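(* For exponentially distributed glue periods, the steady-state mean station sizes are given, for $i=1,\dots,N$, by $$\mathbb E[M_i^o]=\sum_{k=1}^N\Big(\rho_k\Psi_{v,k}^{(\boldsymbol 1_i,0)}+\frac{\mathbb E[G_k]}{\mathbb E[C]}\Psi_{g,k}^{(\boldsymbol 1_i,0)}+\frac{\mathbb E[S_k]}{\mathbb E[C]}\Psi_{s,k}^{(\boldsymbol 1_i)}\Big),$$ $$\mathbb E[M_i^{oq}]=\mathbb E[M_i^o]+\rho_i\Psi_{v,i}^{(\boldsymbol 0,1)}+\frac{\mathbb E[G_i]}{\mathbb E[C]}\Psi_{g,i}^{(\boldsymbol 0,1)},\qquad \mathbb E[M_i]=\mathbb E[M_i^{oq}]+\rho_i .$$
   Context: Model. A single server cyclically visits stations $1,\dots,N$; station indices are modulo $N$. Type-$i$ customers arrive at station $i$ according to a Poisson process with rate $\lambda_i$. Service times at station $i$ are i.i.d. copies of $B_i$; switchover times from station $i$ to station $i+1$ are i.i.d. copies of $S_i$. A cycle consists, for each station $i$ in turn, of: a glue period of station $i$, then a visit period of station $i$, then a switchover from $i$ to $i+1$. Glue periods of station $i$ are i.i.d. copies of $G_i$, exponentially distributed with mean $\mathbb E[G_i]=1/\gamma_i$. Each station has an orbit and a queue. A type-$i$ customer arriving during a glue period of station $i$ joins the queue of station $i$ (is ''glued''); one arriving at any other time joins the orbit of station $i$. Each customer in the orbit of station $i$ retries after independent exponential times with rate $\nu_i$; if a retrial occurs during a glue period of station $i$ the customer moves to the queue of station $i$, otherwise it stays in the orbit. During a visit period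 of station $i$ (gated service) the server serves, one at a time, exactly the customers in the queue of station $i$ at the end of the preceding glue period. All arrival processes, service times, switchover times, glue periods and retrial times are mutually independent. $\rho_i=\lambda_i\mathbb E[B_i]>0$, $\rho=\sum_{i=1}^N\rho_i<1$, $\mathbb E[S_i]>0$, and the system is in steady state. The mean cycle length is $\mathbb E[C]=\dfrac{\sum_{i=1}^N(\mathbb E[G_i]+\mathbb E[S_i])}{1-\rho}$. Steady-state variables at an arbitrary time. $M_i^o$: number of customers in the orbit of station $i$. $\Upsilon$: number of glued customers waiting in the queue (not counting a customer in service). $M_i^{oq}$: number of customers in the orbit of station $i$ plus glued customers waiting in the queue of station $i$. $M_i$: number of customers in station $i$, including the one in service at station $i$, if any. Let $R_g^{(i)}(\mathbf z,w)$ and $R_v^{(i)}(\mathbf z,w)$ be the joint generating functions of $(M_1^o,\dots,M_N^o;\Upsilon)$ (variables $z_1,\dots,z_N;w$) at an arbitrary time point in a glue period, respectively a visit period, of station $i$, and $R_s^{(i)}(\mathbf z)$ that of $(M_1^o,\dots,M_N^o)$ at an arbitrary time point in a switchover period from station $i$ to $i+1$ (steady-state distribution conditioned on being in such a period). With $|\boldsymbol l|=\sum_jl_j$, $\boldsymbol l!=\prod_jl_j!$, $\partial\mathbf z^{\boldsymbol l}=\partial z_1^{l_1}\cdots\partial z_N^{l_N}$, $\boldsymbol 1$ the all-ones vector, $\boldsymbol 1_i$ the $i$-th unit vector and $\boldsymbol 0$ the zero vector, $$\Psi_{g,i}^{(\boldsymbol l,m)}=\frac1{\boldsymbol l!\,m!}\frac{\partial^{|\boldsymbol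 l|+m}R_g^{(i)}(\mathbf z,w)}{\partial\mathbf z^{\boldsymbol l}\partial w^m}\Big|_{\mathbf z=\boldsymbol 1-,w=1-},\quad \Psi_{v,i}^{(\boldsymbol l,m)}=\frac1{\boldsymbol l!\,m!}\frac{\partial^{|\boldsymbol l|+m}R_v^{(i)}(\mathbf z,w)}{\partial\mathbf z^{\boldsymbol l}\partial w^m}\Big|_{\mathbf z=\boldsymbol 1-,w=1-},\quad \Psi_{s,i}^{(\boldsymbol l)}=\frac1{\boldsymbol l!}\frac{\partial^{|\boldsymbol l|}R_s^{(i)}(\mathbf z)}{\partial\mathbf z^{\boldsymbol l}}\Big|_{\mathbf z=\boldsymbol 1-}.$$ *)

(* Defs.v *)
From HB Require Import structures.
From mathcomp Require Import all_boot all_order all_algebra finmap.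
From mathcomp Require Import all_classical all_reals all_analysis.
Set Implicit Arguments.
Unset Strict Implicit.
Unset Printing Implicit Defensive.
Import Order.TTheory GRing.Theory Num.Theory numFieldNormedType.Exports.
Local Open Scope classical_set_scope.
Local Open Scope ring_scope.

(** * Sample paths of the polling system

The N = n.+1 stations are 'I_n.+1, with index 0 for the first one.  The server
starts at time 0 with a glue period of station 0, and the station visits are
numbered 0, 1, 2, ... : visit p is at station p mod N and consists of a glue
period, a visit period and a switchover.

The customers of type i are numbered 0, 1, 2, ... ; those with index below
[x0 i] are in the orbit of station i at time 0, the others arrive later, in
the order of their indices. *)

Inductive clock (n : nat) : Type :=
| interarrival of 'I_n.+1 & nat
    (* [interarrival i k]: time between the arrivals of customers k-1 and k
       of type i *)
| retrial of 'I_n.+1 & nat & nat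
    (* [retrial i k m]: m-th time between retrials of customer k of type i *)
| glue_length of nat
| service of nat & nat
    (* [service p j]: duration of the j-th service during visit p *)
| switchover of nat.

Arguments glue_length {n}.
Arguments service {n}.
Arguments switchover {n}.

Variant phase := InGlue | InVisit | InSwitch.

Record state (n : nat) := State {
  st_phase : phase;
  st_station : 'I_n.+1;
  orbit : {ffun 'I_n.+1 -> nat};
  queue : {ffun 'I_n.+1 -> nat};      (* glued customers not yet in service *)
  in_service : {ffun 'I_n.+1 -> nat}
}.

(* Number of elements of a finite set of naturals; 0 when the set is infinite,
   which has probability 0 in all the uses below. *)
Definition count_set (A : set nat) : nat := #|` fset_set A|%fset.

Definition station {n : nat} (p : nat) : 'I_n.+1 := inZp p.

Section SamplePath.
Context {R : realType} {n : nat}.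
Variables (x0 : 'I_n.+1 -> nat) (c : clock n -> R).

(* The sum is empty, hence 0, for the customers present at time 0. *)
Definition arrival (i : 'I_n.+1) (k : nat) : R :=
  \sum_(x0 i <= j < k.+1) c (interarrival i j).

(* Attempt 0 is the arrival of the customer, attempt m > 0 its m-th retrial: a
   customer joins the queue of its station at its first attempt that falls in
   a glue period of that station. *)
Definition attempt (i : 'I_n.+1) (k m : nat) : R :=
  arrival i k + \sum_(0 <= j < m) c (retrial i k j).

Definition attempts_in (i : 'I_n.+1) (k : nat) (a b : R) : Prop :=
  exists m, a < attempt i k m <= b.

(* Type-i customers glued in a glue period ]t, t + g] of station i, when the
   customers in J have been glued before. *)
Definition glued_set (J : set ('I_n.+1 * nat)) (i : 'I_n.+1) (t g : R)
  : set nat :=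
  [set k | ~ J (i, k) /\ attempts_in i k t (t + g)].

(* Start of the glue period of visit p, and the customers glued before it. *)
Fixpoint history (p : nat) : R * set ('I_n.+1 * nat) :=
  if p is q.+1 then
    let: (t, J) := history q in
    let W := glued_set J (station q) t (c (glue_length q)) in
    (t + c (glue_length q) + \sum_(j < count_set W) c (service q j)
       + c (switchover q),
     J `|` [set x | x.1 = station q /\ W x.2])
  else (0, set0).

Definition glue_start (p : nat) : R := (history p).1.

Definition glue_end (p : nat) : R := glue_start p + c (glue_length p).

(* The customers served during visit p (gated service). *)
Definition batch (p : nat) : set nat :=
  glued_set (history p).2 (station p) (glue_start p) (c (glue_length p)).

Definition batch_size (p : nat) : nat := count_set (batch p).

Definition service_start (p j : nat) : R :=
  glue_end p + \sum_(l < j) c (service p l).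

Definition visit_end (p : nat) : R := service_start p (batch_size p).

(* Index of the station visit in progress at time t. *)
Definition visit_at (t : R) : nat :=
  count_set [set p | glue_start p.+1 <= t].

Definition phase_at (t : R) : phase :=
  let p := visit_at t in
  if t < glue_end p then InGlue
  else if t < visit_end p then InVisit else InSwitch.

Definition orbit_at (t : R) (i : 'I_n.+1) : nat :=
  count_set [set k | arrival i k <= t /\
    ~ exists p, station p = i /\
        attempts_in i k (glue_start p) (Num.min t (glue_end p))].

Definition waiting_at (t : R) (p : nat) : nat :=
  (count_set [set k | batch p k /\
     attempts_in (station p) k (glue_start p) (Num.min t (glue_end p))]
   - \sum_(j < batch_size p) (service_start p j <= t)%R)%N.

Definition queue_at (t : R) (i : 'I_n.+1) : nat :=
  (\sum_(p < (visit_at t).+1 | station p == i) waiting_at t p)%N.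

Definition in_service_at (t : R) (i : 'I_n.+1) : nat :=
  (\sum_(p < (visit_at t).+1 | station p == i)
     \sum_(j < batch_size p) (service_start p j <= t < service_start p j.+1)%R)%N.

Definition state_at (t : R) : state n :=
  State (phase_at t) (station (visit_at t))
    [ffun i => orbit_at t i] [ffun i => queue_at t i]
    [ffun i => in_service_at t i].

End SamplePath.

(** * Stochastic assumptions *)

Definition mutually_independent {d} {T : measurableType d} {R : realType}
    (P : probability T R) (I : Type) (X : I -> {RV P >-> R}) : Prop :=
  forall (m : nat) (f : 'I_m -> I) (A : 'I_m -> set R),
    injective f -> (forall j, measurable (A j)) ->
    P (\bigcap_j (X (f j) @^-1` A j)) = (\prod_(j < m) P (X (f j) @^-1` A j))%E.

Definition has_law {d} {T : measurableType d} {R : realType}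
    (P : probability T R) (X : {RV P >-> R}) (mu : set R -> \bar R) : Prop :=
  forall A, measurable A -> distribution P X A = mu A.

(* A law on [0, +oo[ with a finite mean. *)
Definition duration_law {R : realType} (mu : probability R R) : Prop :=
  mu `[0, +oo[%classic = 1%E /\ mu.-integrable setT (EFin : R -> \bar R).

Definition mean {R : realType} (mu : probability R R) : R :=
  fine (\int[mu]_x x%:E).

Record polling_primitives {d} {T : measurableType d} {R : realType}
    (P : probability T R) (n : nat) (lambda gamma nu : 'I_n.+1 -> R)
    (lawB lawS : 'I_n.+1 -> probability R R) (X : clock n -> {RV P >-> R})
  : Prop := {
  clocks_independent : mutually_independent X;
  interarrival_law : forall i k,
    has_law (X (interarrival i k)) (exponential_prob (lambda i));
  retrial_law : forall i k m,
    has_law (X (retrial i k m)) (exponential_prob (nu i));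
  glue_law : forall p,
    has_law (X (glue_length p)) (exponential_prob (gamma (station p)));
  service_law : forall p j, has_law (X (service p j)) (lawB (station p));
  switchover_law : forall p, has_law (X (switchover p)) (lawS (station p))
}.

(* Y is a random state (on its own probability space) following the steady-state
   distribution, i.e. the limit in law, as t tends to infinity, of the state at
   time t; the state space is countable and discrete. *)
Definition steady_state {d} {T : measurableType d} {R : realType}
    (P : probability T R) (n : nat) (X : clock n -> {RV P >-> R})
    (x0 : 'I_n.+1 -> nat) {d'} {T' : measurableType d'} (Q : probability T' R)
    (Y : T' -> state n) : Prop :=
  (forall y, measurable (Y @^-1` [set y])) /\
  (forall y,
     P [set o | state_at x0 (fun a => X a o) t = y] @[t --> +oo]
       --> Q (Y @^-1` [set y])).

(** * Performance measures *)

Section MeanValues.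
Context {R : realType} {n : nat}.
Variables (lambda gamma : 'I_n.+1 -> R) (lawB lawS : 'I_n.+1 -> probability R R).

Definition load (i : 'I_n.+1) : R := lambda i * mean (lawB i).

Definition total_load : R := \sum_i load i.

Definition mean_glue (i : 'I_n.+1) : R := (gamma i)^-1.

Definition mean_cycle : R :=
  (\sum_i (mean_glue i + mean (lawS i))) / (1 - total_load).

End MeanValues.

Section SteadyState.
Context {R : realType} {n : nat} {d : measure_display} {T : measurableType d}.
Variables (Q : probability T R) (Y : T -> state n).

Definition mean_orbit (i : 'I_n.+1) : \bar R :=
  expectation Q (fun o => (orbit (Y o) i)%:R).

Definition mean_orbit_queue (i : 'I_n.+1) : \bar R :=
  expectation Q (fun o => (orbit (Y o) i + queue (Y o) i)%N%:R).

Definition mean_station (i : 'I_n.+1) : \bar R :=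
  expectation Q
    (fun o => (orbit (Y o) i + queue (Y o) i + in_service (Y o) i)%N%:R).

Definition total_queue (y : state n) : nat := (\sum_j queue y j)%N.

Definition cond_expectation (A : set T) (X : T -> R) : R :=
  fine (expectation Q (fun o => X o * \1_A o)) / fine (Q A).

Definition in_period (s : phase) (i : 'I_n.+1) : set T :=
  [set o | st_phase (Y o) = s /\ st_station (Y o) = i].

Definition joint_gf (s : phase) (i : 'I_n.+1) (z : 'rV[R]_n.+1) (w : R) : R :=
  cond_expectation (in_period s i)
    (fun o => (\prod_j z 0 j ^+ orbit (Y o) j) * w ^+ total_queue (Y o)).

Definition orbit_gf (s : phase) (i : 'I_n.+1) (z : 'rV[R]_n.+1) : R :=
  cond_expectation (in_period s i)
    (fun o => \prod_j z 0 j ^+ orbit (Y o) j).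

Definition R_g := joint_gf InGlue.
Definition R_v := joint_gf InVisit.
Definition R_s := orbit_gf InSwitch.

End SteadyState.

Section FactorialMoments.
Context {R : realType} {n : nat}.

Definition mfact (l : 'I_n.+1 -> nat) : nat := (\prod_j (l j)`!)%N.

Definition unit_index (i : 'I_n.+1) : 'I_n.+1 -> nat := fun j => (j == i).

Definition zero_index : 'I_n.+1 -> nat := fun=> 0%N.

Definition partial (j : 'I_n.+1) (F : 'rV[R]_n.+1 -> R) : 'rV[R]_n.+1 -> R :=
  fun z => 'D_(delta_mx 0 j) F z.

Definition partials (l : 'I_n.+1 -> nat) (F : 'rV[R]_n.+1 -> R)
  : 'rV[R]_n.+1 -> R :=
  foldr (fun j => iter (l j) (partial j)) F (enum 'I_n.+1).

(* The filter z -> 1-, where every coordinate tends to 1 from below. *)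
Definition ones_left : set_system 'rV[R]_n.+1 :=
  within [set z : 'rV[R]_n.+1 | forall j, z 0 j < 1] (nbhs (const_mx 1 : 'rV[R]_n.+1)).

(* Taken in \bar R: the left limits of the derivatives of a generating function
   at 1 may be infinite. *)
Definition Psi (F : 'rV[R]_n.+1 -> R -> R) (l : 'I_n.+1 -> nat) (m : nat)
  : \bar R :=
  lim ((((mfact l * m`!)%N%:R)^-1
        * partials l (fun z => derive1n m (F z) x.2) x.1)%:E
       @[x --> filter_prod ones_left (at_left (1 : R))]).

Definition Psi_s (F : 'rV[R]_n.+1 -> R) (l : 'I_n.+1 -> nat) : \bar R :=
  lim ((((mfact l)%:R)^-1 * partials l F z)%:E @[z --> ones_left]).

End FactorialMoments.

(* Main.v *)
From HB Require Import structures.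
Require Import Defs.
From mathcomp Require Import all_boot all_order all_algebra.
From mathcomp Require Import finmap.
From mathcomp Require Import all_classical all_reals all_analysis.
From mathcomp Require Import measurable_realfun ring lra.
Import Order.TTheory GRing.Theory Num.Theory numFieldNormedType.Exports.
Set Implicit Arguments.
Unset Strict Implicit.
Unset Printing Implicit Defensive.
Local Open Scope classical_set_scope.
Local Open Scope ring_scope.

(** The mean of a function of the steady state is the sum, over stations and
    phases, of its integrals over the events [in_period] (lemma
    [phase_decomposition]).  On such an event of probability q, the derivatives of
    the conditional generating functions at 1- are q^-1 times the integral of the
    number of orbiting, or of queued, customers: below 1 one may differentiate
    under the integral ([power_mean_derivative]), and as the arguments increase to
    1 monotone convergence gives the mean, finite or not ([gf_limit]).  Hence the
    formulas say that q is rho_k for the visit periods, E[G_k]/E[C] for the glue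
    periods and E[S_k]/E[C] for the switchovers, together with two facts about
    the state ([steady_structure]): a queue is empty outside the glue and visit
    periods of its own station, and one customer is in service during a visit
    period.

    The steady state is only known as the limit in law of the state at time t, so
    each q is the limit of the probability that a given kind of period is in
    progress at t.  Glue periods, switchovers, services and interarrival times are
    families of random intervals such that the length of an interval is
    independent of the event that it has started by time t, because other clocks
    decide that event ([free_of_glue] and its analogues,
    [independent_coordinate]).  Wald's identity therefore compares the mean number
    n(T) of the intervals started by T with the mean time covered by them before T,
    up to the overshoot of one interval whose length may be truncated.  If the
    intervals are disjoint, have mean length m, and are in progress at t with a
    probability that tends to q, then n(T)/T tends to q/m ([renewal_rate]).

    The glue periods and switchovers of all stations occur once per cycle, so they
    have a common rate kappa and the corresponding q are kappa E[G_k] and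
    kappa E[S_k] ([glue_prob], [switch_prob]).  The services started at station i
    are the arrivals minus the unserved customers ([unserved_balance]).  The number
    of unserved customers has a limit law and is bounded by a number of arrivals
    that is uniformly integrable on the scale of t, so its mean is o(t)
    ([mean_unserved_rate]); the services thus have the rate lambda_i of the
    arrivals, and q = lambda_i E[B_i] = rho_i for the visit periods ([visit_prob]).
    As the probabilities sum to 1, kappa is 1/E[C] ([cycle_rateE]). *)

(** * Sums over countable types *)

Section countable_sums.
Local Open Scope ereal_scope.
Context {R : realType} {U : countType}.

(** Numbering the index type turns the sum into a series, to which monotone
    convergence applies. *)
Lemma esum_pickle (a : U -> \bar R) : (forall u, 0 <= a u) ->
  \esum_(u in setT) a u = \sum_(k <oo) oapp a 0 (pickle_inv k).
Proof.
move=> a0.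
have oa0 k : 0 <= oapp a 0 (@pickle_inv U k) by case: pickle_inv => [u|] /=.
rewrite nneseries_esumT//.
have -> : \esum_(k in [set: nat]) oapp a 0 (@pickle_inv U k) =
    \esum_(k in @choice.pickle U @` setT) oapp a 0 (@pickle_inv U k).
  rewrite [RHS]esum_mkcond; apply: eq_esum => k _; case: ifPn => // kU.
  have := @pickle_invK U k; case: pickle_inv => [u|] //= uk.
  by move: kU; rewrite -uk; apply: contraNeq => _; rewrite inE; exists u.
rewrite esum_image; last first.
  by move=> u v _ _ uv; exact: (pcan_inj (@choice.pickleK U)).
by apply: eq_esum => u _; rewrite pickleK_inv.
Qed.

Context d (T : measurableType d) (mu : {measure set T -> \bar R}).

Lemma emeasurable_esum (D : set T) (f : U -> T -> \bar R) :
  (forall u, measurable_fun D (f u)) -> (forall u x, 0 <= f u x) ->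
  measurable_fun D (fun x => \esum_(u in setT) f u x).
Proof.
move=> mf f0; rewrite (_ : (fun x => _) =
    fun x => \sum_(k <oo | k \in predT) oapp (f ^~ x) 0 (@pickle_inv U k)); last first.
  by apply/funext => x; rewrite esum_pickle//.
apply: ge0_emeasurable_sum => [k x _ _|k _]; case: pickle_inv => [u|] //=.
Qed.

Lemma integral_esum (D : set T) (f : U -> T -> \bar R) : measurable D ->
  (forall u, measurable_fun D (f u)) -> (forall u x, 0 <= f u x) ->
  \int[mu]_(x in D) (\esum_(u in setT) f u x) =
  \esum_(u in setT) \int[mu]_(x in D) f u x.
Proof.
move=> mD mf f0; rewrite esum_pickle; last by move=> u; exact: integral_ge0.
under eq_integral do rewrite esum_pickle//.
rewrite integral_nneseries//.
- by apply: eq_eseriesr => k _; case: pickle_inv => [u|] //=; rewrite integral0.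
- by move=> k; case: pickle_inv => [u|] //=.
- by move=> k x _; case: pickle_inv => [u|] /=.
Qed.

End countable_sums.

Section countable_sums_scale.
Local Open Scope ereal_scope.
Context {R : realType} {U : countType}.

Lemma esumZl (x : \bar R) (a : U -> \bar R) : 0 <= x -> (forall u, 0 <= a u) ->
  \esum_(u in setT) (x * a u) = x * \esum_(u in setT) a u.
Proof.
move=> x0 a0; rewrite !esum_pickle//; last by move=> u; rewrite mule_ge0.
rewrite -(@ge0_integral_count R (fun k => oapp a 0 (@pickle_inv U k))); last first.
  by move=> k; case: pickle_inv => [u|] /=.
rewrite -ge0_integralZl//=; last first.
  by move=> k _; case: pickle_inv => [u|] /=.
rewrite ge0_integral_count; last first.
  by move=> k; rewrite mule_ge0//; case: pickle_inv => [u|] /=.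
by apply: eq_eseriesr => k _; case: pickle_inv => [u|] /=; rewrite ?mule0.
Qed.

End countable_sums_scale.

(** * Rates of starts by the identity of Wald *)

(** A family of random intervals [a u, a u + L u[, each present on the event
    [Act u].  The hypothesis [wald] says that the length of an interval has the
    given law independently of the event that the interval has started by t. *)
Section busy_intervals.
Local Open Scope ereal_scope.
Context {R : realType} {d : measure_display} {T : measurableType d}.
Variables (P : probability T R) (law : probability R R) (U : countType).
Variables (Act : U -> set T) (a L : U -> T -> R).
Hypothesis mAct : forall u, measurable (Act u).
Hypothesis ma : forall u, measurable_fun setT (a u).
Hypothesis mL : forall u, measurable_fun setT (L u).
Hypothesis a_ge0 : forall u x, Act u x -> (0 <= a u x)%R.

Definition started (t : R) (u : U) : set T :=
  Act u `&` [set x | (a u x <= t)%R].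

Definition busy (t : R) (u : U) : set T :=
  Act u `&` [set x | (a u x <= t < a u x + L u x)%R].

Definition mean_started (t : R) : \bar R := \esum_(u in setT) P (started t u).

Definition mean_busy (t : R) : \bar R := \esum_(u in setT) P (busy t u).

Hypothesis wald : forall t u (f : R -> \bar R),
  measurable_fun setT f -> (forall y, 0 <= f y) ->
  \int[P]_(x in started t u) f (L u x) = (\int[law]_y f y) * P (started t u).

Lemma measurable_started t u : measurable (started t u).
Proof.
apply: measurableI => //; rewrite -[X in measurable X]setTI.
exact: measurable_fun_le.
Qed.

(** Points (x, t) for which the u-th interval covers the time t of [0, T0]: its
    sections are the events [busy t u] and the covered times, so Tonelli exchanges
    the two. *)
Let busy_graph (T0 : R) u : set (T * R) :=
  [set z | Act u z.1 /\ (a u z.1 <= z.2 < a u z.1 + L u z.1)%R] `&`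
  [set z | (0 <= z.2 <= T0)%R].

Let measurable_busy_graph T0 u : measurable (busy_graph T0 u).
Proof.
have m1 : measurable_fun setT (fst : T * R -> T) by exact: measurable_fst.
have m2 : measurable_fun setT (snd : T * R -> R) by exact: measurable_snd.
have ma1 : measurable_fun setT (fun z : T * R => a u z.1).
  exact: measurableT_comp.
have mL1 : measurable_fun setT (fun z : T * R => L u z.1).
  exact: measurableT_comp.
rewrite (_ : busy_graph T0 u = (fst @^-1` Act u) `&`
    [set z | a u z.1 <= z.2]%R `&` [set z | z.2 < a u z.1 + L u z.1]%R `&`
    [set z | 0 <= z.2]%R `&` [set z | z.2 <= T0]%R); last first.
  apply/seteqP; split => z /=.
    by move=> [[Az /andP[z1 z2]] /andP[z3 z4]].
  by move=> [[[[Az z1] z2] z3] z4]; split; [split => //; exact/andP|exact/andP].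
apply: measurableI; last first.
  by rewrite -[X in measurable X]setTI; exact: measurable_fun_le.
apply: measurableI; last first.
  by rewrite -[X in measurable X]setTI; exact: measurable_fun_le.
apply: measurableI; last first.
  rewrite -[X in measurable X]setTI.
  rewrite -[X in _ `&` X]/((fun z => z.2 < a u z.1 + L u z.1)%R @^-1` [set true]).
  apply: measurable_fun_ltr => //; exact: measurable_funD.
apply: measurableI.
  by rewrite -[X in measurable X]setTI; apply: m1.
by rewrite -[X in measurable X]setTI; exact: measurable_fun_le.
Qed.

Let mu : {sigma_finite_measure set _ -> \bar R} := @lebesgue_measure R.

Lemma measurable_busy t u : measurable (busy t u).
Proof.
have := @measurable_ysection _ _ _ _ _ t (measurable_busy_graph t u).
have [t0|t0] := leP 0%R t.
  rewrite [X in measurable X](_ : _ = busy t u)//.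
  apply/seteqP; split => x; rewrite /ysection/= inE.
    by move=> [[Au /= aL] _]; split.
  by move=> [/= Au aL]; split => /=; [split|rewrite t0 lexx].
move=> _; rewrite (_ : busy t u = set0)//.
rewrite -subset0 => x [/[dup] Au /a_ge0 a0 /= /andP[at_ _]].
by have := le_lt_trans (le_trans a0 at_) t0; rewrite ltxx.
Qed.

Lemma measurable_fun_busy (T0 : R) u :
  measurable_fun (`[0%R, T0] : set R) (fun t => P (busy t u)).
Proof.
apply/measurable_restrictT => //.
have := measurable_fun_ysection P (measurable_busy_graph T0 u).
apply: eq_measurable_fun => t _; rewrite patchE.
case: ifPn => [|]; rewrite ?inE ?notin_setE/= in_itv/= => t0.
  congr (P _).
  apply/seteqP; split => x; rewrite /ysection/= inE.
    by move=> [[Au /= aL] _]; split.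
  by move=> [/= Au aL]; split.
by rewrite /= (_ : ysection _ _ = set0) ?measure0// -subset0 => x; rewrite /ysection/= inE => -[_].
Qed.

Let busy_length (T0 : R) u x : \bar R := mu (xsection (busy_graph T0 u) x).

Let measurable_busy_length T0 u : measurable_fun setT (busy_length T0 u).
Proof. exact: (measurable_fun_xsection mu (measurable_busy_graph T0 u)). Qed.

Let integral_busy (T0 : R) u :
  \int[mu]_(t in `[0%R, T0]) P (busy t u) = \int[P]_x busy_length T0 u x.
Proof.
have -> : \int[P]_x busy_length T0 u x =
         \int[mu]_t (P \o ysection (busy_graph T0 u)) t.
  have := indic_fubini_tonelli P mu (measurable_busy_graph T0 u).
  rewrite (indic_fubini_tonelli_FE mu (measurable_busy_graph T0 u)) => ->.
  apply: eq_integral => t _.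
  by have /(congr1 (@^~ t)) := indic_fubini_tonelli_GE P (measurable_busy_graph T0 u).
rewrite [LHS]integral_mkcond; apply: eq_integral => t _ /=; rewrite patchE.
case: ifPn => [|]; rewrite ?inE ?notin_setE/= in_itv/= => t0.
  congr (P _).
  apply/seteqP; split => x; rewrite /ysection/= inE.
    by move=> [/= Au aL]; split.
  by move=> [[Au /= aL] _]; split.
by rewrite /= (_ : ysection _ _ = set0) ?measure0// -subset0 => x; rewrite /ysection/= inE => -[_].
Qed.

Let busy_length_le T0 u x :
  busy_length T0 u x <= (((fun x => (Num.max (L u x) 0)%:E) \_ (started T0 u)) x).
Proof.
rewrite patchE; case: ifPn; rewrite ?inE ?notin_setE => xT.
  apply: (@le_trans _ _ (mu `[a u x, (a u x + L u x)%R]%classic)).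
    rewrite le_measure ?inE//=; first exact: (measurable_xsection _ (measurable_busy_graph T0 u)).
    move=> t; rewrite /xsection/= inE/= in_itv/= => -[[_ /andP[-> /ltW ->]]] _ //.
  rewrite /mu/= lebesgue_measure_itv/=; case: ifPn => _.
    by rewrite -EFinD lee_fin addrAC subrr add0r le_max lexx.
  by rewrite lee_fin le_max lexx orbT.
rewrite (_ : busy_length _ _ _ = 0)// /busy_length (_ : xsection _ _ = set0) ?measure0//.
rewrite -subset0 => t; rewrite /xsection/= inE => -[/= [Au /andP[at_ _]] /andP[_ tT]].
by apply: xT; split => //=; exact: le_trans tT.
Qed.

Let busy_length_ge (K T0 : R) u x : (0 <= K)%R ->
  ((fun x => (Num.min (Num.max (L u x) 0) K)%:E) \_ (started T0 u)) x <=
  busy_length T0 u x + K%:E * (\1_(busy T0 u) x)%:E.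
Proof.
move=> K0; have len0 : 0 <= busy_length T0 u x by exact: measure_ge0.
rewrite patchE; case: ifPn; rewrite ?inE ?notin_setE => xT; last first.
  by rewrite adde_ge0// mule_ge0// lee_fin.
have [xb|xb] := pselect (busy T0 u x).
  rewrite indicE mem_set//= mule1 (le_trans _ (leeDr _ len0))//.
  by rewrite lee_fin ge_min lexx orbT.
rewrite indicE memNset//= mule0 adde0.
case: xT => Au /= aT.
have {}xb : (a u x + L u x <= T0)%R.
  by rewrite leNgt; apply/negP => h; apply: xb; split => //=; rewrite aT.
apply: (@le_trans _ _ (mu `[a u x, (a u x + L u x)%R[%classic)).
  rewrite /mu/= lebesgue_measure_itv/= lte_fin ltrDl; case: ifPn => L0.
    by rewrite -EFinD lee_fin addrAC subrr add0r ge_min max_l ?lexx// ltW.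
  by rewrite lee_fin ge_min max_r ?lexx// leNgt.
rewrite le_measure ?inE//=; first exact: (measurable_xsection _ (measurable_busy_graph T0 u)).
move=> t /=; rewrite in_itv/= /xsection/= inE => /andP[t1 t2].
split => //=; first by split => //; rewrite t1.
by rewrite (le_trans (a_ge0 Au))//= ltW// (lt_le_trans t2).
Qed.

Let integral_mean_busy (T0 : R) :
  \int[mu]_(t in `[0%R, T0]) mean_busy t =
  \esum_(u in setT) \int[P]_x busy_length T0 u x.
Proof.
rewrite integral_esum//; last by move=> u; exact: measurable_fun_busy.
by apply: eq_esum => u _; rewrite integral_busy.
Qed.

Let mlaw (K : R) : measurable_fun setT (fun y : R => (Num.min (Num.max y 0) K)%:E).
Proof.
by apply/measurable_EFinP; apply: measurable_minr => //; exact: measurable_maxr.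
Qed.

(** Every busy interval that meets [0, T0] was started before T0, so the time
    spent busy is at most the total length of the started intervals, whose mean
    is given by Wald's identity. *)
Lemma integral_mean_busy_le (T0 : R) :
  \int[mu]_(t in `[0%R, T0]) mean_busy t <=
  (\int[law]_y (Num.max y 0)%:E) * mean_started T0.
Proof.
rewrite integral_mean_busy -esumZl//; last first.
  by apply: integral_ge0 => y _; rewrite lee_fin le_max lexx orbT.
apply: le_esum => u _.
have mf : measurable_fun setT (fun y : R => (Num.max y 0)%:E).
  by apply/measurable_EFinP; exact: measurable_maxr.
rewrite -wald//; last by move=> y; rewrite lee_fin le_max lexx orbT.
rewrite [leRHS]integral_mkcond; apply: ge0_le_integral => //.
apply/(measurable_restrictT _ _).1; first exact: measurable_started.
apply/measurable_funTS; apply: (measurableT_comp mf); exact: mL.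
Qed.

(** Truncating the lengths at K, the only started interval that can stick out of
    [0, T0] is the one in progress at T0, which contributes at most K. *)
Lemma mean_started_le (K T0 : R) : (0 <= K)%R ->
  (\int[law]_y (Num.min (Num.max y 0) K)%:E) * mean_started T0 <=
  \int[mu]_(t in `[0%R, T0]) mean_busy t + K%:E * mean_busy T0.
Proof.
move=> K0; rewrite integral_mean_busy -esumZl//; last first.
  by apply: integral_ge0 => y _; rewrite lee_fin le_min K0 andbT le_max lexx orbT.
rewrite -esumZl// -esumD; last 2 first.
- by move=> u _; apply: integral_ge0 => x _; exact: measure_ge0.
- by move=> u _; rewrite mule_ge0.
apply: le_esum => u _.
rewrite -wald//; last by move=> y; rewrite lee_fin le_min K0 andbT le_max lexx orbT.
rewrite [leLHS]integral_mkcond.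
have mb : measurable_fun setT (fun x => (\1_(busy T0 u) x)%:E : \bar R).
  by apply/measurable_EFinP; apply: measurable_indic; exact: measurable_busy.
rewrite -(setIT (busy T0 u)) -integral_indic//; last exact: measurable_busy.
rewrite -ge0_integralZl//= -ge0_integralD//=; last 2 first.
- by move=> x _; rewrite mule_ge0// lee_fin.
- exact: measurable_funeM.
apply: ge0_le_integral => //=.
- by move=> x _; apply: erestrict_ge0 => y _; rewrite lee_fin le_min K0 andbT le_max lexx orbT.
- apply/(measurable_restrictT _ _).1; first exact: measurable_started.
  by apply/measurable_funTS; apply: (measurableT_comp (mlaw K)); exact: mL.
- by apply: emeasurable_funD => //; exact: measurable_funeM.
- by move=> x _; exact: busy_length_ge.
Qed.

End busy_intervals.

Section long_run_averages.
Context {R : realType}.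
Let mu : {sigma_finite_measure set _ -> \bar R} := @lebesgue_measure R.

(** Up to the first time after which b is within e/2 of its limit the integral is
    bounded; this part vanishes in the average. *)
Lemma cesaro_mean (b : R -> \bar R) (q : R) :
  (forall T0, measurable_fun (`[0%R, T0] : set R) b) ->
  (forall t, 0 <= t -> (0 <= b t <= 1)%E) ->
  fine (b t) @[t --> +oo] --> q ->
  fine (\int[mu]_(t in `[0%R, T0]) b t)%E / T0 @[T0 --> +oo] --> q.
Proof.
move=> mb b01 bq.
have b_fin t : 0 <= t -> b t \is a fin_num.
  by move=> /b01/andP[b0 b1]; rewrite ge0_fin_numE// (le_lt_trans b1) ?ltry.
apply/cvgrPdist_le => e e0.
have e20 : 0 < e / 2 by rewrite divr_gt0.
move/cvgrPdist_le : bq => /(_ _ e20)[t1 [_ bq]].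
pose t0 := Num.max 0 t1 + 1.
have t00 : 0 < t0 by rewrite ltr_wpDl// le_max lexx.
have t1t0 t : t0 <= t -> t1 < t.
  by apply: lt_le_trans; rewrite (@le_lt_trans _ _ (Num.max 0 t1))// ?le_max ?lexx ?orbT// ltrDl.
have bqt t : t0 <= t -> `|q - fine (b t)| <= e / 2 by move=> /t1t0; exact: bq.
have split_int T0 : t0 <= T0 -> (\int[mu]_(t in `[0%R, T0]) b t =
    \int[mu]_(t in `[0%R, t0]) b t + \int[mu]_(t in `]t0, T0]) b t)%E.
  move=> tT; rewrite -ge0_integral_setU//=.
  - by rewrite -itv_bndbnd_setU// bnd_simp ltW.
  - by rewrite -itv_bndbnd_setU// ?bnd_simp ?ltW//; exact: mb.
  - move=> t [|] /=; rewrite in_itv/= => /andP[t0t _]; first by have /andP[] := b01 _ t0t.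
    by have /andP[] := b01 _ (le_trans (ltW t00) (ltW t0t)).
  - rewrite disj_set2E; apply/eqP; rewrite -subset0 => t [/=].
    by rewrite !in_itv/= => /andP[_ +] /andP[+ _] => /le_lt_trans h /h; rewrite ltxx.
have mb2 T0 : measurable_fun (`]t0, T0] : set R) b.
  apply: (measurable_funS _ _ (mb T0)) => //.
  by move=> t /=; rewrite !in_itv/= => /andP[/ltW t0t ->]; rewrite (le_trans (ltW t00)).
have mu2 T0 : t0 <= T0 -> mu `]t0, T0]%classic = (T0 - t0)%:E.
  move=> tT; rewrite /mu/= lebesgue_measure_itv/= lte_fin; case: ltP => //.
  by move=> Tt; rewrite (@le_anti _ _ T0 t0) ?subrr// tT Tt.
have int1 : (0 <= \int[mu]_(t in `[0%R, t0]) b t <= t0%:E)%E.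
  apply/andP; split.
    by apply: integral_ge0 => t /=; rewrite in_itv/= => /andP[/b01/andP[]].
  apply: (@le_trans _ _ (\int[mu]_(t in `[0%R, t0]) cst 1 t)%E).
    apply: ge0_le_integral => //.
    - by move=> t /=; rewrite in_itv/= => /andP[/b01/andP[]].
    - exact: mb.
    - by move=> t /=; rewrite in_itv/= => /andP[/b01/andP[]].
  rewrite integral_cst// mul1e /mu/= lebesgue_measure_itv/= lte_fin t00.
  by rewrite oppr0 adde0.
have [q0 q1] : 0 <= q + e / 2 /\ q - e / 2 <= 1.
  have /andP[b0 b1] := b01 _ (ltW t00).
  have := bqt _ (lexx _); rewrite ler_norml => /andP[h1 h2].
  have {}b0 : 0 <= fine (b t0) by rewrite fine_ge0.
  have {}b1 : fine (b t0) <= 1 by rewrite -lee_fin fineK// b_fin// ltW.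
  by split; lra.
have int2 T0 : t0 <= T0 -> (((q - e / 2) * (T0 - t0))%:E <=
    \int[mu]_(t in `]t0, T0]) b t <= ((q + e / 2) * (T0 - t0))%:E)%E.
  move=> tT.
  have bt t : (t \in `]t0, T0])%R -> ((q - e / 2)%:E <= b t <= (q + e / 2)%:E)%E.
    rewrite in_itv/= => /andP[t0t tT0]; have t_ge0 := le_trans (ltW t00) (ltW t0t).
    rewrite -(fineK (b_fin _ t_ge0)) !lee_fin.
    have := bqt t (ltW t0t); rewrite ler_norml => /andP[h1 h2].
    by apply/andP; split; lra.
  have b_ge0 t : (t \in `]t0, T0])%R -> (0 <= b t)%E.
    by rewrite in_itv/= => /andP[t0t _]; have /andP[] := b01 _ (le_trans (ltW t00) (ltW t0t)).
  apply/andP; split; last first.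
    rewrite EFinM -mu2// -integral_cst//; apply: ge0_le_integral => //.
      exact: mb2.
    by move=> t /= /bt/andP[].
  apply: (@le_trans _ _ (\int[mu]_(t in `]t0, T0]) cst (Num.max 0 (q - e / 2))%:E t)%E).
    rewrite integral_cst// [X in (_ * X)%E](mu2 _ tT) -EFinM lee_fin ler_wpM2r ?subr_ge0//.
    by rewrite le_max lexx orbT.
  apply: ge0_le_integral => //.
  - by move=> t _; rewrite lee_fin le_max lexx.
  - exact: mb2.
  - move=> t /= tt; rewrite EFin_max ge_max b_ge0//=.
    by have /andP[] := bt _ tt.
near=> T0.
have tT : t0 <= T0 by near: T0; apply: nbhs_pinfty_ge; rewrite num_real.
have T0e : 2 * t0 / e <= T0 by near: T0; apply: nbhs_pinfty_ge; rewrite num_real.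
have T00 : 0 < T0 by exact: lt_le_trans tT.
rewrite split_int//.
move: int1 (int2 _ tT).
set A := (\int[mu]_(t in `[_, _]) _)%E; set B := (\int[mu]_(t in `]_, _]) _)%E.
move=> /andP[A0 A1] /andP[B0 B1].
have Af : A \is a fin_num by rewrite ge0_fin_numE// (le_lt_trans A1) ?ltry.
have Bf : B \is a fin_num.
  by rewrite fin_real// (lt_le_trans _ B0) ?ltNyr// (le_lt_trans B1) ?ltry.
rewrite fineD//.
move: A0 A1 B0 B1; rewrite -{1 2}(fineK Af) -{1 2}(fineK Bf) !lee_fin.
move: (fine A) (fine B) => x y x0 x1 y0 y1.
rewrite -[q in `|q - _|](mulfK (lt0r_neq0 T00)) -mulrBl normrM [X in _ * X]gtr0_norm ?invr_gt0//.
rewrite ler_pdivrMr// ler_norml.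
have : 2 * t0 <= T0 * e by rewrite -ler_pdivrMr.
by move=> h; apply/andP; split; nra.
Unshelve. all: by end_near. Qed.

(** For fixed k the bounds squeeze the ratio between q / m and q / mK k up to a
    vanishing term; k is then taken large. *)
Lemma sandwich_ratio (nT I : R -> R) (mK : nat -> R) (m q : R) : 0 < m ->
  (forall T0, 0 <= T0 -> I T0 <= m * nT T0) ->
  (forall k T0, 0 <= T0 -> mK k * nT T0 <= I T0 + k%:R) ->
  mK k @[k --> \oo] --> m ->
  I T0 / T0 @[T0 --> +oo] --> q ->
  nT T0 / T0 @[T0 --> +oo] --> q / m.
Proof.
move=> m0 In nI mKm Iq; apply/cvgrPdist_lt => e e0.
have : q / mK k @[k --> \oo] --> q / m.
  by apply: cvgM; [exact: cvg_cst|apply: cvgV => //; rewrite gt_eqF].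
move=> /cvgr_lt/(_ (q / m + e)).
rewrite ltrDl => /(_ e0) qmK.
have /cvgr_gt/(_ _ m0) mK0 := mKm.
have [k [mk0 qk]] : exists k, 0 < mK k /\ q / mK k < q / m + e.
  by near \oo => k; exists k; split; near: k.
have lo : \forall T0 \near +oo, (q / m - e) < (I T0 / T0) / m.
  apply: (@cvgr_gt _ _ _ _ _ (q / m)); last by rewrite gtrBl.
  by apply: cvgMr_tmp.
have hi : \forall T0 \near +oo, (I T0 / T0 + k%:R / T0) / mK k < q / m + e.
  apply: (@cvgr_lt _ _ _ _ _ (q / mK k)) => //.
  apply: cvgMr_tmp; rewrite -[q in _ --> q]addr0; apply: cvgD => //.
  rewrite -[0](mulr0 k%:R); apply: cvgMl_tmp.
  apply/gtr0_cvgV0; last exact: cvg_id.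
  by apply: nbhs_pinfty_gt; rewrite num_real.
near=> T0.
have T00 : 0 < T0 by near: T0; apply: nbhs_pinfty_gt; rewrite num_real.
have h1 : q / m - e < I T0 / T0 / m by near: T0.
have h2 : (I T0 / T0 + k%:R / T0) / mK k < q / m + e by near: T0.
have a1 : I T0 / T0 / m <= nT T0 / T0.
  rewrite ler_pdivrMr// mulrAC ler_wpM2r ?invr_ge0 ?(ltW T00)// mulrC.
  exact: In (ltW T00).
have a2 : nT T0 / T0 <= (I T0 / T0 + k%:R / T0) / mK k.
  rewrite ler_pdivlMr// -mulrDl mulrAC ler_wpM2r ?invr_ge0 ?(ltW T00)// mulrC.
  exact: nI (ltW T00).
rewrite ltr_norml; apply/andP; split; lra.
Unshelve. all: by end_near. Qed.

End long_run_averages.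

Lemma cvg_nd_integral {R : realType} d (T : measurableType d)
    (mu : {measure set T -> \bar R}) (g : nat -> T -> \bar R) (f : T -> \bar R) :
  (forall k, measurable_fun setT (g k)) -> (forall k x, (0 <= g k x)%E) ->
  (forall x, nondecreasing_seq (g ^~ x)) ->
  (forall x, g k x @[k --> \oo] --> f x) ->
  (\int[mu]_x g k x)%E @[k --> \oo] --> (\int[mu]_x f x)%E.
Proof.
move=> mg g0 ndg gf.
have -> : f = fun x => limn (g ^~ x).
  by apply/funext => x; apply/esym/cvg_lim.
by apply: cvg_monotone_convergence => // *; exact: g0.
Qed.

(** The maximum with 0 makes the lengths nonnegative for the integral, at no cost:
    the laws of interest live on [0, +oo[. *)
Section truncated_mean.
Context {R : realType} (law : probability R R) (m : R).
Hypothesis law_mean : (\int[law]_y (Num.max y 0)%:E = m%:E)%E.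

Definition trunc_mean (k : nat) : R :=
  fine (\int[law]_y (Num.min (Num.max y 0) k%:R)%:E)%E.

Let trunc_ge0 k (y : R) : 0 <= Num.min (Num.max y 0) k%:R.
Proof. by rewrite le_min ler0n andbT le_max lexx orbT. Qed.

Let mtrunc k : measurable_fun setT (fun y : R => (Num.min (Num.max y 0) k%:R)%:E).
Proof.
by apply/measurable_EFinP; apply: measurable_minr => //; exact: measurable_maxr.
Qed.

Lemma trunc_meanE k :
  (\int[law]_y (Num.min (Num.max y 0) k%:R)%:E = (trunc_mean k)%:E)%E.
Proof.
rewrite /trunc_mean fineK// ge0_fin_numE; last first.
  by apply: integral_ge0 => y _; rewrite lee_fin.
rewrite (@le_lt_trans _ _ m%:E) ?ltry// -law_mean.
apply: ge0_le_integral => //.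
- by move=> y _; rewrite lee_fin.
- by apply/measurable_EFinP; exact: measurable_maxr.
- by move=> y _; rewrite lee_fin ge_min lexx.
Qed.

Lemma trunc_mean_cvg : trunc_mean k @[k --> \oo] --> m.
Proof.
suff : (\int[law]_y (Num.min (Num.max y 0) k%:R)%:E)%E @[k --> \oo] --> m%:E.
  by move=> /fine_cvgP[].
rewrite -law_mean; apply: cvg_nd_integral => //.
- move=> y k l kl /=; rewrite lee_fin le_min ge_min lexx/= ge_min ler_nat kl orbT//.
- move=> y; apply: cvg_EFin; first exact: nearW.
  apply: cvg_near_cst; near=> k; apply/min_l.
  near: k; exact: nbhs_infty_ger.
Unshelve. all: by end_near. Qed.

End truncated_mean.

Section renewal_rate.
Context {R : realType} {d : measure_display} {T : measurableType d}.
Variables (P : probability T R) (law : probability R R) (U : countType).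
Variables (Act : U -> set T) (a L : U -> T -> R).
Hypothesis mAct : forall u, measurable (Act u).
Hypothesis ma : forall u, measurable_fun setT (a u).
Hypothesis mL : forall u, measurable_fun setT (L u).
Hypothesis a_ge0 : forall u x, Act u x -> 0 <= a u x.
Hypothesis wald : forall t u (f : R -> \bar R),
  measurable_fun setT f -> (forall y, (0 <= f y)%E) ->
  (\int[P]_(x in started Act a t u) f (L u x) =
   (\int[law]_y f y) * P (started Act a t u))%E.
Variable m : R.
Hypothesis m_gt0 : 0 < m.
Hypothesis law_mean : (\int[law]_y (Num.max y 0)%:E = m%:E)%E.

Local Notation n_started := (mean_started P Act a).
Local Notation n_busy := (mean_busy P Act a L).

Let mu : {sigma_finite_measure set _ -> \bar R} := @lebesgue_measure R.

Let measurable_mean_busy T0 : measurable_fun (`[0%R, T0] : set R) n_busy.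
Proof. by apply: emeasurable_esum => // u; exact: measurable_fun_busy. Qed.

(** Counting with truncated lengths: the covered time is at most p T0, plus k times
    the probability p of an interval in progress at T0. *)
Lemma mean_started_bound (k : nat) (p T0 : R) : 0 < trunc_mean law k ->
  0 <= T0 -> 0 <= p -> (forall t, 0 <= t <= T0 -> (n_busy t <= p%:E)%E) ->
  (n_started T0 <= ((T0 + k%:R) * p / trunc_mean law k)%:E)%E.
Proof.
move=> c0 T00 p0 bp.
have b0 t : (0 <= n_busy t)%E by apply: esum_ge0.
have := mean_started_le mAct ma mL a_ge0 wald T0 (ler0n R k).
rewrite (trunc_meanE law_mean) => h.
rewrite EFinM muleC lee_pdivlMl//.
apply: (le_trans h); rewrite mulrDl EFinD; apply: leeD.
  rewrite (@le_trans _ _ (\int[mu]_(t in `[0%R, T0]) cst p%:E t)%E)//.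
    apply: ge0_le_integral => //.
    exact: measurable_mean_busy.
  rewrite integral_cst//= /mu/= lebesgue_measure_itv/= lte_fin; case: ltP => T1.
    by rewrite oppr0 adde0 muleC.
  by rewrite mule0 lee_fin mulr_ge0.
by rewrite EFinM lee_wpmul2l// bp// T00 lexx.
Qed.

Hypothesis busy_le1 : forall t, 0 <= t -> (n_busy t <= 1)%E.

Lemma mean_started_fin (T0 : R) : 0 <= T0 -> n_started T0 \is a fin_num.
Proof.
move=> T00; rewrite ge0_fin_numE; last exact: esum_ge0.
have /cvgr_gt/(_ _ m_gt0) := trunc_mean_cvg law_mean.
move=> [k _ /(_ k (leqnn k)) ck].
rewrite (le_lt_trans (mean_started_bound ck T00 ler01 _)) ?ltry//.
by move=> t /andP[t0 _]; exact: busy_le1.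
Qed.

(** The started intervals fill the busy time up to one interval per T0, and their
    mean length is m: the rate of starts is the long-run busy fraction over m. *)
Lemma renewal_rate (q : R) : fine (n_busy t) @[t --> +oo] --> q ->
  fine (n_started T0) / T0 @[T0 --> +oo] --> q / m.
Proof.
move=> bq.
have b0 t : (0 <= n_busy t)%E by apply: esum_ge0.
have b01 t : 0 <= t -> (0 <= n_busy t <= 1)%E.
  by move=> t0; rewrite b0 busy_le1.
have Iq := cesaro_mean measurable_mean_busy b01 bq.
have I_fin T0 : 0 <= T0 -> (\int[mu]_(t in `[0%R, T0]) n_busy t)%E \is a fin_num.
  move=> T00; rewrite ge0_fin_numE; last by apply: integral_ge0.
  rewrite (@le_lt_trans _ _ (\int[mu]_(t in `[0%R, T0]) cst 1 t)%E)//.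
    apply: ge0_le_integral => //.
      exact: measurable_mean_busy.
    by move=> t /=; rewrite in_itv/= => /andP[/busy_le1].
  rewrite integral_cst//= mul1e /mu/= lebesgue_measure_itv/= lte_fin.
  by case: ifPn => _; rewrite ?oppr0 ?adde0 ltry.
apply: (@sandwich_ratio _ (fun T0 => fine (n_started T0)) _ _ _ _ m_gt0 _ _
  (trunc_mean_cvg law_mean) Iq) => [T0 T00|k T0 T00].
  have := integral_mean_busy_le mAct ma mL wald T0.
  by rewrite law_mean -(fineK (mean_started_fin T00)) -(fineK (I_fin _ T00)) -EFinM lee_fin.
have := mean_started_le mAct ma mL a_ge0 wald T0 (ler0n R k).
rewrite (trunc_meanE law_mean) -(fineK (mean_started_fin T00)) -EFinM => h.
rewrite -lee_fin EFinD (fineK (I_fin _ T00)); apply: (le_trans h); apply: leeD => //.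
by rewrite -[leRHS]mule1 lee_wpmul2l// busy_le1.
Qed.

End renewal_rate.

(** * The space of clock paths *)

Section path_space.
Context {R : realType} (I : choiceType).

Definition cylinder (J : {fset I}) (A : I -> set R) : set (I -> R) :=
  [set c | forall i, i \in J -> A i (c i)].

Definition cylinders : set (set (I -> R)) :=
  [set E | exists J A, (forall i, measurable (A i)) /\ E = cylinder J A].

Definition path_space := g_sigma_algebraType cylinders.

Lemma cylinder_measurable J A : (forall i, measurable (A i)) ->
  measurable (cylinder J A : set path_space).
Proof. by move=> mA; apply: sub_sigma_algebra; exists J, A. Qed.

Lemma measurable_coordinate (i : I) :
  measurable_fun setT (fun c : path_space => c i).
Proof.
move=> _ B mB; rewrite setTI.
rewrite (_ : _ @^-1` B = cylinder [fset i]%fset (fun=> B)).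
  exact: cylinder_measurable.
apply/seteqP; split => c /=; first by move=> ci j /[!inE] /eqP ->.
by move=> /(_ i); rewrite inE; exact.
Qed.

Lemma cylinders_setI : setI_closed cylinders.
Proof.
move=> _ _ [J [A [mA ->]]] [K [B [mB ->]]].
exists (J `|` K)%fset.
exists (fun i => (if i \in J then A i else setT) `&` (if i \in K then B i else setT)).
split; first by move=> i; apply: measurableI; case: ifPn.
apply/seteqP; split => c /=.
  by move=> [cA cB] i /[!inE] _; split; case: ifPn => // h; [exact: cA|exact: cB].
move=> h; split => i iJ.
  by have /= := h i; rewrite inE iJ/= => /(_ isT)[].
by have /= := h i; rewrite inE iJ/= orbT => /(_ isT)[].
Qed.

Lemma cylinders_setT : cylinders setT.
Proof. by exists fset0, (fun=> setT); split => //; apply/seteqP; split => c. Qed.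

Lemma measurable_to_path d (T : measurableType d) (f : T -> path_space) :
  (forall i, measurable_fun setT (fun x => f x i)) -> measurable_fun setT f.
Proof.
move=> mf; apply: (@measurability _ _ T path_space setT f cylinders) => //.
move=> _ [_ [J [A [mA ->]]] <-].
rewrite setTI.
rewrite (_ : _ @^-1` _ = \bigcap_(i in [set` J]) ((fun x => f x i) @^-1` A i)).
  apply: fin_bigcap_measurable => // i _.
  by rewrite -[X in measurable X]setTI; exact: mf.
by apply/seteqP; split => x /= h i; exact: h.
Qed.

(** An event free of a is its own preimage by the erasure of the coordinate a, so it is
    described by the other coordinates only. *)
Definition reset (a : I) (c : path_space) : path_space :=
  fun i => if i == a then 0 else c i.

Lemma measurable_reset a : measurable_fun setT (reset a).
Proof.
apply: measurable_to_path => i; rewrite /reset.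
by case: eqP => _; [exact: measurable_cst|exact: measurable_coordinate].
Qed.

(** Independence of E from the clock a, in a pathwise form that can be checked along
    the recursion that defines the schedule. *)
Definition free_of (a : I) (E : set path_space) : Prop :=
  forall c c', (forall i, i != a -> c i = c' i) -> E c -> E c'.

Lemma reset_free a E : free_of a E -> reset a @^-1` E = E.
Proof.
move=> Ea; apply/seteqP; split => c /= /Ea; apply => i.
all: by rewrite /reset => /negPf ->.
Qed.

Section independent_coordinates.
Variable P : probability path_space R.
Hypothesis P_cylinder : forall J A, (forall i, measurable (A i)) ->
  (P (cylinder J A) = \prod_(i <- J) P [set c | A i (c i)])%E.

Let pushforward_reset_measure (a : I) (m : {measure set path_space -> \bar R}) :
  {measure set path_space -> \bar R} :=
  measure_function_pushforward__canonical__measure_function_Measure m (measurable_reset a).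

(** As E is free of a it is its own preimage by the map [reset a].  After composition
    with this map both sides are finite measures of E, and they agree on the
    cylinders, which form a pi-system. *)
Lemma independent_coordinate (a : I) (B : set R) (E : set path_space) :
  measurable B -> measurable E -> free_of a E ->
  (P ([set c | B (c a)] `&` E) = P [set c | B (c a)] * P E)%E.
Proof.
move=> mB mE Ea.
have mBa : measurable [set c : path_space | B (c a)].
  rewrite -[X in measurable X]setTI; exact: measurable_coordinate.
have PB0 : (0 <= fine (P [set c | B (c a)]))%R by rewrite fine_ge0.
pose m1 := pushforward_reset_measure a (mrestr P mBa).
pose m2 : {measure set path_space -> \bar R} :=
  mscale (NngNum PB0) (pushforward_reset_measure a P).
have : m1 E = m2 E; last first.
  rewrite /m1 /m2 /= /mscale/= /pushforward/= /mrestr reset_free// setIC => ->.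
  by rewrite fineK// fin_num_measure.
apply: (@measure_unique _ _ path_space cylinders (fun=> setT) _ _ _ _ m1 m2) => //.
- exact: cylinders_setI.
- by move=> _; exact: cylinders_setT.
- by rewrite bigcup_const.
- move=> _ [J [A [mA ->]]].
  rewrite /m1 /m2 /= /mscale/= /pushforward/= /mrestr fineK ?fin_num_measure//.
  (* The preimage of a cylinder drops the constraint at a, unless that
     constraint excludes the value 0 put there by [reset]. *)
  have [aJA|aJA] := pselect (a \in J -> A a 0).
    have -> : reset a @^-1` cylinder J A = cylinder (J `\ a)%fset A.
      apply/seteqP; split => c /= h i; rewrite /reset ?inE.
        by move=> /andP[ia iJ]; have := h _ iJ; rewrite /reset (negPf ia).
      by case: eqP => [->//|/eqP ia iJ]; apply: h; rewrite !inE ia.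
    have -> : cylinder (J `\ a)%fset A `&` [set c | B (c a)] =
        cylinder (a |` (J `\ a))%fset (fun i => if i == a then B else A i).
      apply/seteqP; split => c /=.
        move=> [h Bc] i; rewrite !inE; case: eqP => [->//|/eqP ia] /= iJ.
        by apply: h; rewrite !inE ia.
      move=> h; split; last by have := h a; rewrite !inE eqxx/=; exact.
      move=> i; rewrite !inE => /andP[ia iJ]; have := h i.
      by rewrite !inE iJ ia orbT (negPf ia); exact.
    rewrite !P_cylinder//; last by move=> i; case: eqP.
    rewrite big_fsetU1 ?inE ?eqxx//=; congr (_ * _)%E.
    rewrite big_seq [RHS]big_seq; apply: eq_bigr => i.
    by rewrite !inE => /andP[/negPf ->].
  have -> : reset a @^-1` cylinder J A = set0.
    rewrite -subset0 => c /= h; apply: aJA => aJ.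
    by have := h a aJ; rewrite /reset eqxx.
  by rewrite set0I !measure0 mule0.
- by move=> _; rewrite /m1/= /pushforward/= /mrestr preimage_setT setTI -ge0_fin_numE// fin_num_measure.
Qed.

(** Wald's identity for one term: the clock a is independent of the event E. *)
Lemma wald_path (a : I) (law : probability R R) (E : set path_space) (f : R -> \bar R) :
  (forall B, measurable B -> P [set c | B (c a)] = law B) ->
  measurable E -> free_of a E ->
  measurable_fun setT f -> (forall y, (0 <= f y)%E) ->
  (\int[P]_(c in E) f (c a) = (\int[law]_y f y) * P E)%E.
Proof.
move=> Pa mE Ea mf f0.
have mfa : measurable_fun setT (fun c : path_space => f (c a)).
  by apply: measurableT_comp => //; exact: measurable_coordinate.
pose m1 : {measure set R -> \bar R} :=
  measure_function_pushforward__canonical__measure_function_Measure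
    (mrestr P mE) (measurable_coordinate a).
have PE0 : (0 <= fine (P E))%R by rewrite fine_ge0.
transitivity (\int[m1]_y f y)%E.
  rewrite /m1 ge0_integral_pushforward//; last exact: measurable_coordinate.
  rewrite preimage_setT.
  transitivity (\int[mrestr P mE]_(c in E) f (c a))%E.
    apply: eq_measure_integral => A mA AE; rewrite /mrestr.
    by congr (P _); apply/esym/setIidPl.
  rewrite [RHS](@ge0_negligible_integral _ _ _ _ setT (~` E))//.
  - by rewrite setTD setCK.
  - exact: measurableC.
  - by move=> c _; exact: f0.
  - by rewrite /= /mrestr setICl measure0.
transitivity (\int[mscale (NngNum PE0) law]_y f y)%E.
  apply: eq_measure_integral => B mB _; rewrite /m1/= /pushforward /mrestr/=.
  rewrite /mscale/= fineK ?fin_num_measure// independent_coordinate// Pa//.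
  by rewrite muleC.
by rewrite ge0_integral_mscale//= fineK ?fin_num_measure// muleC.
Qed.

End independent_coordinates.
End path_space.

(** * The joint law of the clocks *)

Section countable_types.
Variable n : nat.

Definition clock_code (a : clock n) :
    'I_n.+1 * nat + 'I_n.+1 * nat * nat + nat + nat * nat + nat :=
  match a with
  | interarrival i k => inl (inl (inl (inl (i, k))))
  | retrial i k m => inl (inl (inl (inr (i, k, m))))
  | glue_length p => inl (inl (inr p))
  | service p j => inl (inr (p, j))
  | switchover p => inr p
  end.

Definition clock_decode
    (x : 'I_n.+1 * nat + 'I_n.+1 * nat * nat + nat + nat * nat + nat) : clock n :=
  match x with
  | inl (inl (inl (inl (i, k)))) => interarrival i k
  | inl (inl (inl (inr (i, k, m)))) => retrial i k m
  | inl (inl (inr p)) => glue_length p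
  | inl (inr (p, j)) => service p j
  | inr p => switchover p
  end.

Lemma clock_codeK : cancel clock_code clock_decode.
Proof. by case. Qed.

HB.instance Definition _ := Countable.copy (clock n) (can_type clock_codeK).

Definition state_code (y : state n) :=
  (match st_phase y with InGlue => Some true | InVisit => Some false | InSwitch => None end,
   st_station y, Defs.orbit y, queue y, in_service y).

Definition state_decode x : state n :=
  let: (s, i, o, q, v) := x in
  State (match s with Some true => InGlue | Some false => InVisit | None => InSwitch end)
    i o q v.

Lemma state_codeK : cancel state_code state_decode.
Proof. by case=> -[]. Qed.

HB.instance Definition _ := Countable.copy (state n) (can_type state_codeK).

End countable_types.

Section path_law.
Context {R : realType} {d : measure_display} {T : measurableType d}.
Variables (P : probability T R) (n : nat) (X : clock n -> {RV P >-> R}).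

Definition sample (o : T) : path_space (clock n) := fun a => X a o.

Lemma measurable_sample : measurable_fun setT sample.
Proof.
by apply: measurable_to_path => a; exact: (@measurable_funP _ _ _ _ _ (X a)).
Qed.

HB.instance Definition _ :=
  isMeasurableFun.Build _ _ _ _ sample measurable_sample.

Definition path_law : probability (path_space (clock n)) R :=
  distribution P (sample : {mfun T >-> path_space (clock n)}).

Lemma path_lawE (E : set (path_space (clock n))) :
  path_law E = P [set o | E (sample o)].
Proof. by []. Qed.

Lemma path_law_cylinder (J : {fset clock n}) (A : clock n -> set R) :
  mutually_independent X -> (forall a, measurable (A a)) ->
  (path_law (cylinder J A) = \prod_(a <- J) path_law [set c | A a (c a)])%E.
Proof.
move=> indep mA.
pose f (j : 'I_#|` J|) : clock n := tnth (in_tuple (enum_fset J)) j.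
have f_inj : injective f by apply/tuple_uniqP; rewrite /= fset_uniq.
have := indep _ f (fun j => A (f j)) f_inj (fun j => mA _).
rewrite path_lawE (_ : [set o | _] = \bigcap_j (X (f j) @^-1` A (f j))).
  by move=> ->; rewrite [RHS](big_tnth _ _ (enum_fset J)).
apply/seteqP; split => o /= h.
  by move=> j _; apply: h; exact: mem_tnth.
by move=> a aJ; have /tnthP[j ->] : a \in in_tuple (enum_fset J) by []; exact: h.
Qed.

End path_law.

(** A named function, so that it can be declared measurable and its mean computed
    from its tail. *)
Definition pos_part {R : realType} (y : R) : R := Num.max y 0.

Lemma measurable_pos_part {R : realType} : measurable_fun setT (@pos_part R).
Proof. exact: measurable_maxr. Qed.

HB.instance Definition _ {R : realType} :=
  isMeasurableFun.Build _ _ R R pos_part measurable_pos_part.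

Section law_means.
Context {R : realType}.
Local Open Scope ereal_scope.

Lemma mean_max0 (law : probability R R) : law `[0%R, +oo[%classic = 1 ->
  \int[law]_y (Num.max y 0)%:E = \int[law]_y y%:E.
Proof.
move=> law1.
have mN : measurable (~` `[0%R, +oo[%classic : set R) by exact: measurableC.
have N0 : law (~` `[0%R, +oo[%classic) = 0.
  by rewrite probability_setC// law1 subee.
apply: ae_eq_integral => //.
- by apply/measurable_EFinP; exact: measurable_maxr.
- exists (~` `[0%R, +oo[%classic); split => // y /= h; rewrite in_itv/= andbT => y0.
  by apply: h => _; rewrite max_l.
Qed.

Lemma duration_mean (law : probability R R) : duration_law law ->
  \int[law]_y (Num.max y 0)%:E = (mean law)%:E.
Proof.
move=> [law1 ilaw]; rewrite mean_max0// /mean fineK//.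
exact: integrable_fin_num.
Qed.

Variables (law : probability R R) (r : R).
Hypothesis r_gt0 : (0 < r)%R.
Hypothesis law_exp : forall A, measurable A -> law A = exponential_prob r A.

Lemma exponential_nonneg : law `[0%R, +oo[%classic = 1.
Proof.
rewrite law_exp// /exponential_prob -(integral_exponential_pdf r_gt0).
rewrite [LHS]integral_mkcond; apply: eq_integral => x _; rewrite patchE.
case: ifPn => //; rewrite notin_setE => x0.
by rewrite /exponential_pdf patchE memNset.
Qed.

(** The mean is the integral of the tail, and the tail of an exponential law is 1/r
    times its density. *)
Lemma exponential_mean : \int[law]_y (Num.max y 0)%:E = (r^-1)%:E.
Proof.
have := @ge0_expectation_ccdf _ _ _ law (pos_part : {mfun R >-> R}).
rewrite expectation_def => ->; last by move=> y; rewrite le_max lexx orbT.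
transitivity (\int[lebesgue_measure]_(x in `[0%R, +oo[)
    ((r^-1)%:E * (exponential_pdf r x)%:E)).
  rewrite -!(@integral_itv_obnd_cbnd _ 0%R).
  - apply: eq_integral => x; rewrite inE/= in_itv/= andbT => x0.
    rewrite exponential_pdfE ?ltW// -EFinM mulKf ?gt_eqF//.
    rewrite /ccdf /distribution /pushforward.
    have -> : pos_part @^-1` `]x, +oo[%classic = `[0%R, +oo[%classic `\` `[0%R, x]%classic.
      apply/seteqP; split => y /=; rewrite !in_itv/= !andbT.
        rewrite lt_max => /orP[xy|/lt_trans /(_ x0)]; last by rewrite ltxx.
        rewrite (ltW (lt_trans x0 xy))//=; split => //.
        by apply/negP; rewrite -ltNge.
      by move=> [-> /=] /negP; rewrite -ltNge lt_max => ->.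
    rewrite measureD//; last by rewrite -ge0_fin_numE// fin_num_measure.
    rewrite (_ : _ `&` _ = `[0%R, x]%classic); last first.
      apply/setIidPr => y /=; rewrite !in_itv/= andbT => /andP[]//.
    rewrite [X in X - _]exponential_nonneg [X in _ - X]law_exp//.
    rewrite exponential_prob_itv0c//.
    by rewrite -EFinB subKr.
  - apply/measurable_funTS; apply: measurable_funeM.
    by apply/measurable_EFinP; exact: measurable_exponential_pdf.
  - by apply/measurable_funTS; exact: ccdf_measurable.
rewrite ge0_integralZl//=.
- rewrite -[X in _ * X]/(exponential_prob r `[0%R, +oo[%classic).
  by rewrite -law_exp// exponential_nonneg mule1.
- by apply/measurable_funTS/measurable_EFinP; exact: measurable_exponential_pdf.
- by move=> x _; rewrite lee_fin exponential_pdf_ge0// ltW.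
- by rewrite lee_fin invr_ge0 ltW.
Qed.

End law_means.

(** * Measurability of the state at a given time *)

Section discrete_measurability.
Context d (T : measurableType d) {R : realType}.

Definition nat_measurable (f : T -> nat) := forall m, measurable [set x | f x = m].

Lemma measurable_set_le (f g : T -> R) : measurable_fun setT f ->
  measurable_fun setT g -> measurable [set x | f x <= g x].
Proof.
by move=> mf mg; rewrite -[X in measurable X]setTI; exact: measurable_fun_le.
Qed.

Lemma measurable_set_lt (f g : T -> R) : measurable_fun setT f ->
  measurable_fun setT g -> measurable [set x | f x < g x].
Proof.
move=> mf mg; rewrite (_ : [set x | _] = ~` [set x | g x <= f x]).
  exact/measurableC/measurable_set_le.
by apply/seteqP; split => x /=; rewrite real_ltNge ?num_real// => /negP.
Qed.

Lemma measurable_set_and (A B : T -> Prop) : measurable [set x | A x] ->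
  measurable [set x | B x] -> measurable [set x | A x /\ B x].
Proof. by move=> mA mB; apply: measurableI. Qed.

Lemma measurable_set_not (A : T -> Prop) : measurable [set x | A x] ->
  measurable [set x | ~ A x].
Proof. exact: measurableC. Qed.

Lemma measurable_set_exists (A : nat -> T -> Prop) :
  (forall k, measurable [set x | A k x]) -> measurable [set x | exists k, A k x].
Proof.
move=> mA; rewrite (_ : [set x | _] = \bigcup_k [set x | A k x]).
  exact: bigcup_measurable.
by apply/seteqP; split => x /= [k]; exists k.
Qed.

Lemma measurable_set_cst (A : Prop) : measurable [set x : T | A].
Proof.
have [a|a] := pselect A.
  by rewrite (_ : [set x | A] = setT)//; apply/seteqP; split.
by rewrite (_ : [set x | A] = set0)//; apply/seteqP; split.
Qed.

Lemma nat_measurable_cst k : nat_measurable (fun=> k).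
Proof. by move=> m; exact: measurable_set_cst. Qed.

Lemma nat_measurable_random (N : T -> nat) (F : nat -> T -> nat) :
  nat_measurable N -> (forall k, nat_measurable (F k)) ->
  nat_measurable (fun x => F (N x) x).
Proof.
move=> mN mF m.
rewrite (_ : [set x | _] = [set x | exists k, N x = k /\ F k x = m]).
  by apply: measurable_set_exists => k; apply: measurable_set_and; [exact: mN|exact: mF].
by apply/seteqP; split => x /= => [h|[k [<-]]//]; exists (N x).
Qed.

Lemma measurable_fun_random d' (V : measurableType d') (N : T -> nat) (F : nat -> T -> V) :
  nat_measurable N -> (forall k, measurable_fun setT (F k)) ->
  measurable_fun setT (fun x => F (N x) x).
Proof.
move=> mN mF _ B mB; rewrite setTI.
rewrite (_ : _ @^-1` B = [set x | exists k, N x = k /\ (F k @^-1` B) x]).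
  apply: measurable_set_exists => k; apply: measurable_set_and; first exact: mN.
  by rewrite -[X in measurable X]setTI; exact: mF.
by apply/seteqP; split => x /= => [h|[k [<-]]//]; exists (N x).
Qed.

Lemma nat_measurable_comp (f : T -> nat) (g : nat -> nat) :
  nat_measurable f -> nat_measurable (fun x => g (f x)).
Proof.
by move=> mf; apply: (nat_measurable_random (F := fun k _ => g k)) => // k; exact: nat_measurable_cst.
Qed.

Lemma nat_measurable_op (op : nat -> nat -> nat) (f g : T -> nat) :
  nat_measurable f -> nat_measurable g -> nat_measurable (fun x => op (f x) (g x)).
Proof.
move=> mf mg; apply: (nat_measurable_random (F := fun k x => op k (g x))) => // k.
exact: nat_measurable_comp.
Qed.

Lemma nat_measurable_sum (I : Type) (s : seq I) (p : pred I) (F : I -> T -> nat) :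
  (forall i, nat_measurable (F i)) -> nat_measurable (fun x => \sum_(i <- s | p i) F i x)%N.
Proof.
move=> mF; elim: s => [|i s ih].
  by under [fun x => _]eq_fun do rewrite big_nil; exact: nat_measurable_cst.
under [fun x => _]eq_fun do rewrite big_cons.
by case: (p i) => //; exact: nat_measurable_op.
Qed.

Lemma nat_measurable_bool (b : T -> bool) : measurable [set x | b x] ->
  nat_measurable (fun x => nat_of_bool (b x)).
Proof.
move=> mb [|[|m]].
- rewrite (_ : [set x | _] = ~` [set x | b x]); first exact: measurableC.
  by apply/seteqP; split => x /=; case: (b x).
- rewrite (_ : [set x | _] = [set x | b x])//.
  by apply/seteqP; split => x /=; case: (b x).
- rewrite (_ : [set x | _] = set0)//.
  by apply/seteqP; split => x /=; case: (b x).
Qed.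

Lemma count_set_infinite (A : set nat) : ~ finite_set A -> count_set A = 0%N.
Proof. by move=> Ainf; rewrite /count_set /fset_set; case: pselect. Qed.

(** A random set of naturals takes countably many finite values, and each is
    described by countably many memberships; on the infinite ones the count is 0. *)
Lemma nat_measurable_count (A : T -> set nat) :
  (forall k, measurable [set x | A x k]) -> nat_measurable (fun x => count_set (A x)).
Proof.
move=> mA.
have mF (F : {fset nat}) : measurable [set x | A x = [set` F]].
  rewrite (_ : [set x | _] = \bigcap_k [set x | A x k <-> k \in F]).
    apply: bigcap_measurableType => k _; case: (boolP (k \in F)) => kF.
      rewrite (_ : [set x | _] = [set x | A x k])//.
      by apply/seteqP; split => x /= => [[_]|Ak]; [exact|split].
    rewrite (_ : [set x | _] = [set x | ~ A x k]); first exact: measurable_set_not.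
    by apply/seteqP; split => x /= => [[h _] /h|Ak]//; split.
  apply/seteqP; split => x /= => [Ax k _ /=|h]; first by rewrite Ax.
  by apply/seteqP; split => k /= /(h k I).
have mU (D : set {fset nat}) : measurable [set x | exists2 F, D F & A x = [set` F]].
  rewrite (_ : [set x | _] = \bigcup_(F in setT) [set x | D F /\ A x = [set` F]]).
    apply: countable_bigcupT_measurable; first exact: countableP.
    by move=> F; apply: measurable_set_and => //; exact: measurable_set_cst.
  by apply/seteqP; split => x /= => [[F DF AF]|[F _ [DF AF]]]; exists F.
move=> m.
rewrite (_ : [set x | _] = [set x | exists2 F : {fset nat}, #|` F|%fset = m & A x = [set` F]] `|`
    ([set x : T | m = 0%N] `&` ~` [set x | exists2 F : {fset nat}, setT F & A x = [set` F]])).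
  apply: measurableU; first exact: (mU [set F | #|` F|%fset = m]).
  by apply: measurableI; [exact: measurable_set_cst|exact/measurableC/mU].
apply/seteqP; split => x /=.
  have [Afin|Ainf] := pselect (finite_set (A x)).
    by move=> <-; left; exists (fset_set (A x)) => //; rewrite fset_setK.
  rewrite count_set_infinite// => <-; right; split => //= -[F _ AF].
  by apply: Ainf; rewrite AF; exact: finite_fset.
move=> [[F <- ->]|[-> h]]; first by rewrite /count_set set_fsetK.
apply: count_set_infinite => Afin; apply: h.
by exists (fset_set (A x)) => //; rewrite fset_setK.
Qed.

End discrete_measurability.

Section polling_measurability.
Context {R : realType} {n : nat} (x0 : 'I_n.+1 -> nat).
Let Om := path_space (R := R) (clock n).
Implicit Types (c : Om) (i : 'I_n.+1) (p j k m : nat) (t : R).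

Lemma measurable_arrival i k : measurable_fun setT (fun c : Om => arrival x0 c i k).
Proof. by apply: measurable_sum => j; exact: measurable_coordinate. Qed.

Lemma measurable_attempt i k m : measurable_fun setT (fun c : Om => attempt x0 c i k m).
Proof.
apply: measurable_funD; first exact: measurable_arrival.
by apply: measurable_sum => j; exact: measurable_coordinate.
Qed.

Lemma measurable_attempts_in i k (a b : Om -> R) :
  measurable_fun setT a -> measurable_fun setT b ->
  measurable [set c : Om | attempts_in x0 c i k (a c) (b c)].
Proof.
move=> ma mb; apply: measurable_set_exists => m.
rewrite (_ : [set c | _] = [set c : Om | a c < attempt x0 c i k m /\ attempt x0 c i k m <= b c]).
  apply: measurable_set_and.
    by apply: measurable_set_lt => //; exact: measurable_attempt.
  by apply: measurable_set_le => //; exact: measurable_attempt.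
by apply/seteqP; split => c /= /andP.
Qed.

Definition glued_before (c : Om) p : set ('I_n.+1 * nat) := (history x0 c p).2.

Lemma batchE c p k : batch x0 c p k <->
  ~ glued_before c p (station p, k) /\
  attempts_in x0 c (station p) k (glue_start x0 c p) (glue_end x0 c p).
Proof. by []. Qed.

Lemma glue_startS c p :
  glue_start x0 c p.+1 = visit_end x0 c p + c (switchover p).
Proof.
rewrite /visit_end /service_start /glue_end /batch_size /batch /glue_start /=.
by case: (history x0 c p).
Qed.

Lemma glued_beforeS c p : glued_before c p.+1 =
  glued_before c p `|` [set x | x.1 = station p /\ batch x0 c p x.2].
Proof.
rewrite /glued_before /batch /glue_start /=.
by case: (history x0 c p).
Qed.

Lemma measurable_service_start_of p j :
  measurable_fun setT (fun c : Om => glue_start x0 c p) ->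
  measurable_fun setT (fun c : Om => service_start x0 c p j).
Proof.
move=> mg; apply: measurable_funD; last first.
  by apply: measurable_sum => l; exact: measurable_coordinate.
by apply: measurable_funD => //; exact: measurable_coordinate.
Qed.

(** The visit p starts after a random number of services of the visit before it, so
    the start and the glued customers are measurable by a joint induction. *)
Lemma measurable_history p :
  measurable_fun setT (fun c : Om => glue_start x0 c p) /\
  forall x, measurable [set c : Om | glued_before c p x].
Proof.
elim: p => [|p [mg mJ]].
  split; first exact: measurable_cst.
  by move=> x; exact: measurable_set_cst.
have mb k : measurable [set c : Om | batch x0 c p k].
  apply: measurable_set_and; first by apply: measurable_set_not; exact: mJ.
  apply: measurable_attempts_in; first exact: mg.
  by apply: measurable_funD; [exact: mg|exact: measurable_coordinate].
split.
  under [fun c => _]eq_fun do rewrite glue_startS.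
  apply: measurable_funD; last exact: measurable_coordinate.
  apply: (measurable_fun_random (N := fun c => batch_size x0 c p)
    (F := fun k c => service_start x0 c p k)); first exact: nat_measurable_count.
  by move=> k; exact: measurable_service_start_of.
move=> x; under [fun c => _]eq_fun do rewrite glued_beforeS.
rewrite (_ : mkset _ = [set c : Om | glued_before c p x] `|`
  [set c : Om | x.1 = station p /\ batch x0 c p x.2])//.
by apply: measurableU => //; apply: measurable_set_and => //; exact: measurable_set_cst.
Qed.

Lemma measurable_glue_start p : measurable_fun setT (fun c : Om => glue_start x0 c p).
Proof. exact: (measurable_history p).1. Qed.

Lemma measurable_glue_end p : measurable_fun setT (fun c : Om => glue_end x0 c p).
Proof.
by apply: measurable_funD; [exact: measurable_glue_start|exact: measurable_coordinate].
Qed.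

Lemma measurable_batch p k : measurable [set c : Om | batch x0 c p k].
Proof.
apply: measurable_set_and; first by apply: measurable_set_not; exact: (measurable_history p).2.
by apply: measurable_attempts_in; [exact: measurable_glue_start|exact: measurable_glue_end].
Qed.

Lemma nat_measurable_batch_size p : nat_measurable (fun c : Om => batch_size x0 c p).
Proof. by apply: nat_measurable_count => k; exact: measurable_batch. Qed.

Lemma measurable_service_start p j :
  measurable_fun setT (fun c : Om => service_start x0 c p j).
Proof. by apply: measurable_service_start_of; exact: measurable_glue_start. Qed.

Lemma measurable_visit_end p : measurable_fun setT (fun c : Om => visit_end x0 c p).
Proof.
apply: (measurable_fun_random (N := fun c => batch_size x0 c p)
  (F := fun k c => service_start x0 c p k)); first exact: nat_measurable_batch_size.
by move=> k; exact: measurable_service_start.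
Qed.

Lemma nat_measurable_visit_at t : nat_measurable (fun c : Om => visit_at x0 c t).
Proof.
apply: nat_measurable_count => k /=.
by apply: measurable_set_le; [exact: measurable_glue_start|exact: measurable_cst].
Qed.

Lemma measurable_phase_at t s : measurable [set c : Om | phase_at x0 c t = s].
Proof.
have mg : measurable [set c : Om | t < glue_end x0 c (visit_at x0 c t)].
  apply: measurable_set_lt; first exact: measurable_cst.
  apply: (measurable_fun_random (N := fun c => visit_at x0 c t)
    (F := fun k c => glue_end x0 c k)); first exact: nat_measurable_visit_at.
  by move=> k; exact: measurable_glue_end.
have mv : measurable [set c : Om | t < visit_end x0 c (visit_at x0 c t)].
  apply: measurable_set_lt; first exact: measurable_cst.
  apply: (measurable_fun_random (N := fun c => visit_at x0 c t)
    (F := fun k c => visit_end x0 c k)); first exact: nat_measurable_visit_at.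
  by move=> k; exact: measurable_visit_end.
case: s.
- rewrite (_ : [set c | _] = [set c : Om | t < glue_end x0 c (visit_at x0 c t)])//.
  by apply/seteqP; split => c /=; rewrite /phase_at; do ?case: ifPn.
- rewrite (_ : [set c | _] = [set c : Om | t < visit_end x0 c (visit_at x0 c t)] `\`
      [set c : Om | t < glue_end x0 c (visit_at x0 c t)]); first exact: measurableD.
  apply/seteqP; split => c /=; rewrite /phase_at; first by do ?case: ifPn.
  by move=> [tv /negP/negPf ->]; rewrite tv.
- rewrite (_ : [set c | _] = ~` ([set c : Om | t < visit_end x0 c (visit_at x0 c t)] `|`
      [set c : Om | t < glue_end x0 c (visit_at x0 c t)])).
    by apply: measurableC; exact: measurableU.
  apply/seteqP; split => c /=; rewrite /phase_at; case: ifPn => // h1.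
  + by case: ifPn => // /negP h2 _ [//|]; exact/negP.
  + by case; right.
  + by case: ifPn => // h2 []; left.
Qed.

Lemma measurable_glued_by i k p t : measurable [set c : Om |
  attempts_in x0 c i k (glue_start x0 c p) (Num.min t (glue_end x0 c p))].
Proof.
apply: measurable_attempts_in; first exact: measurable_glue_start.
by apply: measurable_minr; [exact: measurable_cst|exact: measurable_glue_end].
Qed.

Lemma nat_measurable_orbit_at t i : nat_measurable (fun c : Om => orbit_at x0 c t i).
Proof.
apply: nat_measurable_count => k; apply: measurable_set_and.
  by apply: measurable_set_le; [exact: measurable_arrival|exact: measurable_cst].
apply: measurable_set_not; apply: measurable_set_exists => p.
by apply: measurable_set_and; [exact: measurable_set_cst|exact: measurable_glued_by].
Qed.

Lemma nat_measurable_waiting_at t p : nat_measurable (fun c : Om => waiting_at x0 c t p).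
Proof.
apply: nat_measurable_op.
  apply: nat_measurable_count => k; apply: measurable_set_and.
    exact: measurable_batch.
  exact: measurable_glued_by.
apply: (nat_measurable_random (N := fun c => batch_size x0 c p)
  (F := fun l c => \sum_(j < l) (service_start x0 c p j <= t)%R)%N).
  exact: nat_measurable_batch_size.
move=> k; apply: nat_measurable_sum => j; apply: nat_measurable_bool.
by apply: measurable_set_le; [exact: measurable_service_start|exact: measurable_cst].
Qed.

Lemma nat_measurable_queue_at t i : nat_measurable (fun c : Om => queue_at x0 c t i).
Proof.
apply: (nat_measurable_random (N := fun c => visit_at x0 c t)
  (F := fun l c => \sum_(p < l.+1 | station p == i) waiting_at x0 c t p)%N).
  exact: nat_measurable_visit_at.
by move=> k; apply: nat_measurable_sum => p; exact: nat_measurable_waiting_at.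
Qed.

Lemma nat_measurable_in_service_at t i :
  nat_measurable (fun c : Om => in_service_at x0 c t i).
Proof.
apply: (nat_measurable_random (N := fun c => visit_at x0 c t)
  (F := fun l c => \sum_(p < l.+1 | station p == i) \sum_(j < batch_size x0 c p)
    (service_start x0 c p j <= t < service_start x0 c p j.+1)%R)%N).
  exact: nat_measurable_visit_at.
move=> k; apply: nat_measurable_sum => p.
apply: (nat_measurable_random (N := fun c => batch_size x0 c p)
  (F := fun l c => \sum_(j < l)
    (service_start x0 c p j <= t < service_start x0 c p j.+1)%R)%N).
  exact: nat_measurable_batch_size.
move=> l; apply: nat_measurable_sum => j; apply: nat_measurable_bool.
rewrite (_ : [set c | _] = [set c : Om | service_start x0 c p j <= t /\
    t < service_start x0 c p j.+1]).
  apply: measurable_set_and.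
    by apply: measurable_set_le; [exact: measurable_service_start|exact: measurable_cst].
  by apply: measurable_set_lt; [exact: measurable_cst|exact: measurable_service_start].
by apply/seteqP; split => c /= /andP.
Qed.

Lemma measurable_state_at t y : measurable [set c : Om | state_at x0 c t = y].
Proof.
case: y => s st o q v.
rewrite (_ : [set c | _] = [set c : Om | phase_at x0 c t = s] `&`
   [set c : Om | exists k, visit_at x0 c t = k /\ station k = st] `&`
   \bigcap_(i in [set: 'I_n.+1]) ([set c : Om | orbit_at x0 c t i = o i] `&`
     [set c : Om | queue_at x0 c t i = q i] `&`
     [set c : Om | in_service_at x0 c t i = v i])).
  apply: measurableI; [apply: measurableI|].
  - exact: measurable_phase_at.
  - apply: measurable_set_exists => k; apply: measurable_set_and.
      exact: nat_measurable_visit_at.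
    exact: measurable_set_cst.
  - apply: fin_bigcap_measurable => // i _; apply: measurableI; [apply: measurableI|].
    + exact: nat_measurable_orbit_at.
    + exact: nat_measurable_queue_at.
    + exact: nat_measurable_in_service_at.
apply/seteqP; split => c /=.
  move=> [-> <- <- <- <-]; split; first by split => //; exists (visit_at x0 c t).
  by move=> i _ /=; rewrite !ffunE.
move=> [[<- [k [kv <-]]] h]; rewrite /state_at kv; congr State.
- by apply/ffunP => i; rewrite ffunE; have [[]] := h i I.
- by apply/ffunP => i; rewrite ffunE; have [[]] := h i I.
- by apply/ffunP => i; rewrite ffunE; have [[]] := h i I.
Qed.

End polling_measurability.

(** * Which clocks determine the schedule *)

Section dependence.
Context {R : realType} {n : nat} (x0 : 'I_n.+1 -> nat).
Implicit Types (c : clock n -> R) (i : 'I_n.+1) (p j k m : nat) (t : R).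

(** The clocks that can influence the start of visit p: all the arrivals and
    retrials, and the lengths drawn during the earlier visits. *)
Definition before_visit p (a : clock n) : bool :=
  match a with
  | interarrival _ _ | retrial _ _ _ => true
  | glue_length q | service q _ | switchover q => (q < p)%N
  end.

Definition agree (s : pred (clock n)) c c' := forall a, s a -> c a = c' a.

Lemma attempt_agree p c c' : agree (before_visit p) c c' ->
  attempt x0 c = attempt x0 c'.
Proof.
move=> cc; apply/funext => i; apply/funext => k; apply/funext => m.
by congr (_ + _); apply: eq_bigr => j _; exact: cc.
Qed.

Lemma history_agree p c c' : agree (before_visit p) c c' ->
  history x0 c p = history x0 c' p.
Proof.
elim: p => //= p ih cc.
have ce : history x0 c p = history x0 c' p.
  by apply: ih => -[i k|i k m|q|q j|q] /= h; apply: cc => //=; exact: leqW.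
have gE : glued_set x0 c = glued_set x0 c'.
  by rewrite /glued_set /attempts_in (attempt_agree cc).
rewrite ce gE; case: (history _ _ _) => t J /=.
rewrite (cc (glue_length p)) /before_visit//= (cc (switchover p)) /before_visit//=.
congr (_ + _ + _, _); apply: eq_bigr => j _; apply: cc.
by rewrite /= ltnSn.
Qed.

Lemma batch_size_agree p c c' : agree (before_visit p) c c' ->
  c (glue_length p) = c' (glue_length p) ->
  batch_size x0 c p = batch_size x0 c' p.
Proof.
move=> cc cg; rewrite /batch_size /batch /glue_start (history_agree cc) cg.
by rewrite /glued_set /attempts_in (attempt_agree cc).
Qed.

Lemma service_start_agree p j c c' : agree (before_visit p) c c' ->
  c (glue_length p) = c' (glue_length p) ->
  (forall l, (l < j)%N -> c (service p l) = c' (service p l)) ->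
  service_start x0 c p j = service_start x0 c' p j.
Proof.
move=> cc cg cs; rewrite /service_start /glue_end /glue_start (history_agree cc) cg.
by congr (_ + _); apply: eq_bigr => l _; exact: cs.
Qed.

Lemma agree_before p a c c' : ~~ before_visit p a ->
  (forall b, b != a -> c b = c' b) -> agree (before_visit p) c c'.
Proof.
move=> pa cc b pb; apply: cc; apply: contraNneq pa => <- //.
Qed.

(** In this lemma and its analogues the event is that the interval ruled by the clock
    has started in [0, t]. *)
Lemma free_of_glue p t : free_of (glue_length p)
  ([set c | 0 <= glue_start x0 c p] `&` [set c | glue_start x0 c p <= t]).
Proof.
move=> c c' cc /=; rewrite /glue_start (@history_agree p c c')//.
by apply: agree_before cc; rewrite /= ltnn.
Qed.

Lemma free_of_service p j t : free_of (service p j)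
  ([set c | (j < batch_size x0 c p)%N /\ 0 <= service_start x0 c p j] `&`
   [set c | service_start x0 c p j <= t]).
Proof.
move=> c c' cc /=.
have ag : agree (before_visit p) c c' by apply: agree_before cc; rewrite /= ltnn.
have cg : c (glue_length p) = c' (glue_length p) by apply: cc; apply/eqP.
rewrite (batch_size_agree ag cg) (service_start_agree ag cg)//.
by move=> l lj; apply: cc; apply/eqP => -[ljE]; rewrite ljE ltnn in lj.
Qed.

Lemma free_of_switchover p t : free_of (switchover p)
  ([set c | 0 <= visit_end x0 c p] `&` [set c | visit_end x0 c p <= t]).
Proof.
move=> c c' cc /=.
have ag : agree (before_visit p) c c' by apply: agree_before cc; rewrite /= ltnn.
have cg : c (glue_length p) = c' (glue_length p) by apply: cc; apply/eqP.
rewrite /visit_end (batch_size_agree ag cg) (service_start_agree ag cg)//.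
by move=> l lj; apply: cc; apply/eqP.
Qed.

(** The time from which the m-th new customer of type i, counted from 0, is awaited:
    the customers with an index below [x0 i] are there from the outset. *)
Definition renewal_time c i m : R :=
  \sum_(x0 i <= j < x0 i + m) c (interarrival i j).

Lemma renewal_time0 c i : renewal_time c i 0 = 0.
Proof. by rewrite /renewal_time addn0 big_geq. Qed.

Lemma renewal_timeS c i m :
  renewal_time c i m.+1 = renewal_time c i m + c (interarrival i (x0 i + m)).
Proof. by rewrite /renewal_time addnS big_nat_recr//= leq_addr. Qed.

Lemma arrivalE c i m : arrival x0 c i (x0 i + m) = renewal_time c i m.+1.
Proof. by rewrite /arrival /renewal_time addnS. Qed.

Lemma arrival_initial c i k : (k < x0 i)%N -> arrival x0 c i k = 0.
Proof. by move=> kx; rewrite /arrival big_geq. Qed.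

Lemma measurable_renewal_time i m :
  measurable_fun setT (fun c : path_space (clock n) => renewal_time c i m).
Proof. by apply: measurable_sum => j; exact: measurable_coordinate. Qed.

Lemma free_of_interarrival i m t : free_of (interarrival i (x0 i + m))
  ([set c | 0 <= renewal_time c i m] `&` [set c | renewal_time c i m <= t]).
Proof.
move=> c c' cc /=; rewrite (_ : renewal_time c i m = renewal_time c' i m)//.
apply: eq_big_nat => j /andP[_ jm]; apply: cc.
by apply/eqP => -[jE]; rewrite jE ltnn in jm.
Qed.

End dependence.

Lemma step_unique {R : realType} (f : nat -> R) (p q : nat) (t : R) :
  {homo f : j k / (j <= k)%N >-> j <= k} ->
  f p <= t < f p.+1 -> f q <= t < f q.+1 -> p = q.
Proof.
move=> fh /andP[p1 p2] /andP[q1 q2]; apply/eqP; rewrite eqn_leq.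
apply/andP; split; rewrite leqNgt; apply/negP => /fh h.
  by have := lt_le_trans q2 (le_trans h p1); rewrite ltxx.
by have := lt_le_trans p2 (le_trans h q1); rewrite ltxx.
Qed.

(** * Order of the events along a path *)

Section nonnegative_paths.
Context {R : realType} {n : nat} (x0 : 'I_n.+1 -> nat) (c : clock n -> R).
Hypothesis c_ge0 : forall a, 0 <= c a.
Implicit Types (i : 'I_n.+1) (p q j k m : nat) (t : R).

Lemma glue_start_le_end p : glue_start x0 c p <= glue_end x0 c p.
Proof. by rewrite lerDl. Qed.

Lemma service_startS p j :
  service_start x0 c p j.+1 = service_start x0 c p j + c (service p j).
Proof. by rewrite /service_start big_ord_recr addrA. Qed.

Lemma service_start0 p : service_start x0 c p 0 = glue_end x0 c p.
Proof. by rewrite /service_start big_ord0 addr0. Qed.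

Lemma service_start_homo p : {homo service_start x0 c p : j k / (j <= k)%N >-> j <= k}.
Proof.
apply: homo_leq => [x|y x z|j]; [exact: lexx|exact: le_trans|].
by rewrite service_startS lerDl.
Qed.

Lemma glue_end_le_service p j : glue_end x0 c p <= service_start x0 c p j.
Proof. by rewrite -service_start0 service_start_homo. Qed.

Lemma glue_end_le_visit_end p : glue_end x0 c p <= visit_end x0 c p.
Proof. exact: glue_end_le_service. Qed.

Lemma visit_end_le p : visit_end x0 c p <= glue_start x0 c p.+1.
Proof. by rewrite glue_startS lerDl. Qed.

Lemma glue_start_homo : {homo glue_start x0 c : p q / (p <= q)%N >-> p <= q}.
Proof.
apply: homo_leq => [x|y x z|p]; [exact: lexx|exact: le_trans|].
apply: le_trans (visit_end_le p); apply: le_trans (glue_end_le_visit_end p).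
exact: glue_start_le_end.
Qed.

Lemma glue_start_ge0 p : 0 <= glue_start x0 c p.
Proof. by have := glue_start_homo (leq0n p). Qed.

Lemma visit_unique p q t : glue_start x0 c p <= t < glue_start x0 c p.+1 ->
  glue_start x0 c q <= t < glue_start x0 c q.+1 -> p = q.
Proof. exact: step_unique glue_start_homo. Qed.

Lemma service_unique p j k t :
  service_start x0 c p j <= t < service_start x0 c p j.+1 ->
  service_start x0 c p k <= t < service_start x0 c p k.+1 -> j = k.
Proof. exact: step_unique (@service_start_homo p). Qed.

Lemma in_glue_in_cycle p t : glue_start x0 c p <= t < glue_end x0 c p ->
  glue_start x0 c p <= t < glue_start x0 c p.+1.
Proof.
move=> /andP[-> /= h]; apply: (lt_le_trans h).
exact: le_trans (glue_end_le_visit_end p) (visit_end_le p).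
Qed.

Lemma in_service_in_cycle p j t : (j < batch_size x0 c p)%N ->
  service_start x0 c p j <= t < service_start x0 c p j.+1 ->
  glue_start x0 c p <= t < glue_start x0 c p.+1.
Proof.
move=> jb /andP[h1 h2]; apply/andP; split.
  by apply: le_trans h1; apply: le_trans (glue_start_le_end p) (glue_end_le_service p j).
apply: (lt_le_trans h2); apply: le_trans (visit_end_le p).
exact: service_start_homo.
Qed.

Lemma in_switchover_in_cycle p t : visit_end x0 c p <= t < glue_start x0 c p.+1 ->
  glue_start x0 c p <= t < glue_start x0 c p.+1.
Proof.
move=> /andP[h ->]; rewrite andbT; apply: le_trans h.
exact: le_trans (glue_start_le_end p) (glue_end_le_visit_end p).
Qed.

Lemma arrival_le_attempt i k m : arrival x0 c i k <= attempt x0 c i k m.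
Proof. by rewrite lerDl sumr_ge0. Qed.

Lemma renewal_time_homo i : {homo renewal_time x0 c i : j k / (j <= k)%N >-> j <= k}.
Proof.
apply: homo_leq => [x|y x z|j]; [exact: lexx|exact: le_trans|].
by rewrite renewal_timeS lerDl.
Qed.

Lemma renewal_time_ge0 i m : 0 <= renewal_time x0 c i m.
Proof. by rewrite -(renewal_time0 x0 c i) renewal_time_homo. Qed.

Lemma renewal_unique i j k t :
  renewal_time x0 c i j <= t < renewal_time x0 c i j.+1 ->
  renewal_time x0 c i k <= t < renewal_time x0 c i k.+1 -> j = k.
Proof. exact: step_unique (@renewal_time_homo i). Qed.

End nonnegative_paths.

(** * The state along a path that runs through all visits *)

Section counting.
Implicit Types (A B : set nat).

Lemma count_set_II k : count_set `I_k = k.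
Proof. by apply: card_fset_set; exact: card_eqxx. Qed.

Lemma count_set0 : count_set set0 = 0%N.
Proof. by rewrite /count_set fset_set0 cardfs0. Qed.

Lemma count_setU A B : finite_set A -> finite_set B -> A `&` B = set0 ->
  count_set (A `|` B) = (count_set A + count_set B)%N.
Proof.
move=> fA fB AB; rewrite /count_set fset_setU// cardfsU -fset_setI// AB.
by rewrite fset_set0 cardfs0 subn0.
Qed.

Lemma le_count_set A B : finite_set B -> A `<=` B -> (count_set A <= count_set B)%N.
Proof.
move=> fB AB; apply: fsubset_leq_card.
by rewrite -fset_set_sub//; exact: sub_finite_set fB.
Qed.

Lemma count_set_bigcup (G : nat -> set nat) (b : pred nat) N :
  (forall p, finite_set (G p)) ->
  (forall p q k, b p -> b q -> G p k -> G q k -> p = q) ->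
  finite_set [set k | exists p, (p < N)%N /\ b p /\ G p k] /\
  count_set [set k | exists p, (p < N)%N /\ b p /\ G p k] =
  (\sum_(p < N | b p) count_set (G p))%N.
Proof.
move=> fG dG; elim: N => [|N [fN ih]].
  rewrite big_ord0 (_ : mkset _ = set0); first by split; [|exact: count_set0].
  by apply/seteqP; split => k //= -[p []].
rewrite big_mkcond big_ord_recr -big_mkcond/= -ih.
have [bN|bN] := boolP (b N).
  rewrite (_ : mkset _ = [set k | exists p, (p < N)%N /\ b p /\ G p k] `|` G N).
    rewrite count_setU//; first by split => //; rewrite finite_setU.
    apply/seteqP; split => k //= -[[p [pN [bp Gp]]] GN].
    by move: pN; rewrite (dG _ _ _ bp bN Gp GN) ltnn.
  apply/seteqP; split => k /=.
    move=> [p [+ [bp Gp]]]; rewrite ltnS leq_eqVlt => /orP[/eqP pN|pN].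
      by right; rewrite -pN.
    by left; exists p.
  move=> [[p [pN [bp Gp]]]|GN]; first by exists p; split => //; exact: leqW.
  by exists N.
rewrite addn0 (_ : mkset _ = [set k | exists p, (p < N)%N /\ b p /\ G p k])//.
apply/seteqP; split => k /= [p [pN [bp Gp]]]; exists p; split => //; last exact: leqW.
move: pN; rewrite ltnS leq_eqVlt => /orP[/eqP pN|//].
by rewrite pN (negPf bN) in bp.
Qed.

End counting.

Section divergent_paths.
Context {R : realType} {n : nat} (x0 : 'I_n.+1 -> nat) (c : clock n -> R).
Hypothesis c_ge0 : forall a, 0 <= c a.
Hypothesis arrivals_diverge : forall i (t : R), exists m, t < renewal_time x0 c i m.
Hypothesis cycles_diverge : forall t : R, exists p, t < glue_start x0 c p.
Implicit Types (i : 'I_n.+1) (p q j k m : nat) (t : R).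

(** An unbounded sequence that starts below t has a last term below t before it first
    exceeds t. *)
Lemma step_exists (f : nat -> R) t : f 0%N <= t -> (exists p, t < f p) ->
  exists p, f p <= t < f p.+1.
Proof.
move=> f0 ex; case: (ex_minnP ex) => -[|p] tp pmin.
  by move: (lt_le_trans tp f0); rewrite ltxx.
exists p; rewrite tp andbT leNgt; apply/negP => /pmin.
by rewrite ltnn.
Qed.

Lemma visit_atP t : 0 <= t ->
  glue_start x0 c (visit_at x0 c t) <= t < glue_start x0 c (visit_at x0 c t).+1.
Proof.
move=> t0; have [p /andP[p1 p2]] := @step_exists (glue_start x0 c) t t0 (cycles_diverge t).
suff -> : visit_at x0 c t = p by rewrite p1.
rewrite /visit_at (_ : [set q | _] = `I_p) ?count_set_II//.
apply/seteqP; split => q /= h.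
  rewrite ltnNge; apply/negP => pq.
  have := lt_le_trans p2 (le_trans (glue_start_homo x0 c_ge0 (pq : (p.+1 <= q.+1)%N)) h).
  by rewrite ltxx.
by apply: le_trans p1; exact: glue_start_homo.
Qed.

Lemma visit_atE p t : glue_start x0 c p <= t < glue_start x0 c p.+1 ->
  visit_at x0 c t = p.
Proof.
move=> /[dup] ht /andP[pt _]; apply: (visit_unique c_ge0 _ ht).
by apply: visit_atP; apply: le_trans pt; exact: glue_start_ge0.
Qed.

Lemma in_glueP p t : 0 <= t -> glue_start x0 c p <= t < glue_end x0 c p <->
  phase_at x0 c t = InGlue /\ visit_at x0 c t = p.
Proof.
move=> t0; split.
  move=> ht; have vp := visit_atE (in_glue_in_cycle c_ge0 ht).
  by split => //; rewrite /phase_at vp; case/andP: ht => _ ->.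
move=> [+ <-]; rewrite /phase_at; have /andP[-> _] := visit_atP t0.
by do 2?case: ifP.
Qed.

Lemma in_visitP p t : 0 <= t ->
  (exists j, (j < batch_size x0 c p)%N /\
     service_start x0 c p j <= t < service_start x0 c p j.+1) <->
  phase_at x0 c t = InVisit /\ visit_at x0 c t = p.
Proof.
move=> t0; split.
  move=> [j [jb ht]]; have vp := visit_atE (in_service_in_cycle c_ge0 jb ht).
  split => //; case/andP: ht => h1 h2; rewrite /phase_at vp.
  rewrite ltNge (le_trans (glue_end_le_service x0 c_ge0 p j) h1)/=.
  by rewrite (lt_le_trans h2)//; exact: service_start_homo.
move=> [+ vp]; rewrite /phase_at vp.
case: ltP => // gt; case: ltP => // tv _.
have [||j /andP[j1 j2]] := @step_exists (service_start x0 c p) t.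
- by rewrite service_start0.
- by exists (batch_size x0 c p).
exists j; rewrite j1 j2; split => //; rewrite ltnNge; apply/negP => bj.
have := lt_le_trans tv (@service_start_homo _ _ x0 c c_ge0 p _ _ bj).
by rewrite ltNge j1.
Qed.

Lemma in_switchoverP p t : 0 <= t ->
  visit_end x0 c p <= t < glue_start x0 c p.+1 <->
  phase_at x0 c t = InSwitch /\ visit_at x0 c t = p.
Proof.
move=> t0; split.
  move=> ht; have vp := visit_atE (in_switchover_in_cycle c_ge0 ht).
  split => //; case/andP: ht => h1 _; rewrite /phase_at vp.
  rewrite ltNge (le_trans (glue_end_le_visit_end x0 c_ge0 p) h1)/=.
  by rewrite ltNge h1.
move=> [+ <-]; rewrite /phase_at; have /andP[_ ->] := visit_atP t0.
by case: ltP => // _; case: ltP => // ->.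
Qed.

(** In a visit period the services follow one another without a gap, so exactly one
    is in progress. *)
Lemma in_service_atE t i : 0 <= t -> in_service_at x0 c t i =
  `[< phase_at x0 c t = InVisit /\ station (visit_at x0 c t) = i >].
Proof.
move=> t0; rewrite /in_service_at big_mkcond big_ord_recr/= big1 ?add0n.
  case: eqP => si; last first.
    by case: asboolP => // -[].
  case: asboolP => [[ph _]|nph].
    have [j [jb jt]] := (in_visitP _ t0).2 (conj ph erefl).
    rewrite (bigD1 (Ordinal jb))//= jt big1 ?addn0// => k kj.
    apply/eqP; rewrite eqb0; apply: contra kj => kt.
    by apply/eqP/val_inj => /=; exact: (service_unique c_ge0 kt jt).
  rewrite big1// => j _; apply/eqP; rewrite eqb0; apply/negP => jt; apply: nph.
  by have /(in_visitP _ t0)[] : exists k, (k < batch_size x0 c (visit_at x0 c t))%N /\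
    service_start x0 c (visit_at x0 c t) k <= t < service_start x0 c (visit_at x0 c t) k.+1
    by exists j.
move=> p _; case: ifP => // _; rewrite big1// => j _.
apply/eqP; rewrite eqb0; apply/negP => jt.
have := visit_atE (in_service_in_cycle c_ge0 (ltn_ord j) jt) => vp.
by have := ltn_ord p; rewrite {2}vp ltnn.
Qed.

Lemma finite_arrived i t : finite_set [set k | arrival x0 c i k <= t].
Proof.
have [m tm] := arrivals_diverge i t.
apply: (@sub_finite_set _ _ `I_(x0 i + m)) => // k /=; rewrite leNgt ltnNge.
apply: contra => mk; apply: (lt_le_trans tm).
have xk : (x0 i <= k)%N by apply: leq_trans mk; exact: leq_addr.
rewrite -(subnKC xk) arrivalE; apply: renewal_time_homo => //.
by rewrite ltnW// ltnS leq_subRL.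
Qed.

Lemma attempts_in_arrived i k (a b : R) : attempts_in x0 c i k a b -> arrival x0 c i k <= b.
Proof. by move=> [m /andP[_]]; apply: le_trans; exact: arrival_le_attempt. Qed.

Lemma finite_batch p : finite_set (batch x0 c p).
Proof.
apply: (sub_finite_set _ (finite_arrived (station p) (glue_end x0 c p))) => k.
by move=> /batchE[_ /attempts_in_arrived].
Qed.

Definition glued_by t p : set nat := [set k | batch x0 c p k /\
  attempts_in x0 c (station p) k (glue_start x0 c p) (Num.min t (glue_end x0 c p))].

Definition served_by t p : nat :=
  (\sum_(j < batch_size x0 c p) (service_start x0 c p j <= t)%R)%N.

Lemma waiting_atE t p : waiting_at x0 c t p = (count_set (glued_by t p) - served_by t p)%N.
Proof. by []. Qed.

Lemma count_glued_by_le t p : (count_set (glued_by t p) <= batch_size x0 c p)%N.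
Proof. by apply: le_count_set; [exact: finite_batch|move=> k []]. Qed.

(** Services only start after the glue period, when the whole batch is glued; hence
    the subtraction in the number of waiting customers is not truncated. *)
Lemma served_by_le t p : (served_by t p <= count_set (glued_by t p))%N.
Proof.
have [gt|tg] := leP (glue_end x0 c p) t.
  rewrite (_ : glued_by t p = batch x0 c p).
    rewrite -[leqRHS]/(batch_size x0 c p) -[leqRHS]card_ord -sum1_card.
    by apply: leq_sum => j _; exact: leq_b1.
  apply/seteqP; split => k; first by case.
  by move=> /[dup] bk /batchE[_ h]; split => //; rewrite min_r.
rewrite /served_by big1// => j _; apply/eqP; rewrite eqb0 -ltNge.
by apply: (lt_le_trans tg); exact: glue_end_le_service.
Qed.

Lemma waiting_served t p : visit_end x0 c p <= t -> waiting_at x0 c t p = 0%N.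
Proof.
move=> vt; rewrite waiting_atE; apply/eqP; rewrite subn_eq0.
apply: (leq_trans (count_glued_by_le t p)).
rewrite -[leqLHS]card_ord -sum1_card; apply: leq_sum => j _.
rewrite lt0b; apply: le_trans vt; apply: service_start_homo => //.
exact: ltnW.
Qed.

Lemma queue_atE t i : 0 <= t -> queue_at x0 c t i =
  if station (visit_at x0 c t) == i then waiting_at x0 c t (visit_at x0 c t) else 0%N.
Proof.
move=> t0; rewrite /queue_at big_mkcond big_ord_recr/= big1 ?add0n// => p _.
case: ifP => // _; apply: waiting_served.
apply: (le_trans (visit_end_le x0 c_ge0 p)).
have /andP[+ _] := visit_atP t0; apply: le_trans.
by apply: glue_start_homo => //; exact: ltn_ord.
Qed.

Lemma queue_at_switchover t i : 0 <= t -> phase_at x0 c t = InSwitch ->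
  queue_at x0 c t i = 0%N.
Proof.
move=> t0 ph; rewrite queue_atE//; case: ifP => // _; apply: waiting_served.
by have /andP[] := (in_switchoverP _ t0).2 (conj ph erefl).
Qed.

Lemma glued_beforeP p i k : glued_before x0 c p (i, k) <->
  exists2 q, (q < p)%N & station q = i /\ batch x0 c q k.
Proof.
elim: p => [|p ih]; first by split => // -[].
rewrite glued_beforeS; split => /=.
  move=> [/ih[q qp h]|[si bk]]; first by exists q => //; exact: leqW.
  by exists p.
move=> [q +]; rewrite ltnS leq_eqVlt => /orP[/eqP -> [si bk]|qp h].
  by right.
by left; apply/ih; exists q.
Qed.

(** A customer glued in one batch is excluded from the later ones. *)
Lemma batch_unique p q k : station p = station q :> 'I_n.+1 ->
  batch x0 c p k -> batch x0 c q k -> p = q.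
Proof.
wlog pq : p q / (p < q)%N => [h|].
  by have [pq|qp|//] := ltngtP p q => s b1 b2; [exact: h|apply/esym/h].
move=> s bp /batchE[nb _]; exfalso; apply: nb; apply/glued_beforeP.
by exists p.
Qed.

(** Every arrived customer is in the orbit, waits in the queue, or has started
    service: the one that is not in the orbit belongs to the batch of the first
    glue period of its station that contains one of its attempts. *)
Lemma arrived_customers t i : 0 <= t ->
  count_set [set k | arrival x0 c i k <= t] =
  (orbit_at x0 c t i + queue_at x0 c t i +
   \sum_(p < (visit_at x0 c t).+1 | station p == i) served_by t p)%N.
Proof.
move=> t0.
have -> : (orbit_at x0 c t i + queue_at x0 c t i +
   \sum_(p < (visit_at x0 c t).+1 | station p == i) served_by t p =
   orbit_at x0 c t i +
   \sum_(p < (visit_at x0 c t).+1 | station p == i) count_set (glued_by t p))%N.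
  rewrite -addnA; congr addn; rewrite -big_split/=; apply: eq_bigr => p _.
  by rewrite waiting_atE subnK// served_by_le.
have fG p : finite_set (glued_by t p).
  by apply: sub_finite_set (finite_batch p) => k [].
have dG p q k : station p == i -> station q == i -> glued_by t p k -> glued_by t q k -> p = q.
  by move=> /eqP si /eqP sj [bp _] [bq _]; apply: batch_unique bp bq; rewrite si.
have [fU <-] := count_set_bigcup (visit_at x0 c t).+1 fG dG.
have fA := finite_arrived i t.
rewrite -count_setU//; last 2 first.
- by apply: sub_finite_set fA => k [].
- apply/seteqP; split => k //= -[[_ nk] [p [_ [/eqP si [_ h]]]]].
  by apply: nk; exists p; rewrite -si.
congr count_set; apply/seteqP; split => k /=; last first.
  move=> [[]//|[p [_ [/eqP si [_]]]]] /attempts_in_arrived; rewrite si => /le_trans.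
  by apply; rewrite ge_min lexx.
move=> ak.
pose Q p := station p = i /\
  attempts_in x0 c i k (glue_start x0 c p) (Num.min t (glue_end x0 c p)).
have [exQ|nQ] := pselect (exists p, Q p); last by left.
right.
have {}exQ : exists p, `[< Q p >] by case: exQ => p Qp; exists p; apply/asboolP.
case: (ex_minnP exQ) => p /asboolP[si att] pmin; exists p.
have pt : glue_start x0 c p < t.
  by case: att => m /andP[h1 h2]; rewrite (lt_le_trans h1)// (le_trans h2)// ge_min lexx.
split.
  rewrite ltnNge; apply/negP => /(glue_start_homo x0 c_ge0) h.
  have /andP[_ h2] := visit_atP t0.
  by have := lt_trans (lt_le_trans h2 h) pt; rewrite ltxx.
split; first exact/eqP.
have att' : attempts_in x0 c i k (glue_start x0 c p) (glue_end x0 c p).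
  case: att => m /andP[h1 h2]; exists m; rewrite h1 (le_trans h2)// ge_min lexx orbT//.
split; last by rewrite si.
apply/batchE; rewrite si; split => // /glued_beforeP[q qp [sq /batchE[_ attq]]].
have := pmin q; rewrite leqNgt qp => /(_ _)/notF; apply; apply/asboolP; split => //.
rewrite min_r; first by rewrite -sq.
apply: le_trans (ltW pt); apply: le_trans (glue_start_homo x0 c_ge0 qp).
exact: le_trans (glue_end_le_visit_end x0 c_ge0 q) (visit_end_le x0 c_ge0 q).
Qed.

End divergent_paths.

(** * Almost sure statements and expected counts *)

Section almost_surely.
Context {R : realType} {d : measure_display} {T : measurableType d}.
Variable P : probability T R.

Lemma ae_forall_count (U : countType) (A : U -> T -> Prop) :
  (forall u, {ae P, forall x, A u x}) -> {ae P, forall x u, A u x}.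
Proof.
move=> h.
have : {ae P, forall x k, if @choice.pickle_inv U k is Some u then A u x else True}.
  by apply/ae_foralln => k; case: pickle_inv => [u|]; [exact: h|exact: aeW].
by apply: filterS => x h' u; have := h' (choice.pickle u); rewrite choice.pickleK_inv.
Qed.

Lemma le_measure_ae (A B : set T) : measurable A -> measurable B ->
  {ae P, forall x, A x -> B x} -> (P A <= P B)%E.
Proof.
move=> mA mB [N [mN N0 AB]].
apply: (@le_trans _ _ (P (B `|` N))); last by rewrite measureU0.
rewrite le_measure ?inE//; first exact: measurableU.
move=> x Ax; have [Bx|Bx] := pselect (B x); [by left|right].
by apply: AB => /= /(_ Ax).
Qed.

Lemma eq_measure_ae (A B : set T) : measurable A -> measurable B ->
  {ae P, forall x, A x <-> B x} -> P A = P B.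
Proof.
move=> mA mB AB; apply/le_anti/andP; split; apply: le_measure_ae => //.
  by apply: filterS AB => x [].
by apply: filterS AB => x [].
Qed.

Lemma ae_measure1 (A : set T) : measurable A -> {ae P, forall x, A x} -> P A = 1%E.
Proof.
by move=> mA hA; rewrite -(probability_setT P); apply: eq_measure_ae => //; apply: filterS hA.
Qed.

Lemma measure1_ae (A : set T) : measurable A -> P A = 1%E -> {ae P, forall x, A x}.
Proof.
move=> mA A1; exists (~` A); split => //; first exact: measurableC.
by rewrite probability_setC// A1 subee.
Qed.

Lemma esum_unique (U : choiceType) (E : U -> Prop) :
  (forall u v, E u -> E v -> u = v) ->
  (\esum_(u in setT) (\1_[set u | E u] u)%:E = (`[< exists u, E u >]%:R)%:E :> \bar R)%E.
Proof.
move=> uE; case: asboolP => [[v Ev]|nE]; last first.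
  rewrite esum1// => u _; rewrite indicE memNset//= => Eu.
  by apply: nE; exists u.
rewrite -(@esum_set1 R U v (fun=> 1%E))// [RHS]esum_mkcond; apply: eq_esum => u _.
rewrite indicE; have [->|uv] := eqVneq u v; first by rewrite !mem_set.
by rewrite !memNset//= => [/eqP|/uE/(_ Ev)/eqP]; rewrite ?(negPf uv).
Qed.

(** The sum of the probabilities is the expected number of events that hold, and this
    number is almost surely the indicator of B. *)
Lemma esum_measure_unique (U : countType) (E : U -> set T) (B : set T) :
  (forall u, measurable (E u)) -> measurable B ->
  {ae P, forall x, (forall u v, E u x -> E v x -> u = v) /\
                   ((exists u, E u x) <-> B x)} ->
  (\esum_(u in setT) P (E u) = P B)%E.
Proof.
move=> mE mB h.
transitivity (\int[P]_x \esum_(u in setT) (\1_(E u) x)%:E)%E.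
  rewrite integral_esum//.
    by apply: eq_esum => u _; rewrite integral_indic// setIT.
  by move=> u; apply/measurable_EFinP; exact: measurable_indic.
rewrite -[in RHS](setIT B) -integral_indic//; apply: ge0_ae_eq_integral => //.
- apply: emeasurable_esum => // u.
  by apply/measurable_EFinP; exact: measurable_indic.
- by apply/measurable_EFinP; exact: measurable_indic.
- by move=> x _; exact: esum_ge0.
- apply: filterS h => x [uE EB] _ /=.
  have -> : (\esum_(u in setT) (\1_(E u) x)%:E =
      \esum_(u in setT) (\1_[set v | E v x] u)%:E :> \bar R)%E.
    by apply: eq_esum => u _; rewrite !indicE; congr ((nat_of_bool _)%:R%:E); apply/idP/idP; rewrite !inE.
  rewrite esum_unique// indicE; congr ((nat_of_bool _)%:R%:E).
  by apply/asboolP/idP; rewrite inE => /EB.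
Qed.

Lemma esum_measure_le1 (U : countType) (E : U -> set T) :
  (forall u, measurable (E u)) ->
  {ae P, forall x u v, E u x -> E v x -> u = v} ->
  (\esum_(u in setT) P (E u) <= 1)%E.
Proof.
move=> mE h; rewrite (@esum_measure_unique _ _ (\bigcup_u E u))//.
- exact: probability_le1 (countable_bigcupT_measurable _ _).
- exact: countable_bigcupT_measurable.
- by apply: filterS h => x hx; split => //; split => [[u Eu]|[u _ Eu]]; exists u.
Qed.

(** If f were bounded by t on an event E of positive probability, each of the infinitely
    many terms of the expected count would be at least the probability of E. *)
Lemma ae_unbounded (f : nat -> T -> R) (Z : nat -> set T) :
  (forall k, measurable_fun setT (f k)) -> (forall k, measurable (Z k)) ->
  {ae P, forall x k, Z k x} ->
  (forall t, 0 <= t ->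
    (\esum_(k in [set: nat]) P (Z k `&` [set x | (f k x <= t)%R]))%E \is a fin_num) ->
  {ae P, forall x t, exists k, t < f k x}.
Proof.
move=> mf mZ hZ hn.
suff h : {ae P, forall x (N : nat), exists k, N%:R < f k x}.
  apply: filterS h => x h t.
  have [k kx] := h (Num.truncn (Num.max 0 t)).+1; exists k.
  apply: le_lt_trans kx; apply: (@le_trans _ _ (Num.max 0 t)); first by rewrite le_max lexx orbT.
  by apply/ltW/truncnS_gt.
apply/ae_foralln => N.
pose E := \bigcap_k (Z k `&` [set x | f k x <= N%:R]).
have mfk k : measurable [set x | f k x <= N%:R] by apply: measurable_set_le.
have mE : measurable E by apply: bigcap_measurableType => k _; exact: measurableI.
have E0 : P E = 0%E.
  have := hn N%:R (ler0n R N); apply: contraPP => /eqP E0.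
  have {}E0 : (0 < P E)%E by rewrite lt0e E0/=.
  have Efin : P E \is a fin_num by rewrite fin_num_measure.
  suff -> : (\esum_(k in [set: nat]) P (Z k `&` [set x | (f k x <= N%:R)%R]) = +oo)%E by [].
  apply/eqyP => A A0.
  pose m := (Num.truncn (A / fine (P E))).+1.
  rewrite -nneseries_esumT//.
  apply: le_trans (nneseries_lim_ge m _) => //.
  apply: (@le_trans _ _ (\sum_(0 <= k < m) P E)%E); last first.
    apply: lee_sum => k _; apply: le_measure; rewrite ?inE//; first exact: measurableI.
    by move=> x; exact.
  rewrite -(fineK Efin) sumEFin sumr_const_nat subn0 lee_fin -mulr_natr.
  rewrite -ler_pdivrMl; last by rewrite fine_gt0// E0 -ge0_fin_numE.
  by rewrite mulrC; apply/ltW/truncnS_gt.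
have : {ae P, forall x, ~ E x}.
  by exists E; split => //; apply/subsetP => x; rewrite !inE /= notK.
apply: filterS2 hZ => x hZ hE; apply: contra_notP hE => hx k _; split; first exact: hZ.
by rewrite /= leNgt; apply/negP => h; apply: hx; exists k.
Qed.

End almost_surely.

(** * Convergence in law on a countable space *)

Section convergence_in_law.
Context {R : realType} {d d' : measure_display}.
Context {T : measurableType d} {T' : measurableType d'} {S : countType}.
Variables (P : probability T R) (Q : probability T' R).

Lemma measurable_countable_preimage d1 (V : measurableType d1) (f : V -> S) (A : set S) :
  (forall y, measurable (f @^-1` [set y])) -> measurable (f @^-1` A).
Proof.
move=> mf; rewrite (_ : _ @^-1` A = \bigcup_y [set x | A y /\ f x = y]).
  apply: countable_bigcupT_measurable; first exact: countableP.
  by move=> y; apply: measurable_set_and; [exact: measurable_set_cst|exact: mf].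
by apply/seteqP; split => x /=; [exists (f x)|move=> [y _ [Ay ->]]].
Qed.

Variables (Z : R -> T -> S) (Y : T' -> S).
Hypothesis mZ : forall t y, measurable (Z t @^-1` [set y]).
Hypothesis mY : forall y, measurable (Y @^-1` [set y]).
Hypothesis ZY : forall y,
  P (Z t @^-1` [set y]) @[t --> +oo] --> Q (Y @^-1` [set y]).

Let fine_cvg_point y :
  fine (P (Z t @^-1` [set y])) @[t --> +oo] --> fine (Q (Y @^-1` [set y])).
Proof. by apply: fine_cvg; rewrite fineK ?fin_num_measure//; exact: ZY. Qed.

Let preimage_cons d1 (V : measurableType d1) (mu : probability V R) (f : V -> S)
    y (s : seq S) : (forall y, measurable (f @^-1` [set y])) -> y \notin s ->
  fine (mu (f @^-1` [set` y :: s])) =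
  fine (mu (f @^-1` [set y])) + fine (mu (f @^-1` [set` s])).
Proof.
move=> mf ys; have -> : f @^-1` [set` y :: s] = f @^-1` [set y] `|` f @^-1` [set` s].
  apply/seteqP; split => x /=; rewrite inE; first by move=> /orP[/eqP|]; [left|right].
  by move=> [->|->]; rewrite ?eqxx ?orbT.
rewrite measureU//; first by rewrite fineD// fin_num_measure//; exact: measurable_countable_preimage.
- exact: measurable_countable_preimage.
- by rewrite -subset0 => x [/= -> ] ; rewrite (negPf ys).
Qed.

Let cvg_seq (s : seq S) : uniq s ->
  fine (P (Z t @^-1` [set` s])) @[t --> +oo] --> fine (Q (Y @^-1` [set` s])).
Proof.
elim: s => [_|y s ih /= /andP[ys /ih {}ih]].
  have e d1 (V : measurableType d1) (mu : probability V R) (f : V -> S) :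
      fine (mu (f @^-1` [set` [::]])) = 0.
    by rewrite (_ : _ @^-1` _ = set0) ?measure0//; apply/seteqP; split.
  by rewrite e; under eq_fun do rewrite e; exact: cvg_cst.
rewrite preimage_cons//; under eq_fun do rewrite preimage_cons//.
by apply: cvgD.
Qed.

(** Finitely many points of A carry all but e of its mass under the limit law. *)
Let lower (A : set S) (e : R) : 0 < e ->
  \forall t \near +oo, fine (Q (Y @^-1` A)) - e < fine (P (Z t @^-1` A)).
Proof.
move=> e0.
pose s k := undup [seq y <- pmap (@choice.pickle_inv S) (iota 0 k) | `[< A y >]].
have sA k y : y \in s k -> A y by rewrite mem_undup mem_filter => /andP[/asboolP].
have sQ : Q (Y @^-1` [set` s k]) @[k --> \oo] --> Q (Y @^-1` A).
  have -> : Y @^-1` A = \bigcup_k (Y @^-1` [set` s k]).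
    apply/seteqP; split => x /=; last by move=> [k _ /sA].
    move=> AY; exists (choice.pickle (Y x)).+1 => //=.
    rewrite mem_undup mem_filter; apply/andP; split; first exact/asboolP.
    rewrite mem_pmap -(choice.pickleK_inv (Y x)); apply: map_f.
    by rewrite mem_iota /= add0n ltnSn.
  apply: nondecreasing_cvg_mu.
  - by move=> k; exact: measurable_countable_preimage.
  - by apply: bigcup_measurable => k _; exact: measurable_countable_preimage.
  - move=> k l kl; apply/subsetPset => x /=.
    rewrite !mem_undup !mem_filter => /andP[->] /=.
    rewrite !mem_pmap => /mapP[j jk ->]; apply: map_f; move: jk.
    by rewrite !mem_iota/= !add0n => /leq_trans; exact.
have {}sQ : fine (Q (Y @^-1` [set` s k])) @[k --> \oo] --> fine (Q (Y @^-1` A)).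
  by apply: fine_cvg; rewrite fineK ?fin_num_measure//; exact: measurable_countable_preimage.
have /cvgr_gt/(_ (fine (Q (Y @^-1` A)) - e)) := sQ.
rewrite gtrBl => /(_ e0)[k _ /(_ k (leqnn k)) /= hk].
have /cvg_seq/cvgr_gt/(_ _ hk) : uniq (s k) by exact: undup_uniq.
apply: filterS => t /lt_le_trans; apply.
apply: fine_le; rewrite ?fin_num_measure//; try exact: measurable_countable_preimage.
apply: le_measure; rewrite ?inE; try exact: measurable_countable_preimage.
by move=> x /sA.
Qed.

(** Both A and its complement have asymptotically at least their limit mass, and the
    masses sum to 1: as the limit is a probability, none can escape. *)
Lemma cvg_law (A : set S) :
  fine (P (Z t @^-1` A)) @[t --> +oo] --> fine (Q (Y @^-1` A)).
Proof.
have C d1 (V : measurableType d1) (mu : probability V R) (f : V -> S) :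
    (forall y, measurable (f @^-1` [set y])) ->
    fine (mu (f @^-1` (~` A))) = 1 - fine (mu (f @^-1` A)).
  move=> mf; rewrite preimage_setC probability_setC; last exact: measurable_countable_preimage.
  by rewrite fineB// fin_num_measure//; exact: measurable_countable_preimage.
apply/cvgrPdist_lt => e e0; near=> t.
have h1 : fine (Q (Y @^-1` A)) - e < fine (P (Z t @^-1` A)) by near: t; exact: lower.
have : fine (Q (Y @^-1` (~` A))) - e < fine (P (Z t @^-1` (~` A))) by near: t; exact: lower.
rewrite !C// ltr_norml => h2; apply/andP; split; lra.
Unshelve. all: by end_near. Qed.

End convergence_in_law.
Lemma cvg_eq_ge0 {R : realType} (f g : R -> R) (l : R) :
  (forall t, 0 <= t -> f t = g t) ->
  g t @[t --> +oo] --> l -> f t @[t --> +oo] --> l.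
Proof.
move=> fg gl; apply/cvgrPdist_le => e e0.
move/cvgrPdist_le : gl => /(_ e e0) gl; near=> t.
rewrite fg; first by near: t.
by near: t; apply: nbhs_pinfty_ge; rewrite num_real.
Unshelve. all: by end_near. Qed.

Lemma nat_tail_cvg {R : realType} d (T : measurableType d) (P : probability T R)
    (N : T -> nat) : (forall L, measurable [set x | (L < N x)%N]) ->
  fine (P [set x | (L < N x)%N]) @[L --> \oo] --> (0 : R).
Proof.
move=> mN.
have : P [set x | (L < N x)%N] @[L --> \oo] --> P (\bigcap_L [set x | (L < N x)%N]).
  apply: nonincreasing_cvg_mu => //.
  - by rewrite -ge0_fin_numE// fin_num_measure.
  - exact: bigcap_measurable.
  - move=> k l kl; apply/subsetPset => x /=; exact: leq_ltn_trans.
rewrite (_ : \bigcap_L _ = set0) ?measure0; first by move=> /fine_cvgP[].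
by apply/seteqP; split => // x /(_ (N x) I)/=; rewrite ltnn.
Qed.

(** * Generating functions and factorial moments *)

Section phase_decomposition.
Context {R : realType} {n : nat} {d : measure_display} {T : measurableType d}.
Variables (Q : probability T R) (Y : T -> state n).
Hypothesis mY : forall y, measurable (Y @^-1` [set y]).

Lemma measurable_of_state d' (V : measurableType d') (g : state n -> V) :
  measurable_fun setT (fun o => g (Y o)).
Proof.
move=> _ B _; rewrite setTI.
exact: (@measurable_countable_preimage _ _ T Y (g @^-1` B)).
Qed.

Lemma measurable_in_period s i : measurable (in_period Y s i).
Proof.
exact: (@measurable_countable_preimage _ _ T Y [set y | st_phase y = s /\ st_station y = i]).
Qed.

(** Unnormalized, unlike a conditional expectation, so that it adds up over the phases
    and makes sense when infinite. *)
Definition phase_mean (g : state n -> R) s i : \bar R :=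
  (\int[Q]_o (g (Y o) * \1_(in_period Y s i) o)%:E)%E.

Lemma measurable_phase_mean (g : state n -> R) s i :
  measurable_fun setT (fun o => (g (Y o) * \1_(in_period Y s i) o)%:E).
Proof.
apply/measurable_EFinP; apply: measurable_funM; first exact: measurable_of_state.
by apply: measurable_indic; exact: measurable_in_period.
Qed.

Lemma phase_mean_ge0 (g : state n -> R) s i : (forall y, 0 <= g y) ->
  (0 <= phase_mean g s i)%E.
Proof. by move=> g0; apply: integral_ge0 => o _; rewrite lee_fin mulr_ge0. Qed.

Lemma phase_decomposition (g : state n -> R) : (forall y, 0 <= g y) ->
  (\int[Q]_o (g (Y o))%:E =
   \sum_i (phase_mean g InVisit i + phase_mean g InGlue i + phase_mean g InSwitch i))%E.
Proof.
move=> g0.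
have gI0 s i o : (0 <= (g (Y o) * \1_(in_period Y s i) o)%:E)%E by rewrite lee_fin mulr_ge0.
transitivity (\sum_i \int[Q]_o ((g (Y o) * \1_(in_period Y InVisit i) o)%:E +
   (g (Y o) * \1_(in_period Y InGlue i) o)%:E + (g (Y o) * \1_(in_period Y InSwitch i) o)%:E))%E.
  rewrite -ge0_integral_sum//; last 2 first.
  - move=> i; apply: emeasurable_funD; last exact: measurable_phase_mean.
    by apply: emeasurable_funD; exact: measurable_phase_mean.
  - by move=> i o _; rewrite !adde_ge0.
  apply: eq_integral => o _; rewrite (bigD1 (st_station (Y o)))//= big1 ?adde0.
    rewrite -!EFinD -!mulrDr; congr (_%:E); rewrite -[LHS]mulr1; congr (_ * _).
    have e s : \1_(in_period Y s (st_station (Y o))) o = `[< st_phase (Y o) = s >]%:R :> R.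
      rewrite indicE; congr (nat_of_bool _)%:R.
      by apply/idP/asboolP => [/set_mem[]//|h]; exact/mem_set.
    by rewrite !e; case: (st_phase (Y o)); do !(case: asboolP => // _); rewrite ?addr0 ?add0r.
  move=> i iY; rewrite !indicE !memNset ?mulr0 ?adde0//.
  - by move=> [_ /esym/eqP]; rewrite (negPf iY).
  - by move=> [_ /esym/eqP]; rewrite (negPf iY).
  - by move=> [_ /esym/eqP]; rewrite (negPf iY).
apply: eq_bigr => i _; rewrite ge0_integralD//; last 3 first.
- by move=> o _; rewrite adde_ge0.
- by apply: emeasurable_funD; exact: measurable_phase_mean.
- exact: measurable_phase_mean.
by rewrite ge0_integralD//; exact: measurable_phase_mean.
Qed.

End phase_decomposition.

Section generating_function_limit.
Context {R : realType} {n : nat} {d : measure_display} {T : measurableType d}.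
Variables (Q : probability T R) (Y : T -> state n).
Hypothesis mY : forall y, measurable (Y @^-1` [set y]).
Variables (s : phase) (k : 'I_n.+1).
Variables (c b : state n -> nat) (a : state n -> 'I_n.+1 -> nat).

(** The derivatives of the monomials are of this form: c is the exponent brought down,
    a and b are the remaining exponents of the variables z and w. *)
Definition gf_weight (z : 'rV[R]_n.+1) (w : R) (y : state n) : R :=
  (c y)%:R * ((\prod_j z 0 j ^+ a y j) * w ^+ b y).

Implicit Types (z : 'rV[R]_n.+1) (w : R) (y : state n).

Lemma gf_weight_ge0 z w y : (forall j, 0 <= z 0 j) -> 0 <= w -> 0 <= gf_weight z w y.
Proof.
by move=> z0 w0; rewrite mulr_ge0// mulr_ge0// ?exprn_ge0// prodr_ge0// => j _; rewrite exprn_ge0.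
Qed.

Lemma gf_weight_le z z' w w' y : (forall j, 0 <= z 0 j <= z' 0 j) -> 0 <= w <= w' ->
  gf_weight z w y <= gf_weight z' w' y.
Proof.
move=> zz /andP[w0 ww]; rewrite ler_wpM2l//; apply: ler_pM.
- by apply: prodr_ge0 => j _; rewrite exprn_ge0//; have /andP[] := zz j.
- by rewrite exprn_ge0.
- apply: ler_prod => j _; have /andP[z0 zz'] := zz j.
  by rewrite exprn_ge0//= lerXn2r// nnegrE// (le_trans z0).
- by rewrite lerXn2r// nnegrE// (le_trans w0).
Qed.

Lemma gf_weight1 y : gf_weight (const_mx 1) 1 y = (c y)%:R.
Proof.
rewrite /gf_weight expr1n mulr1 big1 ?mulr1// => j _.
by rewrite mxE expr1n.
Qed.

Lemma gf_weight_const (x : R) y :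
  gf_weight (const_mx x) x y = (c y)%:R * x ^+ (\sum_j a y j + b y).
Proof.
rewrite /gf_weight exprD; congr (_ * (_ * _)).
by under eq_bigr do rewrite mxE; rewrite prodrXr.
Qed.

(** A sequence increasing to 1: along the diagonal z = w = diag m the weights increase
    with m, so that monotone convergence applies, and each of its values is
    eventually exceeded on any other approach to 1. *)
Let diag (m : nat) : R := 1 - m.+1%:R^-1.

Let diag01 m : 0 <= diag m <= 1.
Proof.
by rewrite subr_ge0 invf_le1// ler1n/= lerBlDr lerDl invr_ge0.
Qed.

Let diag_homo m l : (m <= l)%N -> diag m <= diag l.
Proof. by move=> ml; rewrite lerB// lef_pV2// ?posrE// ler_nat. Qed.

Let diag_cvg : diag m @[m --> \oo] --> (1 : R).
Proof.
rewrite -[X in _ --> X]subr0; apply: cvgB; first exact: cvg_cst.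
exact: cvg_harmonic.
Qed.

Let mean_diag_cvg :
  phase_mean Q Y (gf_weight (const_mx (diag m)) (diag m)) s k @[m --> \oo] -->
  phase_mean Q Y (fun y => (c y)%:R) s k.
Proof.
apply: cvg_nd_integral => //.
- by move=> m; exact: measurable_phase_mean.
- move=> m o; have /andP[d0 _] := diag01 m.
  by rewrite lee_fin mulr_ge0// gf_weight_ge0// => j; rewrite mxE.
- move=> o m l ml /=; rewrite lee_fin ler_wpM2r//.
  have /andP[d0 _] := diag01 m.
  by apply: gf_weight_le; [move=> j; rewrite !mxE|]; rewrite d0/= diag_homo.
- move=> o; apply: cvg_EFin; first exact: nearW.
  apply: cvgM; last exact: cvg_cst.
  under eq_fun do rewrite gf_weight_const.
  set N := (\sum_j _ + _)%N.
  have h : (c (Y o))%:R * diag m ^+ N @[m --> \oo] -->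
      ((c (Y o))%:R * 1 ^+ N : R).
    by apply: cvgMl_tmp; exact: (cvg_comp _ _ diag_cvg (@exprn_continuous R N (1 : R))).
  by rewrite expr1n mulr1 in h.
Qed.

(** As the arguments increase to 1 the weights increase to c, so their means
    converge to that of c, along any approach to 1. *)
Lemma gf_limit (I : Type) (F : set_system I) (FF : ProperFilter F)
    (z : I -> 'rV[R]_n.+1) (w : I -> R) :
  (\forall x \near F, (forall j, 0 <= z x 0 j <= 1) /\ 0 <= w x <= 1) ->
  (forall e, e < 1 -> \forall x \near F, (forall j, e <= z x 0 j) /\ e <= w x) ->
  (\forall x \near F, phase_mean Q Y (gf_weight (z x) (w x)) s k \is a fin_num) ->
  (fine (phase_mean Q Y (gf_weight (z x) (w x)) s k))%:E @[x --> F] -->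
  phase_mean Q Y (fun y => (c y)%:R) s k.
Proof.
move=> h01 h1 hfin.
set l := phase_mean Q Y (fun y => (c y)%:R) s k.
have ub : \forall x \near F, (phase_mean Q Y (gf_weight (z x) (w x)) s k <= l)%E.
  near=> x.
  have [zx /andP[wx wx1]] : (forall j, 0 <= z x 0 j <= 1) /\ 0 <= w x <= 1 by near: x.
  apply: ge0_le_integral => //.
  - move=> o _; rewrite lee_fin mulr_ge0// gf_weight_ge0// => j.
    by have /andP[] := zx j.
  - exact: measurable_phase_mean.
  - exact: (measurable_phase_mean mY (fun y => (c y)%:R)).
  - move=> o _; rewrite lee_fin ler_wpM2r// -gf_weight1; apply: gf_weight_le.
      by move=> j; rewrite mxE.
    by rewrite wx.
have lb (y : R) : (y%:E < l)%E ->
    \forall x \near F, (y%:E < phase_mean Q Y (gf_weight (z x) (w x)) s k)%E.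
  move=> yl.
  have [m ym] : exists m, (y%:E < phase_mean Q Y (gf_weight (const_mx (diag m)) (diag m)) s k)%E.
    have [m _ /(_ m (leqnn m)) /= hm] := mean_diag_cvg (open_ereal_gt' yl).
    by exists m.
  have d1 : diag m < 1 by rewrite gtrBl invr_gt0.
  have /andP[d0 _] := diag01 m.
  near=> x; apply: (lt_le_trans ym).
  have [zx wx] : (forall j, diag m <= z x 0 j) /\ diag m <= w x by near: x; exact: h1.
  apply: ge0_le_integral => //.
  - by move=> o _; rewrite lee_fin mulr_ge0// gf_weight_ge0// => j; rewrite mxE.
  - exact: measurable_phase_mean.
  - exact: measurable_phase_mean.
  - move=> o _; rewrite lee_fin ler_wpM2r//; apply: gf_weight_le.
      by move=> j; rewrite mxE d0 zx.
    by rewrite d0.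
have l0 : (0 <= l)%E by apply: phase_mean_ge0.
have [lfin|] := boolP (l \is a fin_num); last first.
  rewrite ge0_fin_numE// -leNgt leye_eq => /eqP ly; rewrite ly in lb *.
  apply/cvgeyPgt => A; near=> x; rewrite fineK; last by near: x.
  by near: x; apply: lb; rewrite ltry.
rewrite -(fineK lfin); apply: cvg_EFin; first exact: nearW.
apply/cvgrPdist_le => e e0; near=> x.
have xfin : phase_mean Q Y (gf_weight (z x) (w x)) s k \is a fin_num by near: x.
have hu : fine (phase_mean Q Y (gf_weight (z x) (w x)) s k) <= fine l.
  by apply: fine_le => //; near: x.
have hl : fine l - e < fine (phase_mean Q Y (gf_weight (z x) (w x)) s k).
  rewrite -lte_fin (fineK xfin); near: x; apply: lb.
  by rewrite -[X in (_ < X)%E](fineK lfin) lte_fin gtrBl.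
by rewrite /= ler_norml; apply/andP; split; lra.
Unshelve. all: by end_near. Qed.

End generating_function_limit.

Section generating_function_derivative.
Context {R : realType} {n : nat} {d : measure_display} {T : measurableType d}.
Variables (Q : probability T R) (Y : T -> state n).
Hypothesis mY : forall y, measurable (Y @^-1` [set y]).
Variables (s : phase) (k : 'I_n.+1).

(** The left side is at most the geometric sum of the m first powers of v. *)
Lemma power_derivative_bound (v : R) (m : nat) : 0 <= v < 1 ->
  m%:R * v ^+ m.-1 <= (1 - v)^-1.
Proof.
move=> /andP[v0 v1].
have v10 : 0 < 1 - v by rewrite subr_gt0.
rewrite -[leRHS]mul1r ler_pdivlMr//.
apply: (@le_trans _ _ ((\sum_(i < m) v ^+ i) * (1 - v))).
  apply: ler_wpM2r; first exact: ltW.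
  have -> : m%:R * v ^+ m.-1 = \sum_(i < m) v ^+ m.-1 by rewrite sumr_const card_ord mulr_natl.
  apply: ler_sum => i _.
  by rewrite ler_wiXn2l// ?ltW// -ltnS prednK// (leq_ltn_trans _ (ltn_ord i)).
rewrite mulrC -opprB mulNr -subrX1 opprB gerBl exprn_ge0//.
Qed.

(** The derivative of the integrand is bounded uniformly on [0, v] for v < 1, hence
    differentiation under the integral. *)
Lemma power_mean_derivative (h : state n -> R) (m : state n -> nat) (x : R) :
  (forall y, 0 <= h y <= 1) -> 0 < x < 1 ->
  phase_mean Q Y (fun y => (m y)%:R * (h y * x ^+ (m y).-1)) s k \is a fin_num /\
  is_derive x 1 (fun u => fine (phase_mean Q Y (fun y => h y * u ^+ m y) s k))
    (fine (phase_mean Q Y (fun y => (m y)%:R * (h y * x ^+ (m y).-1)) s k)).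
Proof.
move=> h01 /andP[x0 x1].
(* Any point of ]x, 1[ would do. *)
pose v : R := (1 + x) / 2.
have xv : x < v by rewrite /v; lra.
have v1 : v < 1 by rewrite /v; lra.
have v0 : 0 <= v by rewrite /v; lra.
have A01 o : 0 <= (\1_(in_period Y s k) o : R) <= 1.
  by rewrite indicE ler0n lern1 leq_b1.
pose f (u : R) (o : T) : R := h (Y o) * u ^+ m (Y o) * \1_(in_period Y s k) o.
have df (u : R) o : is_derive u 1 (f ^~ o)
    ((m (Y o))%:R * (h (Y o) * u ^+ (m (Y o)).-1) * \1_(in_period Y s k) o).
  have -> : f ^~ o = (h (Y o) * \1_(in_period Y s k) o) \*: (@GRing.exp R ^~ (m (Y o))).
    by apply/funext => u'; rewrite /f /= mulrAC.
  have -> : (m (Y o))%:R * (h (Y o) * u ^+ (m (Y o)).-1) * \1_(in_period Y s k) o =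
      (h (Y o) * \1_(in_period Y s k) o) *: ((m (Y o))%:R * u ^+ (m (Y o)).-1 *: 1) :> R.
    by rewrite /GRing.scale /= mulr1; ring.
  apply: is_deriveZ.
  have h1 := @is_deriveX _ _ (@id R) (m (Y o)) u 1 1 (is_derive_id u 1).
  by rewrite exprfctE in h1; exact: h1.
have d1E (u : R) o : partial1of2 f u o =
    (m (Y o))%:R * (h (Y o) * u ^+ (m (Y o)).-1) * \1_(in_period Y s k) o.
  by rewrite partial1of2E; apply: derive_val.
have bound g : (forall o, 0 <= g (Y o) * \1_(in_period Y s k) o <= (1 - v)^-1) ->
    Q.-integrable setT (EFin \o (fun o => g (Y o) * \1_(in_period Y s k) o)).
  move=> gb; apply: (@le_integrable _ _ _ Q setT _ _ (cst (1 - v)^-1%:E)) => //.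
  - exact: measurable_phase_mean.
  - move=> o _ /=; rewrite lee_fin; have /andP[g0 g1] := gb o.
    by rewrite ger0_norm// ger0_norm// invr_ge0 subr_ge0 ltW.
  - exact: (finite_measure_integrable_cst _ (1 - v)^-1).
have one_v : 1 <= (1 - v)^-1 by rewrite invf_ge1 ?subr_gt0// gerBl.
have intf (u : R) : (`]0, v[%classic : set R) u -> Q.-integrable setT (EFin \o f u).
  rewrite /= in_itv/= => /andP[u0 uv]; apply: (bound (fun y => h y * u ^+ m y)) => o.
  have /andP[h0 h1] := h01 (Y o); have /andP[a0 a1] := A01 o.
  have e0 : 0 <= u ^+ m (Y o) by rewrite exprn_ge0// ltW.
  have e1 : u ^+ m (Y o) <= 1 by rewrite exprn_ile1 ?ltW// (lt_trans uv).
  rewrite !mulr_ge0//= (le_trans _ one_v)//.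
  by rewrite mulr_ile1 ?mulr_ge0// mulr_ile1.
have dbound u o : 0 < u < v ->
    0 <= (m (Y o))%:R * (h (Y o) * u ^+ (m (Y o)).-1) * \1_(in_period Y s k) o <= (1 - v)^-1.
  move=> /andP[u0 uv]; have /andP[h0 h1] := h01 (Y o); have /andP[a0 a1] := A01 o.
  have e0 : 0 <= u ^+ (m (Y o)).-1 by rewrite exprn_ge0// ltW.
  rewrite !mulr_ge0//=.
  apply: (@le_trans _ _ ((m (Y o))%:R * v ^+ (m (Y o)).-1)); last first.
    by apply: power_derivative_bound; rewrite v0.
  rewrite -[leRHS]mulr1; apply: ler_pM => //; first by rewrite !mulr_ge0.
  rewrite ler_wpM2l// -[leRHS]mul1r; apply: ler_pM => //.
  by rewrite lerXn2r// ?nnegrE ltW.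
have dG (u : R) o : (`]0, v[%classic : set R) u -> setT o -> `|partial1of2 f u o| <= cst (1 - v)^-1 o.
  rewrite /= in_itv/= => uv _; rewrite d1E; have /andP[g0 g1] := dbound u o uv.
  by rewrite ger0_norm.
have xI : (`]0, v[%classic : set R) x by rewrite /= in_itv/= x0.
have iG : Q.-integrable setT (EFin \o (cst (1 - v)^-1 : T -> R)).
  exact: finite_measure_integrable_cst.
have G0 o : 0 <= (cst (1 - v)^-1 : T -> R) o by rewrite /= invr_ge0 subr_ge0 ltW.
have derf (u : R) o : (`]0, v[%classic : set R) u -> setT o -> derivable (f ^~ o) u 1.
  by move=> _ _; exact: ex_derive.
split.
  have := integrable_fin_num measurableT (bound (fun y => (m y)%:R * (h y * x ^+ (m y).-1)) _).
  by apply => o; apply: dbound; rewrite x0.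
apply: DeriveDef.
  exact: (derivable_under_integral measurableT xI intf derf G0 iG dG).
rewrite -derive1E (differentiation_under_integral measurableT xI intf derf G0 iG dG).
by rewrite /Rintegral; congr fine; apply: eq_integral => o _; rewrite d1E.
Qed.

Lemma joint_gfE z w : joint_gf Q Y s k z w =
  fine (phase_mean Q Y
    (fun y => (\prod_j z 0 j ^+ Defs.orbit y j) * w ^+ total_queue y) s k) /
  fine (Q (in_period Y s k)).
Proof. by rewrite /joint_gf /cond_expectation unlock. Qed.

Lemma orbit_gfE z : orbit_gf Q Y s k z = joint_gf Q Y s k z 1.
Proof.
rewrite /orbit_gf /joint_gf; congr cond_expectation.
by apply/funext => o; rewrite expr1n mulr1.
Qed.

(** A partial derivative is the derivative of the section through z in the direction of
    the j-th variable. *)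
Lemma partialE (F : 'rV[R]_n.+1 -> R) (phi : R -> R) (z : 'rV[R]_n.+1) (j : 'I_n.+1) :
  (forall t, F (t *: delta_mx 0 j + z) = phi (t + z 0 j)) ->
  partial j F z = 'D_1 phi (z 0 j).
Proof.
move=> Fphi; rewrite /partial /derive.
have -> : F z = phi (z 0 j) by rewrite -[in RHS](add0r (z 0 j)) -Fphi scale0r add0r.
apply: (congr1 (fun f : R -> R => lim (f @ (0 : R)^'))); apply/funext => t /=.
by rewrite Fphi /GRing.scale /= mulr1.
Qed.

(** In the exponents, subtracting [l == j] lowers the power of the j-th variable by 1;
    where that power is 0 the weight vanishes through its first factor. *)
Lemma partial_joint_gf (j : 'I_n.+1) (z : 'rV[R]_n.+1) (w : R) :
  (forall l, 0 < z 0 l < 1) -> 0 <= w <= 1 ->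
  let g := gf_weight (fun y => Defs.orbit y j) (@total_queue n)
     (fun y l => Defs.orbit y l - (l == j))%N z w in
  phase_mean Q Y g s k \is a fin_num /\
  partial j (fun z => joint_gf Q Y s k z w) z =
    fine (phase_mean Q Y g s k) / fine (Q (in_period Y s k)).
Proof.
move=> z01 /andP[w0 w1] g.
pose h y := (\prod_(l | l != j) z 0 l ^+ Defs.orbit y l) * w ^+ total_queue y.
have h01 y : 0 <= h y <= 1.
  have p01 : 0 <= \prod_(l | l != j) z 0 l ^+ Defs.orbit y l <= 1.
    rewrite prodr_ge0/=; last by move=> l _; rewrite exprn_ge0//; have /andP[/ltW] := z01 l.
    apply: prodr_ile1 => l _; have /andP[/ltW z0 /ltW z1] := z01 l.
    by rewrite exprn_ge0//= exprn_ile1.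
  have /andP[p0 p1] := p01.
  by rewrite mulr_ge0 ?exprn_ge0//= mulr_ile1 ?exprn_ge0// exprn_ile1.
have gE : g = fun y => (Defs.orbit y j)%:R * (h y * z 0 j ^+ (Defs.orbit y j).-1).
  apply/funext => y; rewrite /g /gf_weight /h (bigD1 j)//= eqxx subn1.
  rewrite (eq_bigr (fun l => z 0 l ^+ Defs.orbit y l)); last first.
    by move=> l /negPf ->; rewrite subn0.
  by ring.
have [gfin gder] := power_mean_derivative (fun y => Defs.orbit y j) h01 (z01 j).
rewrite -gE in gfin gder; split => //.
pose phi u := (fine (Q (in_period Y s k)))^-1 *
  fine (phase_mean Q Y (fun y => h y * u ^+ Defs.orbit y j) s k).
rewrite (@partialE _ phi).
  have -> : phi = (fine (Q (in_period Y s k)))^-1 \*: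
    (fun u => fine (phase_mean Q Y (fun y => h y * u ^+ Defs.orbit y j) s k)) by [].
  by rewrite (@derive_val _ _ _ _ _ _ _ (is_deriveZ _ gder)) mulrC.
move=> t; rewrite joint_gfE mulrC; congr (_ * fine (phase_mean _ _ _ _ _)).
apply/funext => y; rewrite (bigD1 j)//= !mxE !eqxx mulr1 /h.
rewrite (eq_bigr (fun l => z 0 l ^+ Defs.orbit y l)); last first.
  by move=> l /negPf lj; rewrite !mxE lj andbF mulr0 add0r.
by ring.
Qed.

Lemma derive_joint_gf (z : 'rV[R]_n.+1) (w : R) :
  (forall l, 0 <= z 0 l <= 1) -> 0 < w < 1 ->
  let g := gf_weight (@total_queue n) (fun y => (total_queue y).-1)
     (fun y l => Defs.orbit y l) z w in
  phase_mean Q Y g s k \is a fin_num /\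
  derive1n 1 (joint_gf Q Y s k z) w =
    fine (phase_mean Q Y g s k) / fine (Q (in_period Y s k)).
Proof.
move=> z01 w01 g.
pose h y := \prod_l z 0 l ^+ Defs.orbit y l.
have h01 y : 0 <= h y <= 1.
  rewrite prodr_ge0/=; last by move=> l _; rewrite exprn_ge0//; have /andP[] := z01 l.
  apply: prodr_ile1 => l _; have /andP[z0 z1] := z01 l.
  by rewrite exprn_ge0//= exprn_ile1.
have [gfin gder] := power_mean_derivative (@total_queue n) h01 w01.
split => //; rewrite /= derive1E.
have -> : joint_gf Q Y s k z = (fine (Q (in_period Y s k)))^-1 \*:
    (fun u => fine (phase_mean Q Y (fun y => h y * u ^+ total_queue y) s k)).
  by apply/funext => u; rewrite joint_gfE mulrC.
by rewrite (@derive_val _ _ _ _ _ _ _ (is_deriveZ _ gder)) mulrC.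
Qed.

End generating_function_derivative.

Section factorial_indices.
Context {R : realType} {n : nat}.

Lemma partials_unit_index (i : 'I_n.+1) (F : 'rV[R]_n.+1 -> R) :
  partials (unit_index i) F = partial i F.
Proof.
rewrite /partials; have := enum_uniq 'I_n.+1; have := mem_enum 'I_n.+1 i.
rewrite [in X in X -> _]inE.
elim: (enum 'I_n.+1) => // j r IH /=; rewrite inE /unit_index => jr /andP[nj ur].
have foldr_id s : i \notin s -> foldr (fun j => iter (j == i) (partial j)) F s = F.
  elim: s => // l s IHs; rewrite inE negb_or eq_sym => /andP[/negPf li /IHs /= ->].
  by rewrite li.
case: eqVneq jr nj => [<- _ nj|_ /= ir _]; last exact: IH.
by rewrite /= foldr_id.
Qed.

Lemma partials_zero_index (F : 'rV[R]_n.+1 -> R) : partials zero_index F = F.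
Proof. by rewrite /partials; elim: (enum _) => //= j r ->. Qed.

Lemma mfact_unit_index (i : 'I_n.+1) : mfact (unit_index i) = 1%N.
Proof. by apply: big1 => j _; rewrite /unit_index; case: (j == i). Qed.

Lemma mfact_zero_index : @mfact n zero_index = 1%N.
Proof. by apply: big1 => j _. Qed.

Lemma near_ones_left (e : R) : e < 1 ->
  \forall z \near @ones_left R n, forall j, e < (z : 'rV[R]_n.+1) 0 j < 1.
Proof.
move=> e1; rewrite /ones_left near_withinE.
apply/nbhs_ballP; exists (1 - e); first by rewrite /= subr_gt0.
move=> z [_ hz] hz1 j; have := hz 0 j; rewrite /ball /= mxE.
by rewrite ltr_norml => /andP[_ h]; rewrite hz1 andbT; lra.
Qed.

Global Instance ones_left_proper : ProperFilter (@ones_left R n).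
Proof.
apply: Build_ProperFilter_ex => A.
rewrite /ones_left /within /= => /nbhs_ballP[e /= e0 eA].
exists (const_mx (1 - e / 2)); apply: eA => /=.
  split => // i j; rewrite /ball /= !mxE opprB addrCA subrr addr0.
  by rewrite gtr0_norm ?divr_gt0//; lra.
by move=> j; rewrite mxE; lra.
Qed.

End factorial_indices.

Section factorial_moments.
Context {R : realType} {n : nat} {d : measure_display} {T : measurableType d}.
Variables (Q : probability T R) (Y : T -> state n).
Hypothesis mY : forall y, measurable (Y @^-1` [set y]).
Variables (s : phase) (k : 'I_n.+1).

Let F := filter_prod (@ones_left R n) (at_left (1 : R)).

Let near_F (e : R) : e < 1 ->
  \forall x \near F, (forall j, e < (x : 'rV[R]_n.+1 * R).1 0 j < 1) /\ e < x.2 < 1.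
Proof.
move=> e1.
exists ([set z : 'rV[R]_n.+1 | forall j, e < z 0 j < 1], [set w | e < w < 1]) => /=.
  split; first exact: near_ones_left.
  near=> w; apply/andP; split; near: w.
    exact: nbhs_left_gt.
  exact: nbhs_left_lt.
by move=> [z w] [/= hz hw]; split.
Unshelve. all: by end_near. Qed.

Lemma Psi_orbit (j : 'I_n.+1) :
  Psi (joint_gf Q Y s k) (unit_index j) 0 =
  ((fine (Q (in_period Y s k)))^-1%:E *
    phase_mean Q Y (fun y => (Defs.orbit y j)%:R) s k)%E.
Proof.
rewrite /Psi mfact_unit_index muln1 invr1 -/F.
pose g (x : 'rV[R]_n.+1 * R) := gf_weight (fun y => Defs.orbit y j) (@total_queue n)
     (fun y l => Defs.orbit y l - (l == j))%N x.1 x.2.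
have gE : \forall x \near F, phase_mean Q Y (g x) s k \is a fin_num /\
  1 * partials (unit_index j) (fun z => derive1n 0 (joint_gf Q Y s k z) x.2) x.1 =
  (fine (Q (in_period Y s k)))^-1 * fine (phase_mean Q Y (g x) s k).
  near=> x; have [x1 x2] : (forall j, 0 < x.1 0 j < 1) /\ 0 < x.2 < 1 by near: x; exact: near_F.
  have x2' : 0 <= x.2 <= 1 by have /andP[/ltW -> /ltW ->] := x2.
  have [? e] := partial_joint_gf Q mY s k j x1 x2'; split => //.
  by rewrite mul1r partials_unit_index /= e mulrC.
apply/cvg_lim => //.
apply: (@cvg_trans _ (((fine (Q (in_period Y s k)))^-1%:E *
    (fine (phase_mean Q Y (g x) s k))%:E)%E @[x --> F])).
  by apply: near_eq_cvg; apply: filterS gE => x [_ ->].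
apply: cvgeZl => //.
apply: gf_limit => //.
- apply: filterS (near_F ltr01) => x [x1 x2]; split.
    by move=> l; have /andP[/ltW -> /ltW ->] := x1 l.
  by have /andP[/ltW -> /ltW ->] := x2.
- move=> e /near_F; apply: filterS => x [x1 x2]; split.
    by move=> l; have /andP[/ltW ->] := x1 l.
  by have /andP[/ltW ->] := x2.
- by apply: filterS gE => x [].
Unshelve. all: by end_near. Qed.

Lemma Psi_s_orbit (j : 'I_n.+1) :
  Psi_s (orbit_gf Q Y s k) (unit_index j) =
  ((fine (Q (in_period Y s k)))^-1%:E *
    phase_mean Q Y (fun y => (Defs.orbit y j)%:R) s k)%E.
Proof.
rewrite /Psi_s mfact_unit_index invr1 partials_unit_index.
have -> : orbit_gf Q Y s k = fun z => joint_gf Q Y s k z 1.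
  by apply/funext => z; exact: orbit_gfE.
pose g z := gf_weight (fun y => Defs.orbit y j) (@total_queue n)
     (fun y l => Defs.orbit y l - (l == j))%N z (1 : R).
have gE : \forall z \near ones_left, phase_mean Q Y (g z) s k \is a fin_num /\
  1 * partial j (fun z => joint_gf Q Y s k z 1) z =
  (fine (Q (in_period Y s k)))^-1 * fine (phase_mean Q Y (g z) s k).
  near=> z; have z1 : forall j, 0 < z 0 j < 1 by near: z; exact: near_ones_left.
  have l1 : 0 <= (1 : R) <= 1 by rewrite ler01 lexx.
  have [? e] := partial_joint_gf Q mY s k j z1 l1; split => //.
  by rewrite mul1r /= e mulrC.
apply/cvg_lim => //.
apply: (@cvg_trans _ (((fine (Q (in_period Y s k)))^-1%:E *
    (fine (phase_mean Q Y (g z) s k))%:E)%E @[z --> ones_left])).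
  by apply: near_eq_cvg; apply: filterS gE => x [_ ->].
apply: cvgeZl => //.
apply: (@gf_limit R n d T Q Y mY s k _ _ _ _ (@ones_left R n) _ id (cst 1)) => //.
- apply: filterS (near_ones_left ltr01) => z z1; split; last by rewrite ler01 lexx.
  by move=> l; have /andP[/ltW -> /ltW ->] := z1 l.
- move=> e e1; apply: filterS (near_ones_left e1) => z z1; split; last exact: ltW.
  by move=> l; have /andP[/ltW ->] := z1 l.
- by apply: filterS gE => x [].
Unshelve. all: by end_near. Qed.

Lemma Psi_queue :
  Psi (joint_gf Q Y s k) zero_index 1 =
  ((fine (Q (in_period Y s k)))^-1%:E *
    phase_mean Q Y (fun y => (total_queue y)%:R) s k)%E.
Proof.
rewrite /Psi mfact_zero_index mul1n invr1 -/F.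
pose g (x : 'rV[R]_n.+1 * R) := gf_weight (@total_queue n)
  (fun y => (total_queue y).-1) (fun y l => Defs.orbit y l) x.1 x.2.
have gE : \forall x \near F, phase_mean Q Y (g x) s k \is a fin_num /\
  1 * partials zero_index (fun z => derive1n 1 (joint_gf Q Y s k z) x.2) x.1 =
  (fine (Q (in_period Y s k)))^-1 * fine (phase_mean Q Y (g x) s k).
  near=> x; have [x1 x2] : (forall j, 0 < x.1 0 j < 1) /\ 0 < x.2 < 1 by near: x; exact: near_F.
  have x1' l : 0 <= x.1 0 l <= 1 by have /andP[/ltW -> /ltW ->] := x1 l.
  have [? e] := derive_joint_gf Q mY s k x1' x2; split => //.
  by rewrite mul1r partials_zero_index e mulrC.
apply/cvg_lim => //.
apply: (@cvg_trans _ (((fine (Q (in_period Y s k)))^-1%:E *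
    (fine (phase_mean Q Y (g x) s k))%:E)%E @[x --> F])).
  by apply: near_eq_cvg; apply: filterS gE => x [_ ->].
apply: cvgeZl => //.
apply: gf_limit => //.
- apply: filterS (near_F ltr01) => x [x1 x2]; split.
    by move=> l; have /andP[/ltW -> /ltW ->] := x1 l.
  by have /andP[/ltW -> /ltW ->] := x2.
- move=> e /near_F; apply: filterS => x [x1 x2]; split.
    by move=> l; have /andP[/ltW ->] := x1 l.
  by have /andP[/ltW ->] := x2.
- by apply: filterS gE => x [].
Unshelve. all: by end_near. Qed.

End factorial_moments.

(** * The families of random intervals of the system *)

Section polling_families.
Context {R : realType} {n : nat} {d : measure_display} {T : measurableType d}.
Variables (lambda gamma nu : 'I_n.+1 -> R) (lawB lawS : 'I_n.+1 -> probability R R).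
Variables (P : probability T R) (X : clock n -> {RV P >-> R}) (x0 : 'I_n.+1 -> nat).
Hypothesis lambda_gt0 : forall i, 0 < lambda i.
Hypothesis gamma_gt0 : forall i, 0 < gamma i.
Hypothesis nu_gt0 : forall i, 0 < nu i.
Hypothesis lawB_duration : forall i, duration_law (lawB i).
Hypothesis lawS_duration : forall i, duration_law (lawS i).
Hypothesis meanB_gt0 : forall i, 0 < mean (lawB i).
Hypothesis meanS_gt0 : forall i, 0 < mean (lawS i).
Hypothesis primitives : polling_primitives lambda gamma nu lawB lawS X.

Local Notation Om := (path_space (R := R) (clock n)).
Local Notation PP := (path_law X).
Implicit Types (i : 'I_n.+1) (k m s j : nat) (c : Om).

(** The stations are visited cyclically: this is the number, among all visits, of the
    k-th one to station i, both counted from 0. *)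
Definition visit_no i k : nat := (k * n.+1 + i)%N.

Lemma station_visit_no i k : station (visit_no i k) = i.
Proof.
by apply/val_inj; rewrite /= /visit_no modnMDl modn_small.
Qed.

Lemma visit_no_inj i : injective (visit_no i).
Proof. by move=> k l /addIn /eqP; rewrite eqn_pmul2r// => /eqP. Qed.

Lemma visit_noP i p : station p = i <-> exists k, p = visit_no i k.
Proof.
split; last by move=> [k ->]; exact: station_visit_no.
by move=> <-; exists (p %/ n.+1)%N; rewrite /visit_no /= -divn_eq.
Qed.

Definition clock_law (a : clock n) : probability R R := distribution P (X a).

Lemma clock_law_interarrival i k : forall A, measurable A ->
  clock_law (interarrival i k) A = exponential_prob (lambda i) A.
Proof. exact: interarrival_law primitives i k. Qed.

Lemma clock_law_glue p : forall A, measurable A ->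
  clock_law (glue_length p) A = exponential_prob (gamma (station p)) A.
Proof. exact: glue_law primitives p. Qed.

Lemma clock_nonneg a : clock_law a `[0, +oo[%classic = 1%E.
Proof.
case: a => [i k|i k m|p|p j|p].
- exact: exponential_nonneg (lambda_gt0 i) (clock_law_interarrival i k).
- exact: exponential_nonneg (nu_gt0 i) (retrial_law primitives i k m).
- exact: exponential_nonneg (gamma_gt0 _) (clock_law_glue p).
- by rewrite [LHS](service_law primitives)//; have [] := lawB_duration (station p).
- by rewrite [LHS](switchover_law primitives)//; have [] := lawS_duration (station p).
Qed.

Lemma ae_nonneg : {ae PP, forall c a, 0 <= c a}.
Proof.
apply: ae_forall_count => a.
have mA : measurable [set c : Om | 0 <= c a].
  by apply: measurable_set_le; [exact: measurable_cst|exact: measurable_coordinate].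
apply: (measure1_ae mA); rewrite -(clock_nonneg a) path_lawE.
by congr (P _); apply/seteqP; split => o /=; rewrite in_itv/= andbT.
Qed.

Lemma wald_clock (a : clock n) (law : probability R R) (E : set Om) (f : R -> \bar R) :
  (forall B, measurable B -> clock_law a B = law B) ->
  measurable E -> free_of a E ->
  measurable_fun setT f -> (forall y, (0 <= f y)%E) ->
  (\int[PP]_(c in E) f (c a) = (\int[law]_y f y) * PP E)%E.
Proof.
move=> Ha mE Ea mf f0; apply: wald_path => //.
by move=> J A mA; apply: path_law_cylinder => //; exact: clocks_independent primitives.
Qed.

(** The interarrival times of rank s or more; the shift s serves to bound the number of
    late arrivals. *)
Section arrivals.
Variables (i : 'I_n.+1) (s : nat).

Definition arrival_act m : set Om := [set c | 0 <= renewal_time x0 c i (s + m)].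
Definition arrival_pos m c : R := renewal_time x0 c i (s + m).
Definition arrival_len m c : R := c (interarrival i (x0 i + (s + m))).

Lemma measurable_arrival_act m : measurable (arrival_act m).
Proof.
by apply: measurable_set_le; [exact: measurable_cst|exact: measurable_renewal_time].
Qed.

Lemma measurable_arrival_pos m : measurable_fun setT (arrival_pos m).
Proof. exact: measurable_renewal_time. Qed.

Lemma measurable_arrival_len m : measurable_fun setT (arrival_len m).
Proof. exact: measurable_coordinate. Qed.

Lemma arrival_wald t m (f : R -> \bar R) :
  measurable_fun setT f -> (forall y, (0 <= f y)%E) ->
  (\int[PP]_(c in started arrival_act arrival_pos t m) f (arrival_len m c) =
   (\int[clock_law (interarrival i 0)]_y f y) *
     PP (started arrival_act arrival_pos t m))%E.
Proof.
apply: wald_clock.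
- by move=> B mB; rewrite !clock_law_interarrival.
- apply: measurable_started; [exact: measurable_arrival_act|exact: measurable_arrival_pos].
- exact: free_of_interarrival.
Qed.

Lemma arrival_mean :
  (\int[clock_law (interarrival i 0)]_y (Num.max y 0)%:E = (lambda i)^-1%:E)%E.
Proof. exact: exponential_mean (lambda_gt0 i) (clock_law_interarrival i 0). Qed.

Lemma arrival_busyE t m c :
  (forall a, 0 <= c a) -> busy arrival_act arrival_pos arrival_len t m c <->
  renewal_time x0 c i (s + m) <= t < renewal_time x0 c i (s + m).+1.
Proof.
move=> c0; rewrite /busy /arrival_act /arrival_pos /arrival_len/= renewal_timeS.
by split => [[]//|h]; split => //; exact: renewal_time_ge0.
Qed.

Lemma measurable_arrival_busy t m :
  measurable (busy arrival_act arrival_pos arrival_len t m).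
Proof.
apply: measurable_busy => //; first exact: measurable_arrival_act.
exact: measurable_arrival_pos.
exact: measurable_arrival_len.
Qed.

Lemma arrival_busy_unique t : {ae PP, forall c u v,
  busy arrival_act arrival_pos arrival_len t u c ->
  busy arrival_act arrival_pos arrival_len t v c -> u = v}.
Proof.
apply: filterS ae_nonneg => c c0 u v.
move=> /(arrival_busyE _ _ c0) h1 /(arrival_busyE _ _ c0) h2.
by apply/eqP; rewrite -(eqn_add2l s); apply/eqP; exact: (renewal_unique c0 h1 h2).
Qed.

Lemma arrival_busy_le1 t :
  (mean_busy PP arrival_act arrival_pos arrival_len t <= 1)%E.
Proof.
apply: esum_measure_le1; last exact: arrival_busy_unique.
by move=> m; exact: measurable_arrival_busy.
Qed.

Definition n_arrivals := mean_started PP arrival_act arrival_pos.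

Lemma n_arrivals_fin t : 0 <= t -> n_arrivals t \is a fin_num.
Proof.
apply: (@mean_started_fin _ _ _ PP (clock_law (interarrival i 0)) _ _ _ _
  measurable_arrival_act measurable_arrival_pos measurable_arrival_len _
  arrival_wald (lambda i)^-1) => //.
- by rewrite invr_gt0.
- exact: arrival_mean.
- by move=> u _; exact: arrival_busy_le1.
Qed.

End arrivals.

Section glue_periods.
Variable i : 'I_n.+1.

Definition glue_act k : set Om := [set c | 0 <= glue_start x0 c (visit_no i k)].
Definition glue_pos k c : R := glue_start x0 c (visit_no i k).
Definition glue_len k c : R := c (glue_length (visit_no i k)).

Lemma measurable_glue_act k : measurable (glue_act k).
Proof.
by apply: measurable_set_le; [exact: measurable_cst|exact: measurable_glue_start].
Qed.

Lemma measurable_glue_pos k : measurable_fun setT (glue_pos k).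
Proof. exact: measurable_glue_start. Qed.

Lemma measurable_glue_len k : measurable_fun setT (glue_len k).
Proof. exact: measurable_coordinate. Qed.

Lemma glue_wald t k (f : R -> \bar R) :
  measurable_fun setT f -> (forall y, (0 <= f y)%E) ->
  (\int[PP]_(c in started glue_act glue_pos t k) f (glue_len k c) =
   (\int[clock_law (glue_length (visit_no i 0))]_y f y) *
     PP (started glue_act glue_pos t k))%E.
Proof.
apply: wald_clock.
- by move=> B mB; rewrite !clock_law_glue// !station_visit_no.
- apply: measurable_started; [exact: measurable_glue_act|exact: measurable_glue_pos].
- exact: free_of_glue.
Qed.

Lemma glue_mean : (\int[clock_law (glue_length (visit_no i 0))]_y (Num.max y 0)%:E =
  (mean_glue gamma i)%:E)%E.
Proof.
rewrite (exponential_mean (gamma_gt0 _) (clock_law_glue _)).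
by rewrite station_visit_no.
Qed.

Lemma glue_busyE t k c : (forall a, 0 <= c a) ->
  busy glue_act glue_pos glue_len t k c <->
  glue_start x0 c (visit_no i k) <= t < glue_end x0 c (visit_no i k).
Proof. by move=> c0; split => [[]//|h]; split => //; exact: glue_start_ge0. Qed.

Lemma measurable_glue_busy t k : measurable (busy glue_act glue_pos glue_len t k).
Proof.
apply: measurable_busy => //; first exact: measurable_glue_act.
exact: measurable_glue_pos.
exact: measurable_glue_len.
Qed.

Lemma glue_busy_unique t : {ae PP, forall c u v,
  busy glue_act glue_pos glue_len t u c ->
  busy glue_act glue_pos glue_len t v c -> u = v}.
Proof.
apply: filterS ae_nonneg => c c0 u v.
move=> /(glue_busyE _ _ c0)/(in_glue_in_cycle c0) h1.
move=> /(glue_busyE _ _ c0)/(in_glue_in_cycle c0) h2.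
by apply: (@visit_no_inj i); exact: (visit_unique c0 h1 h2).
Qed.

Lemma glue_busy_le1 t : (mean_busy PP glue_act glue_pos glue_len t <= 1)%E.
Proof.
apply: esum_measure_le1; last exact: glue_busy_unique.
by move=> m; exact: measurable_glue_busy.
Qed.

Definition n_glues := mean_started PP glue_act glue_pos.

Lemma n_glues_fin t : 0 <= t -> n_glues t \is a fin_num.
Proof.
apply: (@mean_started_fin _ _ _ PP (clock_law (glue_length (visit_no i 0))) _ _ _ _
  measurable_glue_act measurable_glue_pos measurable_glue_len _
  glue_wald (mean_glue gamma i)) => //.
- by rewrite invr_gt0.
- exact: glue_mean.
- by move=> u _; exact: glue_busy_le1.
Qed.

End glue_periods.

Section switchovers.
Variable i : 'I_n.+1.

Definition switch_act k : set Om := [set c | 0 <= visit_end x0 c (visit_no i k)].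
Definition switch_pos k c : R := visit_end x0 c (visit_no i k).
Definition switch_len k c : R := c (switchover (visit_no i k)).

Lemma measurable_switch_act k : measurable (switch_act k).
Proof.
by apply: measurable_set_le; [exact: measurable_cst|exact: measurable_visit_end].
Qed.

Lemma measurable_switch_pos k : measurable_fun setT (switch_pos k).
Proof. exact: measurable_visit_end. Qed.

Lemma measurable_switch_len k : measurable_fun setT (switch_len k).
Proof. exact: measurable_coordinate. Qed.

Lemma switch_wald t k (f : R -> \bar R) :
  measurable_fun setT f -> (forall y, (0 <= f y)%E) ->
  (\int[PP]_(c in started switch_act switch_pos t k) f (switch_len k c) =
   (\int[lawS i]_y f y) * PP (started switch_act switch_pos t k))%E.
Proof.
apply: wald_clock.
- by move=> B mB; rewrite [LHS](switchover_law primitives)// station_visit_no.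
- apply: measurable_started; [exact: measurable_switch_act|exact: measurable_switch_pos].
- exact: free_of_switchover.
Qed.

Lemma switch_busyE t k c : (forall a, 0 <= c a) ->
  busy switch_act switch_pos switch_len t k c <->
  visit_end x0 c (visit_no i k) <= t < glue_start x0 c (visit_no i k).+1.
Proof.
move=> c0; rewrite glue_startS; split => [[]//|h]; split => //.
apply: le_trans (glue_start_ge0 x0 c0 (visit_no i k)) _.
apply: le_trans (glue_start_le_end x0 c0 _) _.
exact: glue_end_le_visit_end.
Qed.

Lemma measurable_switch_busy t k : measurable (busy switch_act switch_pos switch_len t k).
Proof.
apply: measurable_busy => //; first exact: measurable_switch_act.
exact: measurable_switch_pos.
exact: measurable_switch_len.
Qed.

Lemma switch_busy_unique t : {ae PP, forall c u v,
  busy switch_act switch_pos switch_len t u c ->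
  busy switch_act switch_pos switch_len t v c -> u = v}.
Proof.
apply: filterS ae_nonneg => c c0 u v.
move=> /(switch_busyE _ _ c0)/(in_switchover_in_cycle c0) h1.
move=> /(switch_busyE _ _ c0)/(in_switchover_in_cycle c0) h2.
by apply: (@visit_no_inj i); exact: (visit_unique c0 h1 h2).
Qed.

Lemma switch_busy_le1 t : (mean_busy PP switch_act switch_pos switch_len t <= 1)%E.
Proof.
apply: esum_measure_le1; last exact: switch_busy_unique.
by move=> m; exact: measurable_switch_busy.
Qed.

Definition n_switches := mean_started PP switch_act switch_pos.

Lemma n_switches_fin t : 0 <= t -> n_switches t \is a fin_num.
Proof.
apply: (@mean_started_fin _ _ _ PP (lawS i) _ _ _ _
  measurable_switch_act measurable_switch_pos measurable_switch_len _
  switch_wald (mean (lawS i))) => //.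
- exact: duration_mean.
- by move=> u _; exact: switch_busy_le1.
Qed.

End switchovers.

(** The services at station i are indexed by a visit of i and a rank in the batch; the
    service exists if the rank is below the size of the batch. *)
Section services.
Variable i : 'I_n.+1.
Implicit Types u : nat * nat.

Definition service_act u : set Om :=
  [set c | (u.2 < batch_size x0 c (visit_no i u.1))%N /\
           0 <= service_start x0 c (visit_no i u.1) u.2].
Definition service_pos u c : R := service_start x0 c (visit_no i u.1) u.2.
Definition service_len u c : R := c (service (visit_no i u.1) u.2).

Lemma measurable_service_act u : measurable (service_act u).
Proof.
apply: measurable_set_and; last first.
  by apply: measurable_set_le; [exact: measurable_cst|exact: measurable_service_start].
rewrite (_ : [set c | _] = [set c : Om | exists b,
    batch_size x0 c (visit_no i u.1) = b /\ (u.2 < b)%N]).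
  apply: measurable_set_exists => b; apply: measurable_set_and.
    exact: nat_measurable_batch_size.
  exact: measurable_set_cst.
by apply/seteqP; split => c /= => [h|[b [->]]//]; eexists; split.
Qed.

Lemma measurable_service_pos u : measurable_fun setT (service_pos u).
Proof. exact: measurable_service_start. Qed.

Lemma measurable_service_len u : measurable_fun setT (service_len u).
Proof. exact: measurable_coordinate. Qed.

Lemma service_wald t u (f : R -> \bar R) :
  measurable_fun setT f -> (forall y, (0 <= f y)%E) ->
  (\int[PP]_(c in started service_act service_pos t u) f (service_len u c) =
   (\int[lawB i]_y f y) * PP (started service_act service_pos t u))%E.
Proof.
apply: wald_clock.
- by move=> B mB; rewrite [LHS](service_law primitives)// station_visit_no.
- apply: measurable_started; [exact: measurable_service_act|exact: measurable_service_pos].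
- exact: free_of_service.
Qed.

Lemma service_busyE t u c : (forall a, 0 <= c a) ->
  busy service_act service_pos service_len t u c <->
  (u.2 < batch_size x0 c (visit_no i u.1))%N /\
  service_start x0 c (visit_no i u.1) u.2 <= t <
    service_start x0 c (visit_no i u.1) u.2.+1.
Proof.
move=> c0; rewrite service_startS; split => [[[]//]|[ub h]]; split => //; split => //.
apply: le_trans (glue_start_ge0 x0 c0 (visit_no i u.1)) _.
apply: le_trans (glue_start_le_end x0 c0 _) _.
exact: glue_end_le_service.
Qed.

Lemma measurable_service_busy t u : measurable (busy service_act service_pos service_len t u).
Proof.
apply: measurable_busy => //; first exact: measurable_service_act.
  exact: measurable_service_pos.
  exact: measurable_service_len.
by move=> v c [].
Qed.

Lemma service_busy_unique t : {ae PP, forall c u v,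
  busy service_act service_pos service_len t u c ->
  busy service_act service_pos service_len t v c -> u = v}.
Proof.
apply: filterS ae_nonneg => c c0 [k j] [l m].
move=> /(service_busyE _ _ c0)[/= b1 h1] /(service_busyE _ _ c0)[/= b2 h2].
have kl : k = l.
  apply: (@visit_no_inj i).
  exact: (visit_unique c0 (in_service_in_cycle c0 b1 h1) (in_service_in_cycle c0 b2 h2)).
by rewrite kl in h1 *; congr pair; exact: (service_unique c0 h1 h2).
Qed.

Lemma service_busy_le1 t : (mean_busy PP service_act service_pos service_len t <= 1)%E.
Proof.
apply: esum_measure_le1; last exact: service_busy_unique.
by move=> m; exact: measurable_service_busy.
Qed.

Definition n_services := mean_started PP service_act service_pos.

Lemma n_services_fin t : 0 <= t -> n_services t \is a fin_num.
Proof.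
apply: (@mean_started_fin _ _ _ PP (lawB i) _ _ _ _
  measurable_service_act measurable_service_pos measurable_service_len _
  service_wald (mean (lawB i))) => //.
- by move=> u c [].
- exact: duration_mean.
- by move=> u _; exact: service_busy_le1.
Qed.

End services.

(** The expected number of cycles completed by any given time is finite, so almost
    surely time runs through all the visits, and likewise for the arrivals. *)
Lemma ae_arrivals_diverge :
  {ae PP, forall c i (t : R), exists m, t < renewal_time x0 c i m}.
Proof.
apply: ae_forall_count => i.
apply: (ae_unbounded (measurable_arrival_pos i 0) (measurable_arrival_act i 0)).
- by apply: filterS ae_nonneg => c c0 k; exact: renewal_time_ge0.
- by move=> t t0; exact: n_arrivals_fin.
Qed.

Lemma ae_cycles_diverge : {ae PP, forall c (t : R), exists p, t < glue_start x0 c p}.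
Proof.
have : {ae PP, forall c t, exists k, t < glue_pos ord0 k c}.
  apply: (ae_unbounded (measurable_glue_pos ord0) (measurable_glue_act ord0)).
  - by apply: filterS ae_nonneg => c c0 k; exact: glue_start_ge0.
  - by move=> t t0; exact: n_glues_fin.
by apply: filterS => c h t; have [k] := h t; exists (visit_no ord0 k).
Qed.

(** Outside a null event the clocks are nonnegative and time runs through all the
    arrivals and all the visits. *)
Definition good_path c : Prop := [/\ forall a, 0 <= c a,
  forall i (t : R), exists m, t < renewal_time x0 c i m &
  forall t : R, exists p, t < glue_start x0 c p].

Lemma ae_good : {ae PP, forall c, good_path c}.
Proof. by apply: filterS3 ae_nonneg ae_arrivals_diverge ae_cycles_diverge => c. Qed.

(** * Rates and probabilities of the periods *)

Section steady_limits.
Context {d' : measure_display} {T' : measurableType d'}.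
Variables (Q : probability T' R) (Y : T' -> state n).
Hypothesis steady : steady_state X x0 Q Y.

Lemma law_cvg (A : set (state n)) :
  fine (PP [set c | A (state_at x0 c t)]) @[t --> +oo] --> fine (Q (Y @^-1` A)).
Proof.
apply: (@cvg_law _ _ _ _ _ _ PP Q (fun t c => state_at x0 c t) Y) => //.
- by move=> t y; exact: measurable_state_at.
- exact: steady.1.
- exact: steady.2.
Qed.

Lemma measurable_state_event t (A : set (state n)) :
  measurable [set c : Om | A (state_at x0 c t)].
Proof.
apply: (@measurable_countable_preimage _ _ Om (fun c => state_at x0 c t)) => y.
exact: measurable_state_at.
Qed.

(** A property that the state almost surely has at each time passes to the limit law. *)
Lemma ae_steady (A : set (state n)) :
  (forall t, 0 <= t -> {ae PP, forall c, A (state_at x0 c t)}) ->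
  {ae Q, forall o, A (Y o)}.
Proof.
move=> hA; have mA : measurable (Y @^-1` A).
  by apply: measurable_countable_preimage; exact: steady.1.
apply: (measure1_ae mA).
have : fine (Q (Y @^-1` A)) = 1.
  have h : fine (PP [set c | A (state_at x0 c t)]) @[t --> +oo] --> (1 : R).
    apply: (@cvg_eq_ge0 _ _ (cst 1)); last exact: cvg_cst.
    move=> t t0; rewrite ae_measure1//; first exact: measurable_state_event.
    exact: hA.
  rewrite -(cvg_lim _ (@law_cvg A))//; exact: cvg_lim.
by move=> h1; rewrite -[LHS]fineK ?fin_num_measure// h1.
Qed.

Definition in_phase (s : phase) i : set (state n) :=
  [set y | st_phase y = s /\ st_station y = i].

Lemma glue_busy_phase i t : 0 <= t ->
  mean_busy PP (glue_act i) (glue_pos i) (glue_len i) t =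
  PP [set c | in_phase InGlue i (state_at x0 c t)].
Proof.
move=> t0; apply: esum_measure_unique.
- by move=> k; exact: measurable_glue_busy.
- exact: measurable_state_event.
- apply: filterS2 ae_good (glue_busy_unique i t) => c [c0 _ cy] uniq; split => //.
  split => [[k /(glue_busyE _ _ _ c0)/(in_glueP c0 cy _ t0)[ph vt]]|[/= ph]].
    by split => //=; rewrite vt station_visit_no.
  move=> /visit_noP[k vt]; exists k; apply/(glue_busyE _ _ _ c0).
  by apply/(in_glueP c0 cy _ t0).
Qed.

Lemma switch_busy_phase i t : 0 <= t ->
  mean_busy PP (switch_act i) (switch_pos i) (switch_len i) t =
  PP [set c | in_phase InSwitch i (state_at x0 c t)].
Proof.
move=> t0; apply: esum_measure_unique.
- by move=> k; exact: measurable_switch_busy.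
- exact: measurable_state_event.
- apply: filterS2 ae_good (switch_busy_unique i t) => c [c0 _ cy] uniq; split => //.
  split => [[k /(switch_busyE _ _ _ c0)/(in_switchoverP c0 cy _ t0)[ph vt]]|[/= ph]].
    by split => //=; rewrite vt station_visit_no.
  move=> /visit_noP[k vt]; exists k; apply/(switch_busyE _ _ _ c0).
  by apply/(in_switchoverP c0 cy _ t0).
Qed.

Lemma service_busy_phase i t : 0 <= t ->
  mean_busy PP (service_act i) (service_pos i) (service_len i) t =
  PP [set c | in_phase InVisit i (state_at x0 c t)].
Proof.
move=> t0; apply: esum_measure_unique.
- by move=> k; exact: measurable_service_busy.
- exact: measurable_state_event.
- apply: filterS2 ae_good (service_busy_unique i t) => c [c0 _ cy] uniq; split => //.
  split => [[[k j] /(service_busyE _ _ _ c0) h]|[/= ph]].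
    have /(in_visitP c0 cy _ t0)[ph vt] : exists j, (j < batch_size x0 c (visit_no i k))%N /\
      service_start x0 c (visit_no i k) j <= t < service_start x0 c (visit_no i k) j.+1.
      by exists j.
    by split => //=; rewrite vt station_visit_no.
  move=> /visit_noP[k vt].
  have [j hj] := (in_visitP c0 cy _ t0).2 (conj ph vt).
  by exists (k, j); apply/(service_busyE _ _ _ c0).
Qed.

(** At any time some next customer is awaited. *)
Lemma arrival_busy_phase i t : 0 <= t ->
  mean_busy PP (arrival_act i 0) (arrival_pos i 0) (arrival_len i 0) t = 1%E.
Proof.
move=> t0; rewrite -(probability_setT PP); apply: esum_measure_unique => //.
- by move=> k; exact: measurable_arrival_busy.
- apply: filterS2 ae_good (arrival_busy_unique i 0 t) => c [c0 ca _] uniq; split => //.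
  split => // _.
  have [|m hm] := @step_exists _ (renewal_time x0 c i) t _ (ca i t).
    by rewrite renewal_time0.
  by exists m; apply/(arrival_busyE _ _ _ _ c0).
Qed.

Definition period_prob (s : phase) i : R := fine (Q (in_period Y s i)).

Let busy_cvg (b : R -> \bar R) (s : phase) i :
  (forall t, 0 <= t -> b t = PP [set c | in_phase s i (state_at x0 c t)]) ->
  fine (b t) @[t --> +oo] --> period_prob s i.
Proof.
by move=> bE; apply: (cvg_eq_ge0 _ (@law_cvg (in_phase s i))) => t t0; rewrite bE.
Qed.

Lemma glue_rate i : fine (n_glues i t) / t @[t --> +oo] -->
  period_prob InGlue i / mean_glue gamma i.
Proof.
apply: (renewal_rate (measurable_glue_act i) (measurable_glue_pos i)
  (measurable_glue_len i) _ (glue_wald i) _ (glue_mean i)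
  (fun t _ => glue_busy_le1 i t)) => //.
- by rewrite invr_gt0.
- by apply: busy_cvg => t; exact: glue_busy_phase.
Qed.

Lemma switch_rate i : fine (n_switches i t) / t @[t --> +oo] -->
  period_prob InSwitch i / mean (lawS i).
Proof.
apply: (renewal_rate (measurable_switch_act i) (measurable_switch_pos i)
  (measurable_switch_len i) _ (switch_wald i) _ (duration_mean (lawS_duration i))
  (fun t _ => switch_busy_le1 i t)) => //.
- by apply: busy_cvg => t; exact: switch_busy_phase.
Qed.

Lemma service_rate i : fine (n_services i t) / t @[t --> +oo] -->
  period_prob InVisit i / mean (lawB i).
Proof.
apply: (renewal_rate (measurable_service_act i) (measurable_service_pos i)
  (measurable_service_len i) _ (service_wald i) _ (duration_mean (lawB_duration i))
  (fun t _ => service_busy_le1 i t)) => //.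
- by move=> u c [].
- by apply: busy_cvg => t; exact: service_busy_phase.
Qed.

Lemma arrival_rate i : fine (n_arrivals i 0 t) / t @[t --> +oo] --> lambda i.
Proof.
rewrite -[lambda i in X in _ --> X]invrK -[X in _ --> X]mul1r.
apply: (renewal_rate (measurable_arrival_act i 0) (measurable_arrival_pos i 0)
  (measurable_arrival_len i 0) _ (arrival_wald i 0) _ (arrival_mean i)
  (fun t _ => arrival_busy_le1 i 0 t)) => //.
- by rewrite invr_gt0.
- apply: (@cvg_eq_ge0 _ _ (cst 1)); last exact: cvg_cst.
  by move=> t t0; rewrite arrival_busy_phase.
Qed.

(** Between two consecutive visits to station 0 each station is visited once, so
    glue periods and switchovers of all stations start at the same rate. *)
Lemma n_glues_bounds i t : 0 <= t ->
  fine (n_glues ord0 t) - 1 <= fine (n_glues i t) <= fine (n_glues ord0 t) /\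
  fine (n_glues ord0 t) - 1 <= fine (n_switches i t) <= fine (n_glues ord0 t).
Proof.
move=> t0.
have mg l k : measurable (started (glue_act l) (glue_pos l) t k).
  by apply: measurable_started; [exact: measurable_glue_act|exact: measurable_glue_pos].
have ms l k : measurable (started (switch_act l) (switch_pos l) t k).
  by apply: measurable_started; [exact: measurable_switch_act|exact: measurable_switch_pos].
have sg : (n_switches i t <= n_glues i t)%E.
  apply: le_esum => k _; apply: le_measure_ae => //.
  apply: filterS ae_nonneg => c c0 [_ /= h]; split; first exact: glue_start_ge0.
  by apply: le_trans h; exact: le_trans (glue_start_le_end x0 c0 _) (glue_end_le_visit_end x0 c0 _).
have g0 : (n_glues i t <= n_glues ord0 t)%E.
  apply: le_esum => k _; apply: le_measure_ae => //.
  apply: filterS ae_nonneg => c c0 [_ /= h]; split; first exact: glue_start_ge0.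
  by apply: le_trans h; apply: glue_start_homo => //; rewrite leq_add2l.
have s0 : (n_glues ord0 t <= 1 + n_switches i t)%E.
  rewrite /n_glues /n_switches /mean_started -!nneseries_esumT//.
  rewrite nneseries_recl//; apply: leeD; first exact: probability_le1.
  rewrite -nneseries_addn//; apply: lee_nneseries => // k _.
  apply: le_measure_ae => //; apply: filterS ae_nonneg => c c0 [_ /= h].
  have ve : visit_end x0 c (visit_no i k) <= glue_start x0 c (visit_no (ord0 : 'I_n.+1) (k + 1)%N).
    apply: (le_trans (visit_end_le x0 c0 (visit_no i k))); apply: glue_start_homo => //.
    by rewrite /visit_no addn1 mulSn addn0 -addnS addnC leq_add2r ltn_ord.
  split; last exact: le_trans ve h.
  apply: le_trans (glue_start_ge0 x0 c0 (visit_no i k)) _.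
  exact: le_trans (glue_start_le_end x0 c0 _) (glue_end_le_visit_end x0 c0 _).
move: sg g0 s0.
rewrite -(fineK (n_glues_fin i t0)) -(fineK (n_glues_fin ord0 t0)).
rewrite -(fineK (n_switches_fin i t0)) -EFinD !lee_fin => sg g0 s0.
by split; apply/andP; split; lra.
Qed.

(** Two counts that differ by at most 1 have the same rate. *)
Let squeeze_rate (f : R -> R) (l : R) :
  (forall t, 0 <= t -> fine (n_glues ord0 t) - 1 <= f t <= fine (n_glues ord0 t)) ->
  f t / t @[t --> +oo] --> l -> l = period_prob InGlue ord0 / mean_glue gamma ord0.
Proof.
move=> hf fl; apply: (cvg_unique _ fl) => //.
have V0 : (t^-1 : R) @[t --> +oo] --> (0 : R).
  by apply/gtr0_cvgV0; [apply: nbhs_pinfty_gt; rewrite num_real|exact: cvg_id].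
apply: (@squeeze_cvgr _ _ _ _ (fun t => fine (n_glues ord0 t) / t - t^-1)
  (fun t => fine (n_glues ord0 t) / t)).
- near=> t; have t_gt0 : 0 < t by near: t; apply: nbhs_pinfty_gt; rewrite num_real.
  have /andP[h1 h2] := hf t (ltW t_gt0).
  by rewrite -{2}(mul1r t^-1) -mulrBl !ler_pM2r ?invr_gt0// h1.
- rewrite -[X in _ --> X]subr0; apply: cvgB => //; exact: glue_rate.
- exact: glue_rate.
Unshelve. all: by end_near. Qed.

(** The rate of the glue periods of the first station, one per cycle. *)
Definition cycle_rate : R := period_prob InGlue ord0 / mean_glue gamma ord0.

Lemma glue_prob i : period_prob InGlue i = mean_glue gamma i * cycle_rate.
Proof.
rewrite /cycle_rate -(squeeze_rate (fun t t0 => (n_glues_bounds i t0).1) (@glue_rate i)).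
by rewrite mulrC mulfVK// gt_eqF// invr_gt0.
Qed.

Lemma switch_prob i : period_prob InSwitch i = mean (lawS i) * cycle_rate.
Proof.
rewrite /cycle_rate -(squeeze_rate (fun t t0 => (n_glues_bounds i t0).2) (@switch_rate i)).
by rewrite mulrC mulfVK// gt_eqF.
Qed.

(** * Balance of the customers of a station *)

Lemma measurable_nat_EFin d1 (V : measurableType d1) (f : V -> nat) :
  nat_measurable f -> measurable_fun setT (fun x => (f x)%:R%:E : \bar R).
Proof.
move=> mf; apply: (measurable_fun_random (F := fun k _ => k%:R%:E)) => // k.
Qed.

Lemma count_set_esum (A : set nat) : finite_set A ->
  (count_set A)%:R%:E = (\esum_(k in setT) (\1_A k)%:E)%E :> \bar R.
Proof.
move=> fA; transitivity (\esum_(k in A) 1%:E : \bar R)%E; last first.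
  by rewrite esum_mkcond; apply: eq_esum => k _; rewrite indicE; case: (k \in A).
by rewrite esum_fset// fsbig_finite//= sumEFin /count_set -sum1_size natr_sum.
Qed.

Lemma esum_lt (m : nat) (a : nat -> \bar R) : (forall j, 0 <= a j)%E ->
  (\esum_(j in setT) (if (j < m)%N then a j else 0) = \sum_(j < m) a j)%E.
Proof.
move=> a0; rewrite fsbig_ord -esum_fset//.
rewrite [RHS]esum_mkcond; apply: eq_esum => j _.
by rewrite [in RHS](_ : (j \in `I_m) = (j < m)%N)//; apply/idP/idP; rewrite inE.
Qed.

Section customer_balance.
Variable i : 'I_n.+1.

Definition arrived t c : nat := count_set [set k | arrival x0 c i k <= t].

Definition unserved t c : nat := (orbit_at x0 c t i + queue_at x0 c t i)%N.

Lemma nat_measurable_arrived t : nat_measurable (arrived t).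
Proof.
apply: nat_measurable_count => k.
by apply: measurable_set_le; [exact: measurable_arrival|exact: measurable_cst].
Qed.

Lemma nat_measurable_unserved t : nat_measurable (unserved t).
Proof.
by apply: nat_measurable_op; [exact: nat_measurable_orbit_at|exact: nat_measurable_queue_at].
Qed.

(** The customers present at the start arrive at time 0; for the new ones, the arrival
    of one is the start of the next interarrival time, and the first such start, at
    time 0, is the 1 on the left. *)
Lemma mean_arrived t : 0 <= t ->
  (\int[PP]_c (arrived t c)%:R%:E + 1 = (x0 i)%:R%:E + n_arrivals i 0 t)%E.
Proof.
move=> t0.
have mA k : measurable [set c : Om | arrival x0 c i k <= t].
  by apply: measurable_set_le; [exact: measurable_arrival|exact: measurable_cst].
have -> : (\int[PP]_c (arrived t c)%:R%:E =
           \esum_(k in setT) PP [set c : Om | (arrival x0 c i k <= t)%R])%E.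
  transitivity (\int[PP]_c \esum_(k in setT) (\1_[set c : Om | (arrival x0 c i k <= t)%R] c)%:E)%E.
    apply: ge0_ae_eq_integral => //.
    - by apply: measurable_nat_EFin; exact: nat_measurable_arrived.
    - apply: emeasurable_esum => // k.
      by apply/measurable_EFinP; exact: measurable_indic.
    - by move=> c _; exact: esum_ge0.
    - apply: filterS ae_good => c [c0 ca _] _.
      rewrite count_set_esum; last exact: finite_arrived.
      by apply: eq_esum => k _; rewrite !indicE; congr ((nat_of_bool _)%:R%:E); apply/idP/idP; rewrite !inE.
  rewrite integral_esum//.
    by apply: eq_esum => k _; rewrite integral_indic// setIT.
  by move=> k; apply/measurable_EFinP; exact: measurable_indic.
rewrite -nneseries_esumT// (nneseries_split 0 (x0 i))//= add0n.
have -> : (\sum_(0 <= k < x0 i) PP [set c : Om | (arrival x0 c i k <= t)%R] = (x0 i)%:R%:E)%E.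
  rewrite (eq_big_nat _ _ (F2 := fun=> 1%:E)).
    by rewrite sumEFin sumr_const_nat subn0.
  move=> k /andP[_ kx]; rewrite -[RHS](probability_setT PP); congr (PP _).
  by apply/seteqP; split => c //= _; rewrite arrival_initial.
rewrite -addeA; congr (_ + _)%E.
rewrite -nneseries_addn// /n_arrivals /mean_started -nneseries_esumT//.
rewrite [RHS]nneseries_recl// addeC; congr (_ + _)%E.
  rewrite -[LHS](probability_setT PP); congr (PP _).
  apply/seteqP; split => c //= _; rewrite /started /arrival_act /arrival_pos/=.
  by rewrite renewal_time0 lexx.
rewrite -(@nneseries_addn _ _ 1)//; apply: eq_eseriesr => m _.
apply: eq_measure_ae => //.
  apply: measurable_started; [exact: measurable_arrival_act|exact: measurable_arrival_pos].
apply: filterS ae_nonneg => c c0; rewrite /started /arrival_act /arrival_pos/=.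
rewrite add0n addn1 addnC arrivalE; split => [h|[]//]; split => //.
exact: renewal_time_ge0.
Qed.

(** No service of a visit after the one in progress has started, and [visit_no]
    enumerates the visits of station i. *)
Lemma served_esum t c : good_path c -> 0 <= t ->
  (\sum_(p < (visit_at x0 c t).+1 | station p == i) served_by x0 c t p)%:R%:E =
  (\esum_(u in setT) (\1_(started (service_act i) (service_pos i) t u) c)%:E)%E
  :> \bar R.
Proof.
move=> [c0 _ cy] t0.
have inner p : (\esum_(j in setT) (\1_[set j | (j < batch_size x0 c p)%N /\
    (service_start x0 c p j <= t)%R] j)%:E = (served_by x0 c t p)%:R%:E :> \bar R)%E.
  rewrite /served_by natr_sum -sumEFin.
  rewrite -(@esum_lt _ (fun j => ((service_start x0 c p j <= t)%R)%:R%:E))//.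
  apply: eq_esum => j _; rewrite indicE.
  have [jb|jb] := boolP (j < batch_size x0 c p)%N.
    by congr ((nat_of_bool _)%:R%:E); apply/idP/idP => [|h]; rewrite inE/= => //; case.
  by rewrite memNset//= => -[]; rewrite (negPf jb).
have zero p : (visit_at x0 c t < p)%N -> served_by x0 c t p = 0%N.
  move=> vp; rewrite /served_by big1// => j _; apply/eqP; rewrite eqb0 -ltNge.
  have /andP[_ h] := visit_atP c0 cy t0; apply: (lt_le_trans h).
  apply: (le_trans (glue_start_homo x0 c0 vp)).
  exact: le_trans (glue_start_le_end x0 c0 p) (glue_end_le_service x0 c0 p j).
transitivity (\esum_(k in setT) (served_by x0 c t (visit_no i k))%:R%:E : \bar R)%E.
  rewrite -(@esum_image _ _ _ setT (visit_no i) (fun p => (served_by x0 c t p)%:R%:E)); last first.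
    by move=> k l _ _; exact: visit_no_inj.
  rewrite esum_mkcond natr_sum -sumEFin big_mkcond/=.
  rewrite -(@esum_lt _ (fun p => if station p == i then (served_by x0 c t p)%:R%:E else 0%E)); last first.
    by move=> p; case: ifP.
  apply: eq_esum => p _; case: ifPn => [_|].
    congr (if _ then _ else _); apply/eqP/idP; rewrite inE.
      by move=> /visit_noP[k ->]; exists k.
    by move=> [k _ <-]; exact: station_visit_no.
  by rewrite -leqNgt => /zero ->; case: ifP.
transitivity (\esum_(k in setT) \esum_(j in setT)
    (\1_(started (service_act i) (service_pos i) t (k, j)) c)%:E : \bar R)%E.
  apply: eq_esum => k _; rewrite -inner; apply: eq_esum => j _.
  rewrite !indicE; congr ((nat_of_bool _)%:R%:E); apply/idP/idP; rewrite !inE.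
    move=> [jb h]; split => //; split => //=.
    apply: (le_trans (glue_start_ge0 x0 c0 (visit_no i k))).
    exact: le_trans (glue_start_le_end x0 c0 _) (glue_end_le_service x0 c0 _ j).
  by move=> [[jb _] h].
rewrite (@esum_esum _ _ _ setT (fun=> setT))//.
rewrite (_ : setT `*`` _ = setT); last by apply/seteqP; split.
by apply: eq_esum => -[k j] _.
Qed.

(** Expectation of the pathwise balance: an arrived customer is unserved or has
    started service. *)
Lemma unserved_balance t : 0 <= t ->
  (\int[PP]_c (unserved t c)%:R%:E + n_services i t =
   \int[PP]_c (arrived t c)%:R%:E)%E.
Proof.
move=> t0.
have mS u : measurable (started (service_act i) (service_pos i) t u).
  apply: measurable_started; [exact: measurable_service_act|exact: measurable_service_pos].
have mI u : measurable_fun setT (fun c : Om =>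
    (\1_(started (service_act i) (service_pos i) t u) c)%:E : \bar R).
  by apply/measurable_EFinP; exact: measurable_indic.
have -> : n_services i t = (\int[PP]_c \esum_(u in setT)
    (\1_(started (service_act i) (service_pos i) t u) c)%:E)%E.
  rewrite integral_esum//; apply: eq_esum => u _.
  by rewrite integral_indic// setIT.
rewrite -ge0_integralD//; last 3 first.
- by apply: measurable_nat_EFin; exact: nat_measurable_unserved.
- by move=> c _; exact: esum_ge0.
- exact: emeasurable_esum.
apply: ge0_ae_eq_integral => //.
- apply: emeasurable_funD; last exact: emeasurable_esum.
  by apply: measurable_nat_EFin; exact: nat_measurable_unserved.
- by apply: measurable_nat_EFin; exact: nat_measurable_arrived.
- by move=> c _; apply: adde_ge0 => //; exact: esum_ge0.
- apply: filterS ae_good => c gc _; rewrite -served_esum//.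
  have [c0 ca cy] := gc.
  by rewrite -EFinD -natrD /arrived (arrived_customers c0 ca cy i t0).
Qed.

Lemma mean_arrived_fin t : 0 <= t -> (\int[PP]_c (arrived t c)%:R%:E)%E \is a fin_num.
Proof.
move=> t0; have := mean_arrived t0; rewrite -(fineK (n_arrivals_fin i 0 t0)) -EFinD.
by case: (\int[PP]_c _)%E.
Qed.

Lemma unserved_arrived_fin t : 0 <= t ->
  (\int[PP]_c (unserved t c)%:R%:E)%E \is a fin_num.
Proof.
move=> t0; rewrite ge0_fin_numE; last by apply: integral_ge0 => c _; rewrite lee_fin.
have := mean_arrived_fin t0; rewrite ge0_fin_numE; last by apply: integral_ge0 => c _; rewrite lee_fin.
apply: le_lt_trans; rewrite -unserved_balance// leeDl//; exact: esum_ge0.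
Qed.

(** The interarrival times of rank s or more are only in progress once the s-th new
    customer is awaited, an event whose probability is, as in Markov's inequality, at
    most the mean number of arrivals over s + 1.  So few late arrivals are expected when s
    is a large multiple of t: the number of arrivals is uniformly integrable on the
    scale of t. *)
Lemma late_arrivals (K s : nat) t : 0 < trunc_mean (clock_law (interarrival i 0)) K ->
  0 <= t ->
  fine (n_arrivals i s t) <= (t + K%:R) * (fine (n_arrivals i 0 t) / s.+1%:R) /
    trunc_mean (clock_law (interarrival i 0)) K.
Proof.
move=> K0 t0.
have mst s' m : measurable (started (arrival_act i s') (arrival_pos i s') t m).
  by apply: measurable_started; [exact: measurable_arrival_act|exact: measurable_arrival_pos].
pose p := fine (PP (started (arrival_act i 0) (arrival_pos i 0) t s)).
have p0 : 0 <= p by rewrite fine_ge0.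
have pn : p <= fine (n_arrivals i 0 t) / s.+1%:R.
  rewrite ler_pdivlMr// -lee_fin (fineK (n_arrivals_fin i 0 t0)).
  rewrite /n_arrivals /mean_started -nneseries_esumT//.
  apply: le_trans (nneseries_lim_ge s.+1 _) => //.
  rewrite (_ : (p * s.+1%:R)%:E = \sum_(0 <= m < s.+1) p%:E)%E; last first.
    by rewrite sumEFin sumr_const_nat subn0 mulr_natr.
  rewrite big_nat [leRHS]big_nat; apply: lee_sum => m /andP[_ ms].
  rewrite /p fineK ?fin_num_measure//; apply: le_measure_ae => //.
  apply: filterS ae_nonneg => c c0 [_ /= h]; split; first exact: renewal_time_ge0.
  by apply: le_trans h; apply: renewal_time_homo => //.
have h : (n_arrivals i s t <= ((t + K%:R) * p /
    trunc_mean (clock_law (interarrival i 0)) K)%:E)%E.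
  apply: (mean_started_bound (measurable_arrival_act i s) (measurable_arrival_pos i s)
    (measurable_arrival_len i s) _ (arrival_wald i s) (arrival_mean i)) => //.
  move=> t' /andP[t'0 t't].
  have mb m : measurable (busy (arrival_act i s) (arrival_pos i s) (arrival_len i s) t' m).
    exact: measurable_arrival_busy.
  rewrite /mean_busy (@esum_measure_unique _ _ _ PP _ _ (\bigcup_m
    (busy (arrival_act i s) (arrival_pos i s) (arrival_len i s) t' m)))//.
  - rewrite /p fineK ?fin_num_measure//; apply: le_measure_ae => //.
      exact: bigcup_measurable.
    apply: filterS ae_nonneg => c c0 [m _ [_ /= /andP[h _]]].
    split; first exact: renewal_time_ge0.
    apply: le_trans (le_trans h t't); apply: renewal_time_homo => //.
    by rewrite add0n leq_addr.
  - exact: bigcup_measurable.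
  - apply: filterS (arrival_busy_unique i s t') => c hu; split => //.
    by split => [[m hm]|[m _ hm]]; exists m.
rewrite -lee_fin (fineK (n_arrivals_fin i s t0)); apply: (le_trans h).
rewrite lee_fin ler_pM2r ?invr_gt0// ler_wpM2l// addr_ge0//.
Qed.

(** The unserved customers are at most e t, except on the unlikely event that they
    are more; there they are fewer than the arrived ones, of which all but
    [x0 i + s] are late. *)
Lemma mean_unserved_le (s : nat) (e t : R) : 0 <= t -> 0 < e ->
  fine (\int[PP]_c (unserved t c)%:R%:E) <=
  e * t + (x0 i + s)%:R * fine (PP [set c | e * t < (unserved t c)%:R]) +
  fine (n_arrivals i s t).
Proof.
move=> t0 e0; pose B := [set c : Om | e * t < (unserved t c)%:R].
have mB : measurable B.
  rewrite (_ : B = [set c | exists k, unserved t c = k /\ e * t < k%:R]).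
    apply: measurable_set_exists => k; apply: measurable_set_and.
      exact: nat_measurable_unserved.
    exact: measurable_set_cst.
  by apply/seteqP; split => c /= => [h|[k [<-]]//]; exists (unserved t c).
have mS m : measurable (started (arrival_act i s) (arrival_pos i s) t m).
  by apply: measurable_started; [exact: measurable_arrival_act|exact: measurable_arrival_pos].
have mI m : measurable_fun setT (fun c : Om =>
    (\1_(started (arrival_act i s) (arrival_pos i s) t m) c)%:E : \bar R).
  by apply/measurable_EFinP; exact: measurable_indic.
rewrite -lee_fin (fineK (unserved_arrived_fin t0)) !EFinD (fineK (n_arrivals_fin i s t0)).
rewrite [((x0 i + s)%:R * _)%:E]EFinM fineK ?fin_num_measure//.
have -> : n_arrivals i s t = (\int[PP]_c \esum_(m in setT)
    (\1_(started (arrival_act i s) (arrival_pos i s) t m) c)%:E)%E.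
  rewrite integral_esum//; apply: eq_esum => m _.
  by rewrite integral_indic// setIT.
have mBI : measurable_fun setT (fun c : Om => (\1_B c)%:E : \bar R).
  by apply/measurable_EFinP; exact: measurable_indic.
have -> : (e * t)%:E = (\int[PP]_c cst (e * t)%:E c)%E.
  by rewrite integral_cst// [X in (_ * X)%E]probability_setT mule1.
rewrite -[B in PP B]setIT -integral_indic// -ge0_integralZl_EFin//.
rewrite -ge0_integralD//=; last 2 first.
- by move=> c _; rewrite lee_fin mulr_ge0// ltW.
- exact: measurable_funeM.
rewrite -ge0_integralD//=; last 4 first.
- by move=> c _; rewrite adde_ge0 ?mule_ge0// lee_fin// mulr_ge0// ltW.
- by apply: emeasurable_funD => //; exact: measurable_funeM.
- by move=> c _; exact: esum_ge0.
- exact: emeasurable_esum.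
apply: ae_ge0_le_integral => //.
- by apply: measurable_nat_EFin; exact: nat_measurable_unserved.
- move=> c _; rewrite adde_ge0//; last exact: esum_ge0.
  by rewrite adde_ge0 ?mule_ge0// lee_fin// mulr_ge0// ltW.
- apply: emeasurable_funD; last exact: emeasurable_esum.
  by apply: emeasurable_funD => //; exact: measurable_funeM.
apply: filterS ae_good => c [c0 ca cy] _.
have et0 : 0 <= e * t by rewrite mulr_ge0// ltW.
have S0 : (0 <= \esum_(m in setT)
    (\1_(started (arrival_act i s) (arrival_pos i s) t m) c)%:E :> \bar R)%E.
  exact: esum_ge0.
have [cB|cB] := pselect (B c); last first.
  rewrite indicE memNset// mule0 adde0; apply: le_trans (leeDl _ S0).
  by rewrite lee_fin leNgt; apply/negP.
rewrite indicE mem_set// mule1 -addeA; apply: le_trans (leeDr _ _); last first.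
  by rewrite lee_fin.
apply: (@le_trans _ _ (arrived t c)%:R%:E).
  by rewrite lee_fin ler_nat /arrived (arrived_customers c0 ca cy i t0) leq_addr.
rewrite count_set_esum; last exact: finite_arrived.
rewrite -nneseries_esumT// (nneseries_split 0 (x0 i + s))//= add0n; apply: leeD.
  apply: (@le_trans _ _ (\sum_(0 <= k < x0 i + s) 1%:E)%E).
    by apply: lee_sum => k _; rewrite lee_fin indicE lern1 leq_b1.
  by rewrite sumEFin sumr_const_nat subn0.
rewrite -nneseries_addn// -nneseries_esumT//; apply: lee_nneseries => // m _.
rewrite lee_fin.
have [h|h] := leP (arrival x0 c i (m + (x0 i + s))) t; last first.
  by rewrite indicE memNset//= => ht; move: h; rewrite ltNge ht.
rewrite [leRHS]indicE mem_set; first by rewrite indicE ler_nat leq_b1.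
split; first exact: renewal_time_ge0.
apply: le_trans h; rewrite addnC -addnA arrivalE.
exact: renewal_time_homo.
Qed.

End customer_balance.

(** The number of unserved customers has a limit law, hence is o(t) in probability; it
    is bounded by the number of arrivals, which is uniformly integrable on the scale
    of t. *)
Lemma mean_unserved_rate i :
  fine (\int[PP]_c (unserved i t c)%:R%:E) / t @[t --> +oo] --> (0 : R).
Proof.
have [K mK0] : exists K, 0 < trunc_mean (clock_law (interarrival i 0)) K.
  have l0 : 0 < (lambda i)^-1 by rewrite invr_gt0.
  have /cvgr_gt/(_ _ l0) := trunc_mean_cvg (arrival_mean i).
  by move=> [K _ /(_ K (leqnn K)) hK]; exists K.
set mK := trunc_mean _ K in mK0.
apply/cvgrPdist_le => eta eta0.
(* The bound of [mean_unserved_le] has three terms.  The arrivals beyond the rank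
   s = cc t are worth at most 2 t C / (cc mK) = e t, where C exceeds the rate of the
   arrivals, and the event of probability at most delta is worth
   (1 + cc) t delta = e t; here e = eta / 3. *)
pose C : R := lambda i + 1.
have C0 : 0 < C by rewrite addr_gt0.
pose cc : R := 6 * C / (mK * eta).
have cc0 : 0 < cc by rewrite divr_gt0 ?mulr_gt0.
pose e : R := eta / 3.
have e0 : 0 < e by rewrite divr_gt0.
pose delta : R := eta / (3 * (1 + cc)).
have delta0 : 0 < delta by rewrite divr_gt0// mulr_gt0// addr_gt0.
pose A (L : nat) := [set y : state n | (L < Defs.orbit y i + queue y i)%N].
have [L QL] : exists L, fine (Q (Y @^-1` A L)) < delta.
  have /cvgr_lt/(_ _ delta0) := @nat_tail_cvg _ _ _ Q _
    (fun L => measurable_countable_preimage (A L) steady.1).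
  by move=> [L _ /(_ L (leqnn L)) hL]; exists L.
have [_ /cvgr_lt/(_ _ QL)] := (I, @law_cvg (A L)).
move=> PL.
have : \forall t \near +oo, fine (n_arrivals i 0 t) / t < C.
  by have /cvgr_lt := @arrival_rate i; apply; rewrite ltrDl.
move=> rate.
near=> t.
have t_gt0 : 0 < t by near: t; apply: nbhs_pinfty_gt; rewrite num_real.
have t0 := ltW t_gt0.
have tK : K%:R <= t by near: t; apply: nbhs_pinfty_ge; rewrite num_real.
have tx : (x0 i)%:R <= t by near: t; apply: nbhs_pinfty_ge; rewrite num_real.
have tL : L%:R <= e * t.
  by rewrite mulrC -ler_pdivrMr//; near: t; apply: nbhs_pinfty_ge; rewrite num_real.
rewrite sub0r normrN ger0_norm; last first.
  by rewrite divr_ge0// fine_ge0//; apply: integral_ge0 => c _; rewrite lee_fin.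
rewrite ler_pdivrMr//.
pose s := Num.truncn (cc * t).
have cct : 0 <= cc * t by rewrite mulr_ge0// ltW.
have /andP[s_le s_lt] : s%:R <= cc * t < s.+1%:R by rewrite truncn_itv.
apply: (le_trans (mean_unserved_le i s t0 e0)).
have na : fine (n_arrivals i 0 t) <= C * t.
  by rewrite -ler_pdivrMr// ltW//; near: t.
have late : fine (n_arrivals i s t) <= e * t.
  have hl := @late_arrivals i K s t mK0 t0.
  apply: (le_trans hl); rewrite -/mK ler_pdivrMr//.
  have h1 : fine (n_arrivals i 0 t) / s.+1%:R <= C / cc.
    rewrite ler_pdivrMr//; apply: (le_trans na).
    rewrite mulrAC ler_pdivlMr// -mulrA; apply: ler_wpM2l; first exact: ltW.
    by rewrite mulrC ltW.
  apply: (@le_trans _ _ ((2 * t) * (C / cc))).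
    apply: ler_pM => //; first by rewrite addr_ge0.
      by rewrite divr_ge0// fine_ge0//; exact: esum_ge0.
    by lra.
  rewrite le_eqVlt; apply/orP; left; apply/eqP.
  rewrite /cc /e; field.
  by rewrite !gt_eqF.
have few : (x0 i + s)%:R * fine (PP [set c | e * t < (unserved i t c)%:R]) <= e * t.
  apply: (@le_trans _ _ (((1 + cc) * t) * delta)).
    apply: ler_pM => //; first by rewrite fine_ge0.
      by rewrite natrD mulrDl mul1r lerD.
    apply: (@le_trans _ _ (fine (PP [set c | A L (state_at x0 c t)]))); last by apply: ltW; near: t.
    have mU : measurable [set c : Om | e * t < (unserved i t c)%:R].
      rewrite (_ : mkset _ = [set c | exists k, unserved i t c = k /\ e * t < k%:R]).
        apply: measurable_set_exists => k; apply: measurable_set_and.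
          exact: nat_measurable_unserved.
        exact: measurable_set_cst.
      by apply/seteqP; split => c /= => [h|[k [<-]]//]; exists (unserved i t c).
    have mAL := measurable_state_event t (A L).
    apply: fine_le; rewrite ?fin_num_measure//.
    apply: le_measure; rewrite ?inE//.
    move=> c /= h; rewrite /A /= !ffunE -(ltr_nat R).
    exact: le_lt_trans tL h.
  rewrite le_eqVlt; apply/orP; left; apply/eqP.
  rewrite /delta /e; field.
  by rewrite gt_eqF// addr_gt0.
rewrite (_ : eta = e + e + e); last by rewrite /e; lra.
by rewrite !mulrDl; lra.
Unshelve. all: by end_near. Qed.

(** Up to a bounded term the mean numbers of arrivals and of started services differ by
    the mean number of unserved customers, which is o(t): their rates agree. *)
Lemma visit_prob i : period_prob InVisit i = load lambda lawB i.
Proof.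
have mB := meanB_gt0 i.
have V0 : (t^-1 : R) @[t --> +oo] --> (0 : R).
  by apply/gtr0_cvgV0; [apply: nbhs_pinfty_gt; rewrite num_real|exact: cvg_id].
have : fine (n_services i t) / t @[t --> +oo] --> lambda i.
  have : ((x0 i)%:R - 1) * t^-1 + fine (n_arrivals i 0 t) / t -
      fine (\int[PP]_c (unserved i t c)%:R%:E) / t @[t --> +oo] -->
      ((x0 i)%:R - 1) * 0 + lambda i - 0.
    apply: cvgB; last exact: mean_unserved_rate.
    by apply: cvgD; [exact: cvgMl_tmp|exact: arrival_rate].
  rewrite mulr0 add0r subr0; apply: cvg_eq_ge0 => t t0.
  rewrite -mulrDl -mulrBl; congr (_ * _).
  have := @mean_arrived i t t0; have := @unserved_balance i t t0.
  rewrite -(fineK (@mean_arrived_fin i t t0)) -(fineK (@unserved_arrived_fin i t t0)).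
  rewrite -(fineK (@n_arrivals_fin i 0 t t0)) -(fineK (@n_services_fin i t t0)).
  by rewrite -!EFinD => -[h1] [h2]; lra.
move=> sl; have li : lambda i = period_prob InVisit i / mean (lawB i).
  by apply: (cvg_unique _ sl) => //; exact: service_rate.
by rewrite /load li mulfVK// gt_eqF.
Qed.

Lemma phase_mean1 (s : phase) i : phase_mean Q Y (cst 1) s i = (period_prob s i)%:E.
Proof.
have mI : measurable (in_period Y s i) by apply: measurable_in_period; exact: steady.1.
rewrite /phase_mean /period_prob fineK ?fin_num_measure//.
under eq_integral do rewrite /= mul1r.
by rewrite integral_indic ?setIT.
Qed.

Lemma period_prob_sum :
  \sum_i (period_prob InVisit i + period_prob InGlue i + period_prob InSwitch i) = 1.
Proof.
apply: EFin_inj; rewrite -sumEFin.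
transitivity (\int[Q]_o (cst 1 (Y o))%:E)%E; last first.
  transitivity (\int[Q]_o cst 1%:E o)%E => //.
  by rewrite integral_cst// [X in (_ * X)%E]probability_setT mule1.
rewrite phase_decomposition//; last exact: steady.1.
apply: eq_bigr => i _; rewrite !EFinD.
by rewrite !phase_mean1.
Qed.

Hypothesis load_lt1 : total_load lambda lawB < 1.

(** The fractions of time add up to 1: rho + cycle_rate * (sum of the mean glue and
    switchover times) = 1. *)
Lemma cycle_rateE : cycle_rate = (mean_cycle lambda gamma lawB lawS)^-1.
Proof.
have := period_prob_sum.
rewrite (eq_bigr (fun i => load lambda lawB i +
   (mean_glue gamma i + mean (lawS i)) * cycle_rate)); last first.
  by move=> i _; rewrite visit_prob glue_prob switch_prob mulrDl addrA.
rewrite big_split/= -mulr_suml -/(total_load lambda lawB) => h.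
have l1 : 1 - total_load lambda lawB != 0 by rewrite subr_eq0 gt_eqF.
rewrite /mean_cycle invf_div; move: h.
set S := \sum_i _ => h.
have S0 : S != 0.
  by apply: contra_neq l1 => S0; rewrite -h S0 mul0r addr0 subrr.
by rewrite -h [total_load _ _ + _]addrC addrK mulrC mulKf.
Qed.

Lemma glue_fraction i :
  period_prob InGlue i = mean_glue gamma i / mean_cycle lambda gamma lawB lawS.
Proof. by rewrite glue_prob cycle_rateE. Qed.

Lemma switch_fraction i :
  period_prob InSwitch i = mean (lawS i) / mean_cycle lambda gamma lawB lawS.
Proof. by rewrite switch_prob cycle_rateE. Qed.

(** The queues and the customers in service follow the phase along almost every path,
    hence also in the limit. *)
Lemma steady_structure : {ae Q, forall o,
  [/\ forall i, in_service (Y o) i = `[< in_phase InVisit i (Y o) >] :> nat,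
      forall i, st_station (Y o) <> i -> queue (Y o) i = 0%N &
      st_phase (Y o) = InSwitch -> forall i, queue (Y o) i = 0%N]}.
Proof.
apply: (@ae_steady [set y | [/\ forall i, in_service y i = `[< in_phase InVisit i y >] :> nat,
  forall i, st_station y <> i -> queue y i = 0%N &
  st_phase y = InSwitch -> forall i, queue y i = 0%N]]) => t t0.
apply: filterS ae_good => c [c0 ca cy]; split => [i|i|].
- by rewrite /= ffunE (in_service_atE c0 cy _ t0).
- by rewrite /= ffunE (queue_atE c0 ca cy _ t0) => /eqP/negPf ->.
- by move=> /= ph i; rewrite ffunE (queue_at_switchover c0 ca cy).
Qed.

(** * Mean station sizes *)

Let mY : forall y, measurable (Y @^-1` [set y]) := steady.1.
Lemma mean_cycle_gt0 : 0 < mean_cycle lambda gamma lawB lawS.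
Proof.
rewrite divr_gt0 ?subr_gt0//.
have term_gt0 i : 0 < mean_glue gamma i + mean (lawS i) by rewrite addr_gt0// invr_gt0.
by rewrite (bigD1 ord0)//= ltr_wpDr// sumr_ge0// => i _; rewrite ltW.
Qed.

Lemma period_prob_gt0 (s : phase) i : 0 < period_prob s i.
Proof.
case: s.
- by rewrite glue_fraction divr_gt0 ?invr_gt0 ?mean_cycle_gt0.
- by rewrite visit_prob mulr_gt0.
- by rewrite switch_fraction divr_gt0// mean_cycle_gt0.
Qed.

Lemma period_probK (s : phase) i (x : \bar R) :
  ((period_prob s i)%:E * ((fine (Q (in_period Y s i)))^-1%:E * x) = x)%E.
Proof.
by rewrite muleA -EFinM mulfV ?mul1e// gt_eqF// period_prob_gt0.
Qed.

(** Only the values on the period matter. *)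
Lemma eq_phase_mean (g h : state n -> R) (s : phase) i :
  (forall y, 0 <= g y) -> (forall y, 0 <= h y) ->
  {ae Q, forall o, in_phase s i (Y o) -> g (Y o) = h (Y o)} ->
  phase_mean Q Y g s i = phase_mean Q Y h s i.
Proof.
move=> g0 h0 gh; apply: ge0_ae_eq_integral => //.
- exact: measurable_phase_mean.
- exact: measurable_phase_mean.
- by move=> o _; rewrite lee_fin mulr_ge0.
- by move=> o _; rewrite lee_fin mulr_ge0.
apply: filterS gh => o gho _; congr (_%:E); rewrite indicE.
by have [/set_mem/gho ->//|_] := boolP (o \in _); rewrite !mulr0.
Qed.

Lemma phase_mean0 (s : phase) i : phase_mean Q Y (cst 0) s i = 0%E.
Proof.
by rewrite /phase_mean; under eq_integral do rewrite /= mul0r; rewrite integral0.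
Qed.

Lemma total_queueE (y : state n) i :
  (forall j : 'I_n.+1, st_station y <> j -> queue y j = 0%N) -> st_station y = i ->
  total_queue y = queue y i.
Proof.
move=> qy yi; rewrite /total_queue (bigD1 i)//= big1 ?addn0// => j /eqP ji.
by apply: qy; rewrite yi => /esym.
Qed.

Lemma mean_orbit_periods i : mean_orbit Q Y i =
  (\sum_k ((load lambda lawB k)%:E * Psi (R_v Q Y k) (unit_index i) 0
     + (mean_glue gamma k / mean_cycle lambda gamma lawB lawS)%:E *
         Psi (R_g Q Y k) (unit_index i) 0
     + (mean (lawS k) / mean_cycle lambda gamma lawB lawS)%:E *
         Psi_s (R_s Q Y k) (unit_index i)))%E.
Proof.
rewrite /mean_orbit unlock.
rewrite (@phase_decomposition _ _ _ _ Q _ mY (fun y => (Defs.orbit y i)%:R))//.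
apply: eq_bigr => k _; rewrite -visit_prob -glue_fraction -switch_fraction.
rewrite /R_v /R_g /R_s (Psi_orbit Q mY InVisit) (Psi_orbit Q mY InGlue).
by rewrite (Psi_s_orbit Q mY InSwitch) !period_probK.
Qed.

(** The queue of station i is empty outside the glue and visit periods of i, where it is
    the only one. *)
Lemma mean_orbit_queue_periods i : mean_orbit_queue Q Y i =
  (mean_orbit Q Y i + (load lambda lawB i)%:E * Psi (R_v Q Y i) zero_index 1
   + (mean_glue gamma i / mean_cycle lambda gamma lawB lawS)%:E *
       Psi (R_g Q Y i) zero_index 1)%E.
Proof.
have queue_visited (s : phase) : phase_mean Q Y (fun y => (queue y i)%:R) s i =
    phase_mean Q Y (fun y => (total_queue y)%:R) s i.
  apply: eq_phase_mean => //; apply: filterS steady_structure => o [_ qo _] [_ oi].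
  by rewrite (total_queueE qo oi).
have queue_elsewhere (s : phase) (k : 'I_n.+1) : k != i ->
    phase_mean Q Y (fun y => (queue y i)%:R) s k = 0%E.
  move=> ki; rewrite -(phase_mean0 s k); apply: eq_phase_mean => //.
  apply: filterS steady_structure => o [_ qo _] [_ ok].
  by rewrite qo// ok; exact/eqP.
have queue_switch : phase_mean Q Y (fun y => (queue y i)%:R) InSwitch i = 0%E.
  rewrite -(phase_mean0 InSwitch i); apply: eq_phase_mean => //.
  by apply: filterS steady_structure => o [_ _ qo] [os _]; rewrite qo.
rewrite -visit_prob -glue_fraction /R_v /R_g (Psi_queue Q mY InVisit) (Psi_queue Q mY InGlue).
rewrite !period_probK -addeA.
have <- : (\int[Q]_o (queue (Y o) i)%:R%:E =
    phase_mean Q Y (fun y => (total_queue y)%:R) InVisit i +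
    phase_mean Q Y (fun y => (total_queue y)%:R) InGlue i)%E.
  rewrite (@phase_decomposition _ _ _ _ Q _ mY (fun y => (queue y i)%:R))// (bigD1 i)//=.
  rewrite big1 ?adde0; last by move=> k ki; rewrite !queue_elsewhere// !adde0.
  by rewrite queue_switch adde0 !queue_visited.
rewrite /mean_orbit_queue /mean_orbit unlock -ge0_integralD//.
- by apply: eq_integral => o _; rewrite natrD.
- exact: (measurable_of_state mY (fun y => (Defs.orbit y i)%:R%:E)).
- exact: (measurable_of_state mY (fun y => (queue y i)%:R%:E)).
Qed.

Lemma mean_station_load i : mean_station Q Y i =
  (mean_orbit_queue Q Y i + (load lambda lawB i)%:E)%E.
Proof.
have -> : (load lambda lawB i)%:E = (\int[Q]_o (in_service (Y o) i)%:R%:E)%E.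
  have mI : measurable (in_period Y InVisit i) by exact: measurable_in_period.
  rewrite -visit_prob fineK ?fin_num_measure// -[in LHS](setIT (in_period _ _ _)).
  rewrite -integral_indic//; apply: ge0_ae_eq_integral => //.
  - by apply/measurable_EFinP; exact: measurable_indic.
  - exact: (measurable_of_state mY (fun y => (in_service y i)%:R%:E)).
  - apply: filterS steady_structure => o [so _ _] _; rewrite so indicE.
    congr ((nat_of_bool _)%:R%:E).
rewrite /mean_station /mean_orbit_queue unlock -ge0_integralD//.
- by apply: eq_integral => o _; rewrite natrD.
- exact: (measurable_of_state mY (fun y => (Defs.orbit y i + queue y i)%N%:R%:E)).
- exact: (measurable_of_state mY (fun y => (in_service y i)%:R%:E)).
Qed.

End steady_limits.

End polling_families.

Theorem mainTheorem11 (R : realType) (n : nat)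
    (lambda gamma nu : 'I_n.+1 -> R)
    (lawB lawS : 'I_n.+1 -> probability R R)
    (d : measure_display) (T : measurableType d) (P : probability T R)
    (X : clock n -> {RV P >-> R}) (x0 : 'I_n.+1 -> nat)
    (d' : measure_display) (T' : measurableType d') (Q : probability T' R)
    (Y : T' -> state n)
    (lambda_gt0 : forall i, 0 < lambda i)
    (gamma_gt0 : forall i, 0 < gamma i)
    (nu_gt0 : forall i, 0 < nu i)
    (lawB_duration : forall i, duration_law (lawB i))
    (lawS_duration : forall i, duration_law (lawS i))
    (load_gt0 : forall i, 0 < load lambda lawB i)
    (total_load_lt1 : total_load lambda lawB < 1)
    (meanS_gt0 : forall i, 0 < mean (lawS i))
    (primitives : polling_primitives lambda gamma nu lawB lawS X)
    (steady : steady_state X x0 Q Y) :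
  let rho := load lambda lawB in
  let EC := mean_cycle lambda gamma lawB lawS in
  let EG := mean_glue gamma in
  let ES := fun k => mean (lawS k) in
  forall i : 'I_n.+1,
    [/\ mean_orbit Q Y i =
          (\sum_k ((rho k)%:E * Psi (R_v Q Y k) (unit_index i) 0
                   + (EG k / EC)%:E * Psi (R_g Q Y k) (unit_index i) 0
                   + (ES k / EC)%:E * Psi_s (R_s Q Y k) (unit_index i)))%E,
        mean_orbit_queue Q Y i =
          (mean_orbit Q Y i
           + (rho i)%:E * Psi (R_v Q Y i) zero_index 1
           + (EG i / EC)%:E * Psi (R_g Q Y i) zero_index 1)%E
      & mean_station Q Y i =
          (mean_orbit_queue Q Y i + (rho i)%:E)%E].
Proof.
move=> rho EC EG ES i.
have meanB_gt0 k : 0 < mean (lawB k) by have := load_gt0 k; rewrite pmulr_rgt0.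
split.
- exact: (mean_orbit_periods lambda_gt0 gamma_gt0 nu_gt0 lawB_duration lawS_duration
    meanB_gt0 meanS_gt0 primitives steady total_load_lt1).
- exact: (mean_orbit_queue_periods lambda_gt0 gamma_gt0 nu_gt0 lawB_duration lawS_duration
    meanB_gt0 meanS_gt0 primitives steady total_load_lt1).
- exact: (mean_station_load lambda_gt0 gamma_gt0 nu_gt0 lawB_duration lawS_duration
    meanB_gt0 primitives steady).
Qed.
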